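(* Let $\frac12\le m<1$, $m_1=2m-1$, $\alpha=2-m$. Let $s_1,l_1>1$ satisfy $\frac3{s_1}+\frac2{l_1}=4$ and $$\frac3{3-m}=\frac3{\alpha+1}<s_1<\frac32,$$ and put $\gamma_*=1-\big(\frac3{2s_1}-1\big)(1-m)$. Let $U=(U_r,0,U_3)$ be an axisymmetric vector field on $\mathbb R^3$ without swirl and $P$ an axisymmetric function on $\mathbb R^3$ satisfying the self-similar Euler system $$\frac{\alpha}{\alpha+1}U_r+\frac1{\alpha+1}\big(rU_{r,r}+y_3U_{r,3}\big)+U_rU_{r,r}+U_3U_{r,3}+P_{,r}=0,$$ $$\frac{\alpha}{\alpha+1}U_3+\frac1{\alpha+1}\big(rU_{3,r}+y_3U_{3,3}\big)+U_rU_{3,r}+U_3U_{3,3}+P_{,3}=0,$$ $$\frac1r(rU_r)_{,r}+U_{3,3}=0 .$$ Assume that $$\sup_{b>1}\Bigg(\frac1{b^{m_1}}\int_{\mathcal C(b)}|U|^2dx+\frac1{b^m}\int_{\mathcal C(b)}|\nabla U|^2dx+\frac1{b^{\gamma_*l_1}}\Big(\int_{\mathcal C(b)}|\nabla^2U|^{s_1}dx\Big)^{l_1/s_1}\Bigg)<\infty,$$ and that there are constants $c_2,c$ with $|U(y)|\le c_2$ and $|\nabla U(y)|\le c$ for $y\in\mathbb R^3$. Then $U\equiv0$.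
   Context: Cylindrical coordinates $(r,\vartheta,y_3)$ in $\mathbb R^3$, $r=|y'|$, $y'=(y_1,y_2,0)$; $U=U_re_r+U_3e_3$ with $U_r,U_3,P$ independent of $\vartheta$; commas denote partial derivatives ($U_{r,3}=\partial_{y_3}U_r$, etc.). $\mathcal C(b)=\{|y'|<b,\ |y_3|<b\}$. The system (understood in the sense of distributions) expresses that $$u(x,t)=\frac1{(-t)^{\alpha/(\alpha+1)}}U(y),\qquad p(x,t)=\frac1{(-t)^{2\alpha/(\alpha+1)}}P(y),\qquad y=\frac{x}{(-t)^{1/(\alpha+1)}},$$ solves the Euler equations $\partial_tu+u\cdot\nabla u+\nabla p=0$, ${\rm div}\,u=0$ in $\mathbb R^3\times]-\infty,0[$. *)

(* Defs.v *)
From HB Require Import structures.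
From mathcomp Require Import all_boot all_order all_algebra.
From mathcomp Require Import all_classical all_reals all_analysis.

Set Implicit Arguments.
Unset Strict Implicit.
Unset Printing Implicit Defensive.

Import Order.TTheory GRing.Theory Num.Theory.
Import numFieldNormedType.Exports.

Local Open Scope classical_set_scope.
Local Open Scope ring_scope.

(* R * R * R carries both the normed-space and the (Borel) product measurable
   structures of the library, so it is used for R^3.  The library norm on it
   is the sup norm, hence the Euclidean lengths are written out below. *)
Notation vec3 R := (R * R * R)%type.

Section R3.
Variable R : realType.
Implicit Types (f g phi : vec3 R -> R) (y : vec3 R) (W : set (vec3 R)).

Definition leb3 : {measure set (measurableTypeR R * measurableTypeR R
                                * measurableTypeR R) -> \bar R} :=
  ((@lebesgue_measure R \x @lebesgue_measure R) \x @lebesgue_measure R)%E.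

Definition coord3 (i : 'I_3) y : R :=
  match val i with 0%N => y.1.1 | 1%N => y.1.2 | _ => y.2 end.

Definition std_basis (i : 'I_3) : vec3 R :=
  ((val i == 0%N)%:R, (val i == 1%N)%:R, (val i == 2%N)%:R).

Definition ix1 : 'I_3 := @Ordinal 3 0 isT.
Definition ix2 : 'I_3 := @Ordinal 3 1 isT.
Definition ix3 : 'I_3 := @Ordinal 3 2 isT.

Definition partial (i : 'I_3) f : vec3 R -> R := fun y => 'D_(std_basis i) f y.

Definition partials (s : seq 'I_3) f : vec3 R -> R := foldr partial f s.

(* C^oo: all iterated partial derivatives exist and are continuous. *)
Definition smooth phi :=
  forall s : seq 'I_3, continuous (partials s phi) /\
    forall (i : 'I_3) y, derivable (partials s phi) y (std_basis i).

Definition test_function W phi :=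
  let supp := closure [set y | phi y != 0] in
  [/\ smooth phi, compact supp & supp `<=` W].

Definition loc_integrable W f :=
  measurable_fun W f /\
  forall K : set (vec3 R), compact K -> K `<=` W ->
    leb3.-integrable K (EFin \o f).

(* Distributions are only ever built from locally integrable functions by
   differentiation and by multiplication by functions smooth on W, and only
   compared on test functions, so linearity and continuity are not recorded. *)
Definition distrib := (vec3 R -> R) -> R.

Implicit Types T S : distrib.

Definition dist_of f : distrib :=
  fun phi => (\int[leb3]_(y in [set: vec3 R]) (f y * phi y))%R.
Definition dist0 : distrib := fun=> 0.
Definition dist_add T S : distrib := fun phi => T phi + S phi.
Definition dist_mul a T : distrib := fun phi => T (fun y => a y * phi y).
Definition dist_partial (i : 'I_3) T : distrib :=
  fun phi => - T (partial i phi).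

Definition dist_eq W T S := forall phi, test_function W phi -> T phi = S phi.

Definition weak_partial (i : 'I_3) f g :=
  [/\ loc_integrable [set: vec3 R] f, loc_integrable [set: vec3 R] g &
      dist_eq [set: vec3 R] (dist_partial i (dist_of f)) (dist_of g)].

Definition weak_gradient (U : vec3 R -> vec3 R)
    (DU : 'I_3 -> 'I_3 -> vec3 R -> R) :=
  forall i j, weak_partial j (fun y => coord3 i (U y)) (DU i j).

Definition weak_hessian (DU : 'I_3 -> 'I_3 -> vec3 R -> R)
    (D2U : 'I_3 -> 'I_3 -> 'I_3 -> vec3 R -> R) :=
  forall i j k, weak_partial k (DU i j) (D2U i j k).

Definition enorm0 (U : vec3 R -> vec3 R) y : R :=
  Num.sqrt (\sum_i coord3 i (U y) ^+ 2).
Definition enorm1 (DU : 'I_3 -> 'I_3 -> vec3 R -> R) y : R :=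
  Num.sqrt (\sum_i \sum_j DU i j y ^+ 2).
Definition enorm2 (D2U : 'I_3 -> 'I_3 -> 'I_3 -> vec3 R -> R) y : R :=
  Num.sqrt (\sum_i \sum_j \sum_k D2U i j k y ^+ 2).

Definition cyl_r y : R := Num.sqrt (y.1.1 ^+ 2 + y.1.2 ^+ 2).

Definition cylinder (b : R) : set (vec3 R) :=
  [set y | cyl_r y < b /\ `|y.2| < b].

Definition off_axis : set (vec3 R) := [set y | 0 < cyl_r y].

(* As 0^-1 = 0, this is the zero vector on the axis. *)
Definition e_r y : vec3 R := (y.1.1 / cyl_r y, y.1.2 / cyl_r y, 0).
Definition e_3 : vec3 R := (0, 0, 1).

Definition axisymmetric f :=
  forall y z, cyl_r y = cyl_r z -> y.2 = z.2 -> f y = f z.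

Definition axisymmetric_no_swirl (U : vec3 R -> vec3 R) (Ur U3 : vec3 R -> R) :=
  [/\ axisymmetric Ur, axisymmetric U3 &
      forall y, U y = Ur y *: e_r y + U3 y *: e_3].

(* d/dr = (y1/r) d/dy1 + (y2/r) d/dy2 ; its coefficients are smooth off the
   axis, which is where cylindrical coordinates are defined. *)
Definition dist_dr T : distrib :=
  dist_add (dist_mul (fun y => y.1.1 / cyl_r y) (dist_partial ix1 T))
           (dist_mul (fun y => y.1.2 / cyl_r y) (dist_partial ix2 T)).
Definition dist_d3 T : distrib := dist_partial ix3 T.

Definition weak_dr f g :=
  [/\ loc_integrable off_axis f, loc_integrable off_axis g &
      dist_eq off_axis (dist_dr (dist_of f)) (dist_of g)].
Definition weak_d3 f g :=
  [/\ loc_integrable off_axis f, loc_integrable off_axis g &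
      dist_eq off_axis (dist_d3 (dist_of f)) (dist_of g)].

(* The products such as Ur * Ur_r need the derivatives of Ur and U3 to be
   functions; P, r Ur and U3 are otherwise differentiated as distributions.
   Testing off the axis loses nothing when U is Lipschitz and P is locally
   integrable on R^3: the axis has codimension 2, hence is removable. *)
Definition selfsimilar_euler (alpha : R) (Ur U3 P : vec3 R -> R) :=
  exists Ur_r Ur_3 U3_r U3_3 : vec3 R -> R,
  [/\ weak_dr Ur Ur_r /\ weak_d3 Ur Ur_3,
      weak_dr U3 U3_r /\ weak_d3 U3 U3_3,
      dist_eq off_axis
        (dist_add
          (dist_of (fun y =>
             alpha / (alpha + 1) * Ur y
             + (alpha + 1)^-1 * (cyl_r y * Ur_r y + y.2 * Ur_3 y)
             + Ur y * Ur_r y + U3 y * Ur_3 y))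
          (dist_dr (dist_of P)))
        dist0,
      dist_eq off_axis
        (dist_add
          (dist_of (fun y =>
             alpha / (alpha + 1) * U3 y
             + (alpha + 1)^-1 * (cyl_r y * U3_r y + y.2 * U3_3 y)
             + Ur y * U3_r y + U3 y * U3_3 y))
          (dist_d3 (dist_of P)))
        dist0 &
      dist_eq off_axis
        (dist_add
          (dist_mul (fun y => (cyl_r y)^-1)
             (dist_dr (dist_of (fun y => cyl_r y * Ur y))))
          (dist_d3 (dist_of U3)))
        dist0].

End R3.

(* Main.v *)
Require Import Defs.
From HB Require Import structures.
From mathcomp Require Import all_boot all_order all_algebra.
From mathcomp Require Import all_classical all_reals all_analysis.
From mathcomp Require Import measurable_realfun.
From mathcomp Require Import ring lra.

Set Implicit Arguments.
Unset Strict Implicit.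
Unset Printing Implicit Defensive.

Import Order.TTheory GRing.Theory Num.Theory.
Import numFieldNormedType.Exports.

Local Open Scope classical_set_scope.
Local Open Scope ring_scope.

(** The profile solves the stationary self-similar Euler system with drift
    V = U + bt y, where bt = 1 / (alpha + 1). Two facts force it to vanish: its
    vorticity is zero, and a curl-free, divergence-free field of small energy
    growth is zero. The first step uses the bounds on U and its gradient, the second
    one the growth of the local energy.

    Vorticity. Write Lam = r (d_3 U_r - d_r U_3), mu = U_r / r, lam = mu + bt and
    k = (alpha - 1) / (alpha + 1). Testing the momentum equation with a
    divergence-free field removes the pressure and the Bernoulli gradient, and
    leaves the transport equation
      V . grad Lam = (2 lam - k - 3 bt) Lam
    ([vorticity_pointwise]); the square satisfies, in weak form,
      integral Lam^2 (V . grad phi + (4 lam - kappa) phi) = 0,  kappa = 2 k + 3 bt > 0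
    ([nullint_vorticity_sq]). Since V is radial with factor lam in the horizontal
    plane, phi = chi / r^4 cancels the term 4 lam, and only -kappa is left. The
    cutoff chi contributes with a sign, because V points outwards far away. The
    singularity of 1 / r^4 on the axis is harmless: as the gradient is bounded,
    Lam^2 = O(r^2), so a cutoff of width delta costs delta^2 delta^-2 = O(1); this
    bound makes Lam^2 / r^4 locally integrable, after which the cost tends to 0.
    Hence Lam = 0 ([rvort_eq0]). As alpha > 1, both k and bt are positive.

    Energy. When Lam = 0 the nonlinearity is the gradient of |U|^2 / 2. Testing
    with f y, where f is a cutoff of (1 + |y|^2)^(-1/2) at radius R, yields
      integral |U|^2 (1 + |y|^2)^(-3/2) over the ball of radius R
        <= (C / R) integral |U|^2 over the ball of radius 2 R,
    which is O(R^(m1 - 1)) and tends to 0 since m1 < 1 ([usq_eq0]).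

    Reduction. Everything is done in Cartesian coordinates. The cylindrical
    derivatives of the hypothesis are identified with combinations of the
    Cartesian ones by testing with functions multiplied by r or r^2, which cancel
    the singular coefficients ([rad2Ur_r] and its companions). The ratio mu is
    bounded because U_1 is odd in y_1 and has bounded derivative ([ang_bound]).

    Analysis. The argument needs the fundamental lemma of the calculus of
    variations ([flcv]), the fundamental theorem of calculus for weak derivatives
    ([weak_FTC]) and the Leibniz rule for products of locally bounded weakly
    differentiable functions ([wderivM]). Test functions are taken from an explicit
    class of smooth functions closed under partial derivatives ([elem]), and
    averages along segments take the place of mollifiers. *)

(** * Integrals of real-valued functions *)

Section generic.
Context d (X : measurableType d) (R : realType) (mu : {measure set X -> \bar R}).
Implicit Types f g h : X -> R.

Definition itg f := mu.-integrable setT (EFin \o f).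

Lemma ae1 (P Q : X -> Prop) : {ae mu, forall x, P x} -> (forall x, P x -> Q x) ->
  {ae mu, forall x, Q x}.
Proof. by move=> aP PQ; apply: filterS aP => x; exact: PQ. Qed.

Lemma ae2 (P Q S : X -> Prop) : {ae mu, forall x, P x} -> {ae mu, forall x, Q x} ->
  (forall x, P x -> Q x -> S x) -> {ae mu, forall x, S x}.
Proof. by move=> aP aQ PQ; apply: filterS2 aP aQ => x; exact: PQ. Qed.

Lemma ae3 (P Q S W : X -> Prop) : {ae mu, forall x, P x} -> {ae mu, forall x, Q x} ->
  {ae mu, forall x, S x} -> (forall x, P x -> Q x -> S x -> W x) -> {ae mu, forall x, W x}.
Proof. by move=> aP aQ aS PQ; apply: filterS3 aP aQ aS => x; exact: PQ. Qed.

Lemma itg_meas f : itg f -> measurable_fun setT f.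
Proof. by move=> /measurable_int /measurable_EFinP. Qed.

Lemma itg_dom f g : measurable_fun setT f -> itg g ->
  (forall x, `|f x| <= g x) -> itg f.
Proof.
move=> mf ig fg; apply: le_integrable ig => //; first exact/measurable_EFinP.
by move=> x _ /=; rewrite lee_fin (le_trans (fg x))// ler_norm.
Qed.

Lemma itgD f g : itg f -> itg g -> itg (fun x => f x + g x).
Proof. by move=> fi gi; have := integrableD measurableT fi gi. Qed.

Lemma itgB f g : itg f -> itg g -> itg (fun x => f x - g x).
Proof. by move=> fi gi; have := integrableB measurableT fi gi. Qed.

Lemma itgZ k f : itg f -> itg (fun x => k * f x).
Proof. by move=> fi; have := integrableZl measurableT k fi. Qed.

Lemma itg_norm f : itg f -> itg (fun x => `|f x|).
Proof. by move=> fi; have := integrable_norm fi. Qed.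

Lemma itg_ext f g : (forall x, f x = g x) -> itg f -> itg g.
Proof. by move=> /funext ->. Qed.

Lemma itg_ae f g : measurable_fun setT g -> itg f ->
  {ae mu, forall x, f x = g x} -> itg g.
Proof.
move=> mg fi fg; have mf := itg_meas fi.
apply/integrableP; split; first exact/measurable_EFinP.
have /integrableP[_] := fi; congr (_ < _)%E.
apply: ae_eq_integral => //.
- by apply: measurableT_comp => //; exact/measurable_EFinP.
- by apply: measurableT_comp => //; exact/measurable_EFinP.
- by apply: filterS fg => x /= -> _.
Qed.

Lemma I_ae f g : measurable_fun setT f -> measurable_fun setT g ->
  {ae mu, forall x, f x = g x} ->
  \int[mu]_(x in setT) f x = \int[mu]_(x in setT) g x.
Proof.
move=> mf mg fg; rewrite /Rintegral; congr fine.
apply: ae_eq_integral => //; [exact/measurable_EFinP|exact/measurable_EFinP|].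
by apply: filterS fg => x /= -> _.
Qed.

Lemma ID f g : itg f -> itg g ->
  \int[mu]_(x in setT) (f x + g x) =
  \int[mu]_(x in setT) f x + \int[mu]_(x in setT) g x.
Proof. exact: RintegralD. Qed.

Lemma IB f g : itg f -> itg g ->
  \int[mu]_(x in setT) (f x - g x) =
  \int[mu]_(x in setT) f x - \int[mu]_(x in setT) g x.
Proof. exact: RintegralB. Qed.

Lemma IZ k f : itg f ->
  \int[mu]_(x in setT) (k * f x) = k * \int[mu]_(x in setT) f x.
Proof. exact: RintegralZl. Qed.

Lemma I_ext f g : (forall x, f x = g x) ->
  \int[mu]_(x in setT) f x = \int[mu]_(x in setT) g x.
Proof. by move=> /funext ->. Qed.

Lemma I_le f g : itg f -> itg g -> (forall x, f x <= g x) ->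
  \int[mu]_(x in setT) f x <= \int[mu]_(x in setT) g x.
Proof. by move=> fi gi fg; apply: le_Rintegral. Qed.

Lemma I_ge0 f : (forall x, 0 <= f x) -> 0 <= \int[mu]_(x in setT) f x.
Proof. by move=> f0; apply: Rintegral_ge0. Qed.

Lemma I_norm f : itg f ->
  `|\int[mu]_(x in setT) f x| <= \int[mu]_(x in setT) `|f x|.
Proof. by move=> fi; apply: le_normr_Rintegral. Qed.

Lemma I_EFin f : itg f ->
  (\int[mu]_(x in setT) f x)%:E = (\int[mu]_x (f x)%:E)%E.
Proof. by move=> fi; rewrite /Rintegral fineK//; apply: integrable_fin_num. Qed.

Lemma I_eq0 f : itg f -> (forall x, 0 <= f x) ->
  \int[mu]_(x in setT) f x <= 0 -> {ae mu, forall x, f x = 0}.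
Proof.
move=> fi f0 If.
have E : (\int[mu]_(x in setT) `|(EFin \o f) x| = 0)%E.
  under eq_integral do rewrite /= ger0_norm//.
  rewrite -I_EFin//; congr EFin; apply/eqP; rewrite eq_le If/=.
  exact: I_ge0.
have mf : measurable_fun setT (EFin \o f) by exact/measurable_EFinP/itg_meas.
have /(ae_eq_integral_abs mu measurableT mf) := E.
by apply: filterS => x /(_ I) [].
Qed.

(** Dominated convergence in the form used throughout: the domination holds
    everywhere, the convergence almost everywhere. *)
Lemma I_dct (F : nat -> X -> R) f g : (forall n, measurable_fun setT (F n)) ->
  measurable_fun setT f -> itg g ->
  (forall n x, `|F n x| <= g x) ->
  {ae mu, forall x, F n x @[n --> \oo] --> f x} ->
  itg f /\ (\int[mu]_(x in setT) F n x) @[n --> \oo] --> \int[mu]_(x in setT) f x.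
Proof.
move=> mF mf gi Fg Ff.
have [] := @dominated_convergence _ X R mu setT measurableT
  (fun n => EFin \o F n) (EFin \o f) (EFin \o g) _ _ _ gi _.
- by move=> n; exact/measurable_EFinP.
- exact/measurable_EFinP.
- apply: filterS Ff => x /= Fx _; apply: cvg_EFin; [exact: nearW|exact: Fx].
- by apply: aeW => x n _ /=; rewrite lee_fin.
move=> fi _ cv; split => //.
apply: fine_cvg; rewrite /= fineK//; exact: integrable_fin_num.
Qed.

End generic.

(** * Lebesgue measure on R^3: sigma-finiteness and translations *)

Section sigma_finite_instances.
Context d1 d2 (T1 : measurableType d1) (T2 : measurableType d2) (R : realType).
Variable m1 : {sigma_finite_measure set T1 -> \bar R}.
Variable m2 : {sigma_finite_measure set T2 -> \bar R}.

(** The product of two sigma-finite measures is again sigma-finite; the copy under a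
    new name lets a triple product carry that structure, which Fubini's theorem
    requires. *)
Definition sprod := (m1 \x m2)%E.

HB.instance Definition _ := Measure.copy sprod (m1 \x m2)%E.

Lemma sprod_sigma_finite : sigma_finite setT sprod.
Proof.
have /sigma_finiteP[F [TF ndF Foo]] := sigma_finiteT m1.
have /sigma_finiteP[G [TG ndG Goo]] := sigma_finiteT m2.
exists (fun n => F n `*` G n).
  rewrite -setXTT TF TG predeqE => -[x y]; split.
    move=> [/= [n _ Fnx] [k _ Gky]]; exists (maxn n k) => //; split.
    - by move: x Fnx; exact/subsetPset/ndF/leq_maxl.
    - by move: y Gky; exact/subsetPset/ndG/leq_maxr.
  by move=> [n _ []/= ? ?]; split; exists n.
move=> k; have [? ?] := Foo k; have [? ?] := Goo k.
split; first exact: measurableX.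
by rewrite /sprod product_measure1E// lte_mul_pinfty// ge0_fin_numE.
Qed.

HB.instance Definition _ := Measure_isSigmaFinite.Build _ _ _ sprod
  sprod_sigma_finite.

End sigma_finite_instances.

Section leb.
Variable R : realType.
Local Notation mu1 := (@lebesgue_measure R).

Definition leb1s : {sigma_finite_measure set (measurableTypeR R) -> \bar R} := mu1.
Definition leb2s : {sigma_finite_measure set (measurableTypeR R
     * measurableTypeR R)%type -> \bar R} := sprod leb1s leb1s.
Definition leb3s : {sigma_finite_measure set (measurableTypeR R * measurableTypeR R
     * measurableTypeR R)%type -> \bar R} := sprod leb2s leb1s.
End leb.

Section translation.
Variable R : realType.
Local Notation T := (vec3 R).
Local Notation mu1 := (@lebesgue_measure R).
Local Notation mu3 := (leb3 R).
Local Notation mT := (measurableTypeR R * measurableTypeR R * measurableTypeR R)%type.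
Local Notation M f := (@measurable_fun _ _ mT _ setT f).

Lemma measurable_shift1 (t : R) : measurable_fun setT (fun x : R => x + t).
Proof. exact: measurable_funD. Qed.

Lemma leb1_shift (t : R) (A : set R) : measurable A ->
  mu1 ((fun x : R => x + t) @^-1` A) = mu1 A.
Proof.
move=> mA.
rewrite -[LHS]/(pushforward mu1 (fun x : R => x + t : measurableTypeR R) A).
apply/esym/lebesgue_measure_unique => //=.
  by move=> *; exact: measurable_shift1.
move=> mt _ [[a b]] _ <-.
rewrite /pushforward.
have key (x : R) : (a < x + t <= b) = (a - t < x <= b - t).
  by apply/andP/andP => -[h1 h2]; split; lra.
have -> : (fun x => x + t) @^-1` `]a, b]%classic = `]a - t, b - t]%classic.
  by apply/seteqP; split => x /=; rewrite !in_itv/= (key x).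
rewrite !lebesgue_measure_itv/= !lte_fin ltrD2r.
by case: ifPn => // _; rewrite -!EFinD; congr EFin; lra.
Qed.

Lemma measurable_shift3 (v : T) : @measurable_fun _ _ mT mT setT (fun x : T => x + v).
Proof.
have -> : (fun x : T => x + v) =
   (fun x => (x.1.1 + v.1.1, x.1.2 + v.1.2, x.2 + v.2)).
  by apply/funext => -[[x y] z].
apply: measurable_fun_pair; first apply: measurable_fun_pair.
- by apply: measurable_funD => //; apply: measurableT_comp.
- by apply: measurable_funD => //; apply: measurableT_comp.
- by apply: measurable_funD.
Qed.

Lemma measurable_preim d1 d2 (X : measurableType d1) (Y : measurableType d2)
  (f : X -> Y) (A : set Y) : measurable_fun setT f -> measurable A ->
  measurable (f @^-1` A).
Proof. by move=> mf mA; rewrite -[X in measurable X]setTI; exact: mf. Qed.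

Local Notation mu2 := (mu1 \x mu1)%E.

Lemma measurable_shift2 (v : R * R) :
  measurable_fun setT (fun x : R * R => (x.1 + v.1, x.2 + v.2)).
Proof.
by apply: measurable_fun_pair; apply: measurable_funD => //; apply: measurableT_comp.
Qed.

Lemma leb2_shift (v : R * R) (A : set (R * R)) : measurable A ->
  mu2 ((fun x : R * R => (x.1 + v.1, x.2 + v.2)) @^-1` A) = mu2 A.
Proof.
move=> mA.
rewrite -[LHS]/(pushforward mu2 (fun x : R * R => (x.1 + v.1, x.2 + v.2)
   : measurableTypeR R * measurableTypeR R) A).
apply/esym/product_measure_unique => //=.
  exact: measurable_shift2.
move=> mt B C mB mC.
rewrite /pushforward -[X in mu2 X]/(((fun x => x + v.1) @^-1` B) `*` ((fun x => x + v.2) @^-1` C)).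
rewrite product_measure1E; [|exact: measurable_preim (measurable_shift1 _) _|exact: measurable_preim (measurable_shift1 _) _].
by congr (_ * _)%E; exact: leb1_shift.
Qed.

Lemma leb3_shift (v : T)
  (A : set (measurableTypeR R * measurableTypeR R * measurableTypeR R)) : measurable A ->
  mu3 ((fun x : T => x + v) @^-1` A) = mu3 A.
Proof.
move=> mA.
pose ph := fun x : T => (x + v
   : measurableTypeR R * measurableTypeR R * measurableTypeR R).
have mph : @measurable_fun _ _ mT mT setT ph by exact: measurable_shift3.
pose mM := (measure_function_pushforward__canonical__measure_function_Measure
  ((mu1 \x mu1)%E \x mu1)%E mph).
have H : (((mu1 \x mu1)%E \x mu1)%E A = pushforward ((mu1 \x mu1)%E \x mu1)%E ph A); last exact: esym H.
apply: (@product_measure_unique _ _ _ _ R (leb2s R) (leb1s R) mM) => //.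
move=> B C mB mC.
rewrite /= /pushforward.
have -> : ph @^-1` (B `*` C) = ((fun x => (x.1 + v.1.1, x.2 + v.1.2)) @^-1` B) `*` ((fun x => x + v.2) @^-1` C) by [].
rewrite product_measure1E; [|exact: measurable_preim (measurable_shift2 _) _|exact: measurable_preim (measurable_shift1 _) _].
by congr (_ * _)%E; [exact: leb2_shift|exact: leb1_shift].
Qed.

Lemma ge0_int_shift (v : T) (f : T -> \bar R) : M f ->
  (forall x, (0 <= f x)%E) ->
  (\int[mu3]_x f ((x : T) + v)%R = \int[mu3]_x f x)%E.
Proof.
move=> mf f0.
pose ph := fun x : T => (x + v
   : measurableTypeR R * measurableTypeR R * measurableTypeR R).
have mph : @measurable_fun _ _ mT mT setT ph by exact: measurable_shift3.
have H := ge0_integral_pushforward mph mu3 measurableT mf (fun y _ => f0 y).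
rewrite preimage_setT in H.
transitivity (\int[pushforward mu3 ph]_y f y)%E; first exact: esym H.
pose mM := (measure_function_pushforward__canonical__measure_function_Measure
  mu3 mph).
have E := @eq_measure_integral _ mT R setT mu3 mM f.
by apply: E => A mA _; exact: leb3_shift.
Qed.

Lemma itg_shift (v : T) (f : T -> R) : itg mu3 f -> itg mu3 (fun x => f (x + v)).
Proof.
move=> fi; have mf := itg_meas fi.
apply/integrableP; split.
  apply/measurable_EFinP; apply: (measurableT_comp mf); exact: measurable_shift3.
rewrite (ge0_int_shift v (f := fun x => `|(f x)%:E|%E))//.
- by have /integrableP[] := fi.
- by apply: measurableT_comp => //; exact/measurable_EFinP.
Qed.

Lemma I_shift (v : T) (f : T -> R) : itg mu3 f ->
  \int[mu3]_(x in setT) f (x + v) = \int[mu3]_(x in setT) f x.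
Proof.
move=> fi; rewrite /Rintegral; congr fine.
have fi' := itg_shift v fi.
rewrite integralE [RHS]integralE.
have mf := itg_meas fi.
rewrite -(ge0_int_shift v (f := (fun x => (f x)%:E)^\+%E))//; last first.
  by apply: measurable_funepos; exact/measurable_EFinP.
rewrite -(ge0_int_shift v (f := (fun x => (f x)%:E)^\-%E))//; last first.
  by apply: measurable_funeneg; exact/measurable_EFinP.
by congr (_ - _)%E; apply: eq_integral => x _; rewrite ?funeposE ?funenegE.
Qed.

End translation.

(** * Averages along segments *)

Section averages.
Variable R : realType.
Local Notation T := (vec3 R).
Local Notation mu1 := (@lebesgue_measure R).
Local Notation mu3 := (leb3 R).
Local Notation mT := (measurableTypeR R * measurableTypeR R * measurableTypeR R)%type.
Local Notation M f := (@measurable_fun _ _ mT R setT f).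

Implicit Types (i : 'I_3) (s t c : R) (g K : T -> R) (v : T).

Lemma measurable_ray (v : T) : measurable_fun setT
  (fun z : mT * measurableTypeR R => ((z.1 : T) + z.2 *: v : T)).
Proof.
have -> : (fun z : T * R => z.1 + z.2 *: v) = (fun z =>
   (z.1.1.1 + z.2 * v.1.1, z.1.1.2 + z.2 * v.1.2, z.1.2 + z.2 * v.2)).
  by apply/funext => -[[[x y] z] s].
apply: measurable_fun_pair; first apply: measurable_fun_pair.
- apply: measurable_funD; last exact: measurable_funM.
  by do 2 apply: measurableT_comp => //.
- apply: measurable_funD; last exact: measurable_funM.
  by do 2 apply: measurableT_comp => //.
- apply: measurable_funD; last exact: measurable_funM.
  by do 1 apply: measurableT_comp => //.
Qed.

(** The integral of [g] over the segment from [x] to [x + t v]. Averages replace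
    mollification: they commute with weak derivatives, and the average of a
    derivative is a difference. *)
Definition avg v (t : R) (g : T -> R) (x : T) : R :=
  \int[mu1]_(s in setT) (\1_(`[0, t]%classic) s * g (x + s *: v)).

Definition kern v (t : R) (K g : T -> R) (z : mT * measurableTypeR R) : R :=
  K z.1 * (\1_(`[0, t]%classic) (z.2 : R) * g ((z.1 : T) + z.2 *: v)).

Lemma measurable_kern v t K g : M K -> M g ->
  measurable_fun setT (kern v t K g).
Proof.
move=> mK mg; apply: measurable_funM; first exact: measurableT_comp.
apply: measurable_funM; last by apply: (measurableT_comp mg); exact: measurable_ray.
by apply: measurableT_comp => //; exact: measurable_indic.
Qed.

Lemma measurable_comp_shift v g : M g -> M (fun x : T => g (x + v)).
Proof. by move=> mg; apply: (measurableT_comp mg); exact: measurable_shift3. Qed.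

Lemma itg_indic_itv t : itg mu1 (\1_(`[0, t]%classic) : R -> R).
Proof. exact: integrable_indic_itv. Qed.

(** Fubini's theorem applies to [kern] when one of the two functions is bounded and
    the other one integrable; both cases occur, since either function may be the
    test function. *)
Definition dual_ok K g := [/\ M K, M g &
  ((exists2 c, forall x, `|K x| <= c & itg mu3 g) \/
   (exists2 c, forall x, `|g x| <= c & itg mu3 K))].

Definition dual_bound K g c := 0 <= c /\ forall v s,
  itg mu3 (fun x => K x * g (x + s *: v)) /\
  \int[mu3]_(x in setT) `|K x * g (x + s *: v)| <= c.

Lemma dual_okP K g : dual_ok K g -> exists c, dual_bound K g c.
Proof.
move=> [mK mg [[c Kc gi]|[c gc Ki]]].
- have c0 : 0 <= c by apply: le_trans (Kc (0,0,0)).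
  exists (c * \int[mu3]_(x in setT) `|g x|); split.
    by rewrite mulr_ge0// I_ge0.
  move=> v s; have i1 : itg mu3 (fun x => K x * g (x + s *: v)).
    apply: (@itg_dom _ _ R mu3 _ (fun x : T => c * `|g (x + s *: v)|)).
    - by apply: measurable_funM => //; exact: measurable_comp_shift.
    - by apply: itgZ; apply: itg_norm; exact: itg_shift.
    - by move=> x; rewrite normrM ler_wpM2r.
  split => //; rewrite -(I_shift (s *: v) (itg_norm gi)) -IZ; last first.
    by apply: itg_norm; exact: itg_shift.
  apply: I_le; [exact: itg_norm| |].
    by apply: itgZ; apply: itg_norm; exact: itg_shift.
  by move=> x; rewrite normrM ler_wpM2r.
- have c0 : 0 <= c by apply: le_trans (gc (0,0,0)).
  exists (c * \int[mu3]_(x in setT) `|K x|); split.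
    by rewrite mulr_ge0// I_ge0.
  move=> v s; have i1 : itg mu3 (fun x => K x * g (x + s *: v)).
    apply: (@itg_dom _ _ R mu3 _ (fun x : T => c * `|K x|)).
    - by apply: measurable_funM => //; exact: measurable_comp_shift.
    - by apply: itgZ; apply: itg_norm.
    - by move=> x; rewrite normrM mulrC ler_wpM2r.
  split => //; rewrite -IZ; last exact: itg_norm.
  apply: I_le; [exact: itg_norm| |].
    by apply: itgZ; exact: itg_norm.
  by move=> x; rewrite normrM mulrC ler_wpM2r.
Qed.

Lemma itg_kern v t K g : dual_ok K g -> 0 <= t ->
  (leb3s R \x leb1s R)%E.-integrable setT (EFin \o kern v t K g).
Proof.
move=> dk t0; have [mK mg _] := dk; have [c [c0 H]] := dual_okP dk.
have mk : measurable_fun setT (EFin \o kern v t K g).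
  by apply/measurable_EFinP; apply: measurable_kern.
apply/(integrable21ltyP (leb3s R) (leb1s R) mk).
apply: (@le_lt_trans _ _ (\int[mu1]_(s in `[0%R, t]) c%:E)%E).
  rewrite [leRHS]integral_mkcond; apply: ge0_le_integral => //.
  - by move=> s _; apply: integral_ge0.
  - have := measurable_fun_fubini_tonelli_G (m1 := leb3s R) (fun z => `|(kern v t K g z)%:E|%E).
    by apply => //; apply: measurableT_comp.
  - by apply/(measurable_restrictT _ _).1 => //; exact: measurable_itv.
  move=> s _; rewrite /patch; case: ifPn => sI; last first.
    rewrite integral0_eq// => x _; rewrite /kern /= indicE (negPf sI).
    by rewrite mul0r mulr0 normr0.
  have [i1 i2] := H v s.
  apply: (@le_trans _ _ (\int[mu3]_(x in setT) `|K x * g (x + s *: v)|)%:E).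
    rewrite I_EFin; last exact: itg_norm.
    rewrite le_eqVlt; apply/orP; left; apply/eqP; apply: eq_integral => x _.
    by rewrite /kern /= indicE sI mul1r.
  by rewrite lee_fin.
rewrite integral_cst//= lebesgue_measure_itv/= lte_fin.
by case: ifP => _; rewrite ?mule0 ?ltry.
Qed.

Lemma itg_fine d (X : measurableType d) (mu : {measure set X -> \bar R})
  (F : X -> \bar R) : mu.-integrable setT F -> itg mu (fine \o F).
Proof.
move=> iF; have mF := measurable_int mu iF.
apply: le_integrable iF => //.
  by apply/measurable_EFinP; apply: measurableT_comp.
move=> x _ /=; case: (F x) => [r| |] //=; first by rewrite normr0 leey.
by rewrite normr0 leey.
Qed.

Lemma kern_section v t K g : dual_ok K g -> 0 <= t ->
  itg mu1 (fun s => \1_(`[0, t]%classic) s *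
     \int[mu3]_(x in setT) (K x * g (x + s *: v))).
Proof.
move=> dk t0; have [mK mg _] := dk; have [c [c0 H]] := dual_okP dk.
have E s : \1_(`[0, t]%classic) s *
     \int[mu3]_(x in setT) (K x * g (x + s *: v)) =
    fine (fubini_G mu3 (EFin \o kern v t K g) s).
  rewrite -IZ; last by have [] := H v s.
  by rewrite /Rintegral; congr fine; apply: eq_integral => x _; rewrite /kern /= mulrCA.
have mG := measurable_fubini_G (itg_kern v dk t0).
apply: (@itg_dom _ _ R mu1 _ (fun s : R => c * \1_(`[0, t]%classic) s)).
- rewrite (_ : (fun _ => _) = fine \o fubini_G mu3 (EFin \o kern v t K g)).
    by apply: measurableT_comp.
  by apply/funext => s; rewrite E.
- by apply: itgZ; exact: itg_indic_itv.
move=> s; rewrite normrM [leRHS]mulrC indicE ger0_norm// ler_wpM2l//.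
by have [i1 i2] := H v s; apply: le_trans (I_norm i1) i2.
Qed.

Lemma dual_ok1 g : itg mu3 g -> dual_ok (fun=> 1) g.
Proof.
move=> gi; split; [exact: measurable_cst|exact: itg_meas gi|left].
by exists 1 => // x; rewrite normr1.
Qed.

Lemma avg_itg v t g : 0 <= t -> itg mu3 g -> itg mu3 (avg v t g).
Proof.
move=> t0 gi.
have /itg_fine := integrable_fubini_F (itg_kern v (dual_ok1 gi) t0).
apply: itg_ext => x /=; rewrite /avg /Rintegral /fubini_F.
by congr fine; apply: eq_integral => s _; rewrite /kern /= mul1r.
Qed.

Lemma itg_line_bounded v t g c x : M g -> (forall x, `|g x| <= c) ->
  itg mu1 (fun s => \1_(`[0, t]%classic) s * g (x + s *: v)).
Proof.
move=> mg gc.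
apply: (@itg_dom _ _ R mu1 _ (fun s : R => c * \1_(`[0, t]%classic) s)).
- apply: measurable_funM; first exact: measurable_indic.
  apply: (measurableT_comp mg).
  exact: (measurableT_comp (measurable_ray v) (measurable_pair1 x)).
- by apply: itgZ; exact: itg_indic_itv.
by move=> s; rewrite normrM [leRHS]mulrC indicE ger0_norm// ler_wpM2l.
Qed.

Lemma ae_itg_line v t K g : dual_ok K g -> 0 <= t ->
  {ae mu3, forall x, itg mu1 (fun s => \1_(`[0, t]%classic) s * g (x + s *: v))}.
Proof.
move=> [mK mg [[c Kc gi]|[c gc Ki]]] t0; last first.
  by apply: aeW => x; exact: itg_line_bounded gc.
apply: (ae1 (ae_integrable1 (itg_kern v (dual_ok1 gi) t0))) => x.
by apply: itg_ext => s; rewrite /kern /= mul1r.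
Qed.

Lemma itg_mul_avg v t K g : dual_ok K g -> 0 <= t -> M (avg v t g) ->
  itg mu3 (fun x => K x * avg v t g x).
Proof.
move=> dk t0 mavg; have ki := itg_kern v dk t0; have [mK mg _] := dk.
apply: (itg_ae _ (itg_fine (integrable_fubini_F ki))).
  by apply: measurable_funM.
apply: (ae1 (ae_itg_line v dk t0)) => x ix.
by rewrite /avg -RintegralZl.
Qed.

(** Fubini's theorem: pairing with an average is the average of the pairings. *)
Lemma avg_dual v t K g : dual_ok K g -> 0 <= t -> M (avg v t g) ->
  \int[mu3]_(x in setT) (K x * avg v t g x) =
  \int[mu1]_(s in setT) (\1_(`[0, t]%classic) s *
     \int[mu3]_(x in setT) (K x * g (x + s *: v))).
Proof.
move=> dk t0 mavg; have ki := itg_kern v dk t0; have [mK mg _] := dk.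
have [c [c0 H]] := dual_okP dk.
transitivity (fine (\int[mu3]_x fubini_F mu1 (EFin \o kern v t K g) x)%E).
  transitivity (\int[mu3]_(x in setT) fine (fubini_F mu1 (EFin \o kern v t K g) x)).
    apply: I_ae.
    - exact: measurable_funM.
    - by apply: itg_meas (itg_fine (integrable_fubini_F ki)).
    apply: (ae1 (ae_itg_line v dk t0)) => x ix.
    by rewrite /avg -RintegralZl.
  rewrite /Rintegral; congr fine; apply: ae_eq_integral => //.
  - by apply/measurable_EFinP; exact: itg_meas (itg_fine (integrable_fubini_F ki)).
  - exact: measurable_int (integrable_fubini_F ki).
  apply: (ae1 (integrable_ae measurableT (integrable_fubini_F ki))) => x /(_ I) Fx _.
  by rewrite fineK.
rewrite [X in fine X](_ : _ = (\int[mu1]_s fubini_G mu3 (EFin \o kern v t K g) s)%E); last first.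
  exact: Fubini ki.
rewrite /Rintegral; congr fine; apply: eq_integral => s _.
have [i1 _] := H v s.
rewrite EFinM I_EFin// -integralZl //.
by apply: eq_integral => x _; rewrite /kern /= -EFinM mulrCA.
Qed.

Lemma I1_bound t (u : R -> R) (b B : R) : 0 <= t ->
  itg mu1 (fun s => \1_(`[0, t]%classic) s * u s) ->
  (forall s, 0 <= s <= t -> `|u s - b| <= B) ->
  `|\int[mu1]_(s in setT) (\1_(`[0, t]%classic) s * u s) - t * b| <= t * B.
Proof.
move=> t0 iu ub.
have I1 : \int[mu1]_(s in setT) (\1_(`[0, t]%classic) s) = t.
  have mI : measurable (`[0, t]%classic : set (measurableTypeR R)) by exact: measurable_itv.
  transitivity (fine (mu1 (`[0, t]%classic : set R))).
    by congr fine; rewrite (integral_indic mu1 measurableT mI) setIT.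
  by rewrite lebesgue_measure_itv/= lte_fin; case: ltP => [_|t1] /=;
    [rewrite subr0|apply/eqP; rewrite eq_le t0 t1].
have ii := itg_indic_itv t.
have ib k : \int[mu1]_(s in setT) (k * \1_(`[0, t]%classic) s) = t * k.
  by rewrite IZ// I1 mulrC.
rewrite -ib -IB//; last exact: itgZ.
have i2 : itg mu1 (fun s => \1_(`[0, t]%classic) s * u s - b * \1_(`[0, t]%classic) s).
  by apply: itgB => //; exact: itgZ.
apply: (le_trans (I_norm i2)); rewrite -(ib B).
apply: I_le; [exact: itg_norm|exact: itgZ|].
move=> s; rewrite [b * _]mulrC -mulrBr normrM [leRHS]mulrC.
rewrite indicE; have [/set_mem/= sI|_] := boolP (s \in _).
  by rewrite normr1 !mul1r; apply: ub; rewrite in_itv/= in sI.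
by rewrite normr0 !mul0r.
Qed.

Lemma avg_bound v t g c x : 0 <= t -> M g -> (forall x, `|g x| <= c) ->
  `|avg v t g x| <= t * c.
Proof.
move=> t0 mg gc.
have := @I1_bound t (fun s => g (x + s *: v)) 0 c t0 (itg_line_bounded v t x mg gc).
by rewrite mulr0 subr0; apply => s _; rewrite subr0.
Qed.

End averages.

(** * A class of explicit smooth functions *)

Section one_dim.
Variable R : realType.
Implicit Types (k n : nat) (x y : R).

(** The function x^(-1/2) on the positive half-line. Being an exponential of a
    logarithm it is smooth there without any case distinction. *)
Definition isq x : R := expR (- (ln x / 2)).

Lemma isq_gt0 x : 0 < isq x. Proof. exact: expR_gt0. Qed.

Lemma isq_sqr x : 0 < x -> isq x ^+ 2 = x^-1.
Proof.
move=> x0; rewrite /isq -expRM_natl (_ : 2 * - (ln x / 2) = - ln x); last by field.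
by rewrite expRN lnK.
Qed.

Lemma is_derive_pow (V : normedModType R) (f : V -> R) n (x v : V) (df : R) :
  is_derive x v f df ->
  is_derive x v (fun z : V => f z ^+ n) (n%:R * f x ^+ n.-1 * df).
Proof.
move=> /(is_deriveX n); rewrite (_ : f ^+ n = fun z => f z ^+ n) //.
by apply/funext => z; elim: n => [|n ih]; rewrite ?expr0// !exprS -ih.
Qed.

Lemma is_derive_isq x : 0 < x -> is_derive x 1 isq (- (isq x ^+ 3 / 2)).
Proof.
move=> x0; have dln := is_derive1_ln x0.
have d1 : is_derive x 1 (fun y => - (ln y / 2)) (- (x^-1 / 2)).
  apply: (@is_deriveN _ _ _ (fun y => ln y / 2)).
  have -> : (fun y => ln y / 2) = (2^-1 \*: (@ln R)).
    by apply/funext => y /=; rewrite mulrC.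
  by apply: is_derive_eq; rewrite /GRing.scale/= mulrC.
have d2 := @is_derive1_comp R expR (fun y => - (ln y / 2)) x _ _ (is_derive_expR _) d1.
apply: (is_derive_eq d2); rewrite -/(isq x) exprS (isq_sqr x0).
by field; rewrite gt_eqF.
Qed.

(** The functions x^-k exp(-1/x), extended by 0. The family is closed under
    differentiation, which gives smoothness by induction. *)
Definition flat k x : R := if 0 < x then x^-1 ^+ k * expR (- x^-1) else 0.

Lemma flat_le0 k x : x <= 0 -> flat k x = 0.
Proof. by move=> x0; rewrite /flat ltNge x0. Qed.

Lemma flat_ge0 k x : 0 <= flat k x.
Proof.
rewrite /flat; case: ifPn => // x0; rewrite mulr_ge0 ?expR_ge0// exprn_ge0//.
by rewrite invr_ge0 ltW.
Qed.

Lemma flat_bound k x : flat k x <= k.+2`!%:R * x ^+ 2.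
Proof.
rewrite /flat; case: ifPn => [x0|_]; last by rewrite mulr_ge0// sqr_ge0.
have u0 : 0 <= x^-1 by rewrite invr_ge0 ltW.
have := expR_ge1Dxn k.+1 u0; set u := x^-1 in u0 *; move=> H.
have {}H : u ^+ k.+2 <= k.+2`!%:R * expR u.
  rewrite mulrC -ler_pdivrMr ?ltr0n ?fact_gt0//; apply: le_trans H.
  by rewrite lerDr.
have -> : u ^+ k * expR (- u) = u ^+ k.+2 * expR (- u) * x ^+ 2.
  by rewrite /u -addn2 exprD; field; rewrite gt_eqF.
rewrite ler_wpM2r ?sqr_ge0// expRN ler_pdivrMr ?expR_gt0//.
Qed.

(** The quadratic bound [flat_bound] makes the difference quotient at the origin
    tend to 0. *)
Lemma is_derive_flat0 k : is_derive (0 : R) 1 (flat k) 0.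
Proof.
apply/is_derive1_caratheodory; exists (fun z => flat k z / z); split.
- move=> z; rewrite (flat_le0 k (lexx 0)) !subr0.
  have [->|z0] := eqVneq z 0; first by rewrite (flat_le0 k (lexx 0)) mulr0.
  by rewrite divfK.
- rewrite /prop_for /continuous_at /= invr0 mulr0.
  apply/cvgrPdist_le => /= eps eps0.
  have C0 : 0 < k.+2`!%:R :> R by rewrite ltr0n fact_gt0.
  near=> z; rewrite sub0r normrN normrM ger0_norm ?flat_ge0//.
  have [->|z0] := eqVneq z 0; first by rewrite invr0 normr0 mulr0 ltW.
  apply: (@le_trans _ _ (k.+2`!%:R * `|z|)).
    rewrite normfV ler_pdivrMr ?normr_gt0//; apply: le_trans (flat_bound k z) _.
    by rewrite -mulrA -expr2 -normrX ger0_norm ?sqr_ge0.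
  rewrite -ler_pdivlMl//; near: z.
  exists (k.+2`!%:R^-1 * eps) => /=; first by rewrite mulr_gt0 ?invr_gt0.
  by move=> z /=; rewrite sub0r normrN => /ltW.
- by rewrite invr0 mulr0.
Unshelve. all: by end_near.
Qed.

Lemma is_derive_flat k x :
  is_derive x 1 (flat k) (flat k.+2 x - k%:R * flat k.+1 x).
Proof.
have [x0|x0|->] := ltgtP x 0.
- apply: (@near_eq_is_derive _ _ _ (cst 0)).
    near=> y; rewrite flat_le0//; near: y; exact: lt_le_nbhsl.
  by rewrite !flat_le0 ?ltW// mulr0 subr0; exact: is_derive_cst.
- apply: (@near_eq_is_derive _ _ _ (fun y => y^-1 ^+ k * expR (- y^-1))).
    by near=> y; rewrite /flat ifT//; near: y; exact: lt_nbhsr.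
  have xN0 : x != 0 by rewrite gt_eqF.
  have dV : is_derive x 1 (fun y : R => y^-1) (- x ^- 2 *: 1).
    exact: is_deriveV xN0 (is_derive_id _ _).
  have d1 := is_derive_pow k dV.
  have d2 := @is_derive1_comp R expR (fun y => - y^-1) x _ _ (is_derive_expR _) (is_deriveN dV).
  apply: (is_derive_eq (is_deriveM d1 d2)).
  rewrite /flat x0 /GRing.scale/= !mulr1 opprK.
  case: k {d1} => [|k]; first by rewrite /= expr0 !mul0r mul1r mulr0 addr0 subr0 exprVn mulrC.
  by rewrite /= -natr1 !exprS; field.
- apply: (is_derive_eq (is_derive_flat0 k)).
  by rewrite !flat_le0// mulr0 subr0.
Unshelve. all: by end_near.
Qed.

End one_dim.

Section elem.
Variable R : realType.
Local Notation T := (vec3 R).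
Local Notation e := (@std_basis R).
Local Notation mT := (measurableTypeR R * measurableTypeR R * measurableTypeR R)%type.
Local Notation M f := (@measurable_fun _ _ mT R setT f).
Implicit Types (i j : 'I_3) (f g : T -> R) (c s : R).

(** Every test function of the proof is built from coordinates by these operations.
    A syntactic class closed under partial derivatives gives smoothness,
    measurability and the commutation of derivatives by induction on the
    construction. *)
Inductive elem : (T -> R) -> Prop :=
| elem_cst c : elem (fun=> c)
| elem_crd i : elem (coord3 i)
| elem_add f g : elem f -> elem g -> elem (fun y => f y + g y)
| elem_mul f g : elem f -> elem g -> elem (fun y => f y * g y)
| elem_flat k f : elem f -> elem (fun y => flat k (f y))
| elem_isq f : elem f -> (forall y, 0 < f y) -> elem (fun y => isq (f y)).

Lemma is_derive_ray (v y : T) f (d : R) :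
  is_derive y v f d <-> is_derive (0 : R) 1 (fun h : R => f (y + h *: v)) d.
Proof.
have E : (fun h : R => h^-1 *: ((f \o shift y) (h *: v) - f y)) =
  (fun h : R => h^-1 *: (((fun h : R => f (y + h *: v)) \o shift 0) (h *: 1) -
    f (y + 0 *: v))).
  by apply/funext => h /=; rewrite scale0r !addr0 [_ + y]addrC /GRing.scale/= mulr1.
split=> -[]; rewrite /derivable /derive => h1 h2; split; rewrite /derivable /derive;
  by rewrite ?E // -?E.
Qed.

Lemma is_derive_comp1 (v y : T) f (g : R -> R) (a b : R) :
  is_derive (f y) 1 g a -> is_derive y v f b ->
  is_derive y v (fun z => g (f z)) (a * b).
Proof.
move=> dg /is_derive_ray df; apply/is_derive_ray.
apply: (@is_derive1_comp R g (fun h => f (y + h *: v))) => //.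
by rewrite scale0r addr0.
Qed.

Lemma ord3P i : i = ix1 \/ (i = ix2 \/ i = ix3).
Proof.
case: i => -[|[|[|//]]] hi; [left|right; left|right; right]; exact/val_inj.
Qed.

Lemma is_derive_crd i j y : is_derive y (e j) (coord3 i) (i == j)%:R.
Proof.
apply/is_derive_ray.
have -> : (fun h : R => coord3 i (y + h *: e j)) =
  (fun h : R => coord3 i y + h * (i == j)%:R).
  apply/funext => h; rewrite /coord3 /std_basis /=.
  case: (ord3P i) => [->|[->|->]]; case: (ord3P j) => [->|[->|->]] /=;
    by rewrite /GRing.scale/= ?mulr1 ?mulr0.
have d : is_derive (0 : R) 1 (fun h : R => (i == j)%:R * h) ((i == j)%:R * 1).
  exact: (is_deriveZ _ (is_derive_id _ _)).
have := is_deriveD (is_derive_cst (coord3 i y) (0 : R) 1) d.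
rewrite add0r mulr1 => {d} d.
rewrite (_ : (fun h : R => coord3 i y + h * (i == j)%:R) =
  cst (coord3 i y) + (fun h : R => (i == j)%:R * h)) //.
by apply/funext => h; rewrite [in LHS]mulrC.
Qed.

(** All derivatives come from the one-dimensional ones by the chain rule along rays. *)
Lemma elem_derive f : elem f -> forall j, exists g, elem g /\
  forall y, is_derive y (e j) f (g y).
Proof.
elim=> {f} [c|i|f g _ IHf _ IHg|f g af IHf ag IHg|k f af IHf|f af IHf f0] j.
- exists (fun=> 0); split; first exact: elem_cst.
  by move=> y; exact: is_derive_cst.
- exists (fun=> (i == j)%:R); split; first exact: elem_cst.
  by move=> y; exact: is_derive_crd.
- have [f' [af' df]] := IHf j; have [g' [ag' dg]] := IHg j.
  exists (fun y => f' y + g' y); split; first exact: elem_add.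
  by move=> y; exact: (is_deriveD (df y) (dg y)).
- have [f' [af' df]] := IHf j; have [g' [ag' dg]] := IHg j.
  exists (fun y => f y * g' y + g y * f' y); split.
    by apply: elem_add; apply: elem_mul.
  by move=> y; exact: (is_deriveM (df y) (dg y)).
- have [f' [af' df]] := IHf j.
  exists (fun y => (flat k.+2 (f y) + (- k%:R) * flat k.+1 (f y)) * f' y); split.
    apply: elem_mul => //; apply: elem_add; first exact: elem_flat.
    by apply: elem_mul; [exact: elem_cst|exact: elem_flat].
  move=> y; rewrite mulNr; apply: is_derive_comp1 => //; exact: is_derive_flat.
- have [f' [af' df]] := IHf j.
  exists (fun y => (- 2^-1) * (isq (f y) * (isq (f y) * isq (f y))) * f' y); split.
    apply: elem_mul => //; apply: elem_mul; first exact: elem_cst.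
    by do ?[apply: elem_mul]; exact: elem_isq.
  move=> y; rewrite (_ : - 2^-1 * _ = - (isq (f y) ^+ 3 / 2)).
    by apply: is_derive_comp1 => //; exact: is_derive_isq.
  by rewrite !exprS expr0 mulr1 mulNr mulrC.
Qed.

Lemma elem_is_derive f y j : elem f -> is_derive y (e j) f (partial j f y).
Proof.
move=> /elem_derive /(_ j) [g [_ dg]]; rewrite /partial; have d := dg y.
by rewrite derive_val.
Qed.

Lemma elem_partial f j : elem f -> elem (partial j f).
Proof.
move=> /elem_derive /(_ j) [g [ag dg]]; rewrite (_ : partial j f = g) //.
by apply/funext => y; rewrite /partial; have d := dg y; rewrite derive_val.
Qed.

Lemma partialE f g j : (forall y, is_derive y (e j) f (g y)) -> partial j f = g.
Proof. by move=> dg; apply/funext => y; rewrite /partial; have d := dg y; rewrite derive_val. Qed.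

Lemma continuous_flat k : continuous (@flat R k).
Proof.
move=> x; apply: differentiable_continuous; apply/derivable1_diffP.
by have [] := is_derive_flat k x.
Qed.

Lemma continuous_isq (x : R) : 0 < x -> {for x, continuous (@isq R)}.
Proof.
move=> x0; apply: differentiable_continuous; apply/derivable1_diffP.
by have [] := is_derive_isq x0.
Qed.

Lemma continuous_crd i : continuous (@coord3 R i).
Proof.
move: i => i y; case: (ord3P i) => [->|[->|->]].
- by apply: (@continuous_comp _ _ _ fst fst); [exact: cvg_fst|exact: cvg_fst].
- by apply: (@continuous_comp _ _ _ fst snd); [exact: cvg_fst|exact: cvg_snd].
- exact: cvg_snd.
Qed.

Lemma elem_continuous f : elem f -> continuous f.
Proof.
elim=> {f} [c|i|f g _ IHf _ IHg|f g af IHf ag IHg|k f af IHf|f af IHf f0] y.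
- exact: cvg_cst.
- exact: continuous_crd.
- by apply: continuousD; [exact: IHf|exact: IHg].
- by apply: continuousM; [exact: IHf|exact: IHg].
- by apply: (@continuous_comp _ _ _ f (flat k)); [exact: IHf|exact: continuous_flat].
- by apply: (@continuous_comp _ _ _ f (@isq R)); [exact: IHf|exact: continuous_isq].
Qed.

Lemma elem_measurable f : elem f -> M f.
Proof.
elim=> {f} [c|i|f g _ IHf _ IHg|f g af IHf ag IHg|k f af IHf|f af IHf f0].
- exact: measurable_cst.
- case: (ord3P i) => [->|[->|->]]; last exact: measurable_snd.
    exact: (measurableT_comp (f := fst) measurable_fst measurable_fst).
  exact: (measurableT_comp (f := snd) measurable_snd measurable_fst).
- exact: (measurable_funD IHf IHg).
- exact: (measurable_funM IHf IHg).
- apply: measurableT_comp => //; apply: continuous_measurable_fun; exact: continuous_flat.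
- apply: measurableT_comp => //; rewrite /isq.
  apply: measurableT_comp => //; apply: measurableT_comp => //.
  by apply: measurable_funM => //; exact: measurable_ln.
Qed.

Lemma elem_smooth f : elem f -> smooth f.
Proof.
move=> af s.
have {af} : elem (partials s f) by elim: s => //= i s IH; exact: elem_partial.
move: (partials s f) => g ag; split; first exact: elem_continuous.
by move=> i y; have [] := elem_is_derive y i ag.
Qed.

Lemma elem_shift f (v : T) : elem f -> elem (fun y => f (y + v)).
Proof.
elim=> {f} [c|i|f g _ IHf _ IHg|f g af IHf ag IHg|k f af IHf|f af IHf f0].
- exact: elem_cst.
- rewrite (_ : (fun _ => _) = (fun y => coord3 i y + coord3 i v)).
    by apply: elem_add; [exact: elem_crd|exact: elem_cst].
  by apply/funext => y; case: (ord3P i) => [->|[->|->]].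
- exact: elem_add IHf IHg.
- exact: elem_mul IHf IHg.
- exact: elem_flat IHf.
- exact: elem_isq IHf _.
Qed.

Lemma partial_shift f (v : T) j : elem f ->
  partial j (fun y => f (y + v)) = fun y => partial j f (y + v).
Proof.
move=> af; apply: partialE => y; apply/is_derive_ray.
have /is_derive_ray := elem_is_derive (y + v) j af.
by rewrite (_ : (fun h : R => f (y + v + _)) = (fun h : R => f (y + h *: e j + v))) //;
  apply/funext => h; rewrite addrAC.
Qed.

Lemma partialD f g j : elem f -> elem g ->
  partial j (fun y => f y + g y) = fun y => partial j f y + partial j g y.
Proof.
move=> af ag; apply: partialE => y.
exact: (is_deriveD (elem_is_derive y j af) (elem_is_derive y j ag)).
Qed.

Lemma partialM f g j : elem f -> elem g ->
  partial j (fun y => f y * g y) = fun y => f y * partial j g y + g y * partial j f y.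
Proof.
move=> af ag; apply: partialE => y.
exact: (is_deriveM (elem_is_derive y j af) (elem_is_derive y j ag)).
Qed.

Lemma partial_cst c j : partial j (fun=> c) = fun=> 0.
Proof. by apply: partialE => y; exact: is_derive_cst. Qed.

Lemma partial_crd i j : partial j (@coord3 R i) = fun=> (i == j)%:R.
Proof. by apply: partialE => y; exact: is_derive_crd. Qed.

Lemma partial_flat k f j : elem f -> partial j (fun y => flat k (f y)) =
  fun y => (flat k.+2 (f y) + (- k%:R) * flat k.+1 (f y)) * partial j f y.
Proof.
move=> af; apply: partialE => y; rewrite mulNr.
by apply: is_derive_comp1; [exact: is_derive_flat|exact: elem_is_derive].
Qed.

Lemma partial_isq f j : elem f -> (forall y, 0 < f y) ->
  partial j (fun y => isq (f y)) =
  fun y => (- 2^-1) * (isq (f y) * (isq (f y) * isq (f y))) * partial j f y.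
Proof.
move=> af f0; apply: partialE => y; rewrite (_ : - 2^-1 * _ = - (isq (f y) ^+ 3 / 2)).
  by apply: is_derive_comp1; [exact: is_derive_isq|exact: elem_is_derive].
by rewrite !exprS expr0 mulr1 mulNr mulrC.
Qed.

Lemma partialC f i j : elem f -> partial i (partial j f) = partial j (partial i f).
Proof.
elim=> {f} [c|k|f g af IHf ag IHg|f g af IHf ag IHg|k f af IHf|f af IHf f0].
- by rewrite !partial_cst.
- by rewrite !partial_crd !partial_cst.
- have [fi fj] := (elem_partial i af, elem_partial j af).
  have [gi gj] := (elem_partial i ag, elem_partial j ag).
  rewrite (partialD i af ag) (partialD j af ag).
  by rewrite (partialD i fj gj) (partialD j fi gi) IHf IHg.
- have [fi fj] := (elem_partial i af, elem_partial j af).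
  have [gi gj] := (elem_partial i ag, elem_partial j ag).
  rewrite (partialM i af ag) (partialM j af ag).
  rewrite (partialD i (elem_mul af gj) (elem_mul ag fj)).
  rewrite (partialD j (elem_mul af gi) (elem_mul ag fi)).
  rewrite (partialM i af gj) (partialM i ag fj) (partialM j af gi) (partialM j ag fi).
  rewrite IHf IHg.
  apply/funext => y.
  move: (partial j (partial i f) y) (partial j (partial i g) y) => ff gg.
  move: (partial i f y) (partial j f y) (partial i g y) (partial j g y) (f y) (g y) => *.
  by ring.
- have [fi fj] := (elem_partial i af, elem_partial j af).
  have a1 : elem (fun y => flat k.+1 (f y)) by exact: elem_flat.
  have a4 : elem (fun y => flat k.+2 (f y)) by exact: elem_flat.
  have a3 := elem_mul (elem_cst (- k%:R)) a1.
  have a2 := elem_add a4 a3.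
  rewrite (partial_flat k i af) (partial_flat k j af).
  rewrite (partialM i a2 fj) (partialM j a2 fi).
  rewrite (partialD i a4 a3) (partialD j a4 a3).
  rewrite (partialM i (elem_cst _) a1) (partialM j (elem_cst _) a1).
  rewrite !(partial_flat _ i af) !(partial_flat _ j af) !partial_cst IHf.
  apply/funext => y; move: (partial j (partial i f) y) (partial i f y) (partial j f y) => *.
  by ring.
- have [fi fj] := (elem_partial i af, elem_partial j af).
  have aq : elem (fun y => isq (f y)) by exact: elem_isq.
  have aq2 := elem_mul aq aq; have aq3 := elem_mul aq aq2.
  have aq4 := elem_mul (elem_cst (- 2^-1)) aq3.
  rewrite (partial_isq i af f0) (partial_isq j af f0).
  rewrite (partialM i aq4 fj) (partialM j aq4 fi).
  rewrite (partialM i (elem_cst _) aq3) (partialM j (elem_cst _) aq3).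
  rewrite (partialM i aq aq2) (partialM j aq aq2) (partialM i aq aq) (partialM j aq aq).
  rewrite (partial_isq i af f0) (partial_isq j af f0).
  rewrite !partial_cst IHf.
  apply/funext => y; move: (partial j (partial i f) y) (partial i f y) (partial j f y) => *.
  by ring.
Qed.

End elem.

Section zeta.
Variable R : realType.
Local Notation T := (vec3 R).
Implicit Types (j : 'I_3) (f : T -> R) (s t : R).

Definition flat1 : R := flat 0 1.
(** A smooth nonincreasing step from 1 (for t <= 0) to 0 (for t >= 1). Composing
    [flat 0] with itself produces it inside the class [elem], without a quotient. *)
Definition zeta t : R := (flat 0 flat1)^-1 * flat 0 (flat1 + (-1) * flat 0 t).
(** The derivative of [zeta], see [partial_zeta]. *)
Definition dzeta t : R :=
  - ((flat 0 flat1)^-1 * (flat 2 (flat1 + (-1) * flat 0 t) * flat 2 t)).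

Lemma flat_gt0 k t : 0 < t -> 0 < flat k t.
Proof. by move=> t0; rewrite /flat t0 mulr_gt0 ?expR_gt0// exprn_gt0 ?invr_gt0. Qed.

Lemma flat0_le1 t : flat 0 t <= 1.
Proof.
rewrite /flat; case: ifPn => // t0; rewrite expr0 mul1r.
by rewrite -[leRHS]expR0 ler_expR oppr_le0 invr_ge0 ltW.
Qed.

Lemma flat0_mono s t : s <= t -> flat 0 s <= flat 0 t.
Proof.
move=> st; rewrite {1}/flat; case: ifPn => s0; last exact: flat_ge0.
rewrite /flat (lt_le_trans s0 st) !expr0 !mul1r ler_expR lerN2.
by rewrite lef_pV2 ?posrE// (lt_le_trans s0).
Qed.

Lemma flat_le_fact k t : flat k.+1 t <= k.+1`!%:R.
Proof.
rewrite /flat; case: ifPn => [t0|_]; last exact: ler0n.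
have u0 : 0 <= t^-1 by rewrite invr_ge0 ltW.
rewrite expRN ler_pdivrMr ?expR_gt0//.
rewrite mulrC -ler_pdivrMr ?ltr0n ?fact_gt0//; apply: le_trans (expR_ge1Dxn k u0).
by rewrite lerDr.
Qed.

Lemma flat1_gt0 : 0 < flat1. Proof. exact: flat_gt0. Qed.
Lemma ff_gt0 : 0 < flat 0 flat1. Proof. exact: flat_gt0 flat1_gt0. Qed.

Lemma zeta_ge0 t : 0 <= zeta t.
Proof. by rewrite mulr_ge0 ?flat_ge0// invr_ge0 ltW// ff_gt0. Qed.

Lemma zeta_le1 t : zeta t <= 1.
Proof.
rewrite /zeta mulrC ler_pdivrMr ?ff_gt0// mul1r flat0_mono//.
by rewrite mulN1r gerBl flat_ge0.
Qed.

Lemma zeta_eq1 t : t <= 0 -> zeta t = 1.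
Proof.
by move=> t0; rewrite /zeta (flat_le0 _ t0) mulr0 addr0 mulVf// gt_eqF// ff_gt0.
Qed.

Lemma zeta_eq0 t : 1 <= t -> zeta t = 0.
Proof.
move=> t1; rewrite /zeta [flat 0 (_ + _)]flat_le0 ?mulr0//.
by rewrite mulN1r subr_le0; exact: flat0_mono.
Qed.

Lemma dzeta_le0 t : dzeta t <= 0.
Proof. by rewrite oppr_le0 !mulr_ge0 ?flat_ge0// invr_ge0 ltW// ff_gt0. Qed.

Lemma dzeta_eq0l t : t <= 0 -> dzeta t = 0.
Proof. by move=> t0; rewrite /dzeta (flat_le0 2 t0) !mulr0 oppr0. Qed.

Lemma dzeta_eq0r t : 1 <= t -> dzeta t = 0.
Proof.
move=> t1; rewrite /dzeta [flat 2 (_ + _)]flat_le0 ?(mul0r, mulr0, oppr0)//.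
by rewrite mulN1r subr_le0; exact: flat0_mono.
Qed.

Definition czeta : R := (flat 0 flat1)^-1 * 4.

Lemma czeta_gt0 : 0 < czeta.
Proof. by rewrite mulr_gt0 ?invr_gt0 ?ff_gt0. Qed.

Lemma dzeta_bound t : - dzeta t <= czeta.
Proof.
rewrite opprK ler_pM2l ?invr_gt0 ?ff_gt0//.
have -> : 4 = 2 * 2 :> R by ring.
by rewrite ler_pM ?flat_ge0//; exact: (flat_le_fact 1).
Qed.

Lemma elem_zeta f : elem f -> elem (fun y => zeta (f y)).
Proof.
move=> af; apply: elem_mul; first exact: elem_cst.
apply: elem_flat; apply: elem_add; first exact: elem_cst.
by apply: elem_mul; [exact: elem_cst|exact: elem_flat].
Qed.

Lemma partial_zeta f j : elem f ->
  partial j (fun y => zeta (f y)) = fun y => dzeta (f y) * partial j f y.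
Proof.
move=> af.
have a1 := elem_flat 0 af; have a2 := elem_mul (elem_cst (-1)) a1.
have a3 := elem_add (elem_cst flat1) a2.
rewrite (partialM j (elem_cst _) (elem_flat 0 a3)) (partial_flat 0 j a3).
rewrite (partialD j (elem_cst _) a2) (partialM j (elem_cst _) a1) (partial_flat 0 j af).
rewrite !partial_cst; apply/funext => y; rewrite /dzeta.
move: (partial j f y) (flat _ (_ + _)) (flat _ (_ + _)) (flat _ (_ + _)) => *.
by ring.
Qed.

End zeta.

(** * Boxes, local integrability and test functions *)

Lemma itg_indic d (X : measurableType d) (R : realType)
  (mu : {measure set X -> \bar R}) (A : set X) :
  measurable A -> (mu A < +oo)%E -> itg mu (\1_A : X -> R).
Proof.
move=> mA fA; apply/integrableP; split.
  by apply/measurable_EFinP; exact: measurable_indic.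
rewrite (eq_integral (fun x => (\1_A x)%:E)); last first.
  by move=> t _; rewrite gee0_abs// lee_fin.
by rewrite integral_indic// setIT.
Qed.

Section loc.
Variable R : realType.
Local Notation T := (vec3 R).
Local Notation e := (@std_basis R).
Local Notation mu1 := (@lebesgue_measure R).
Local Notation mu3 := (leb3 R).
Local Notation mT := (measurableTypeR R * measurableTypeR R * measurableTypeR R)%type.
Local Notation M f := (@measurable_fun _ _ mT R setT f).
Implicit Types (i j : 'I_3) (f g h phi : T -> R) (c N : R) (y v : T).

Definition box N : set T := (`[-N, N] `*` `[-N, N]) `*` `[-N, N].

Lemma boxP N y : box N y <-> forall i, `|coord3 i y| <= N.
Proof.
rewrite /box /= !in_itv/= -!ler_norml; split.
  by move=> [[h1 h2] h3] i; case: (ord3P i) => [->|[->|->]].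
by move=> h; split; [split|]; [apply: (h ix1)|apply: (h ix2)|apply: (h ix3)].
Qed.

Lemma box_sub N N' : N <= N' -> box N `<=` box N'.
Proof. by move=> NN y /boxP h; apply/boxP => i; rewrite (le_trans (h i)). Qed.

Lemma box_compact N : compact (box N).
Proof. by do 2?apply: compact_setX; exact: segment_compact. Qed.

Lemma box_measurable N : @measurable _ mT (box N).
Proof. by apply: measurableX; [apply: measurableX|]; exact: measurable_itv. Qed.

Lemma box_finite N : (mu3 (box N) < +oo)%E.
Proof.
pose J := `[-N, N]%classic : set R.
rewrite [X in (X < _)%E](_ : _ = (mu1 J * mu1 J * mu1 J)%E).
  have Jf : mu1 J \is a fin_num.
    by rewrite ge0_fin_numE// /J lebesgue_measure_itv/=; case: ifP; rewrite ?ltry.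
  by rewrite -(fineK Jf) -!EFinM ltry.
have mJ : measurable J by exact: measurable_itv.
have H2 := @product_measure1E _ _ _ _ R (leb1s R) (leb1s R) J J mJ mJ.
have H3 := @product_measure1E _ _ _ _ R (leb2s R) (leb1s R) (J `*` J) J (measurableX mJ mJ) mJ.
by apply: etrans H3 _; congr (_ * _)%E.
Qed.

Definition ind N : T -> R := \1_(box N).

Lemma ind1 N y : box N y -> ind N y = 1.
Proof. by move=> h; rewrite /ind indicE mem_set. Qed.
Lemma ind0 N y : ~ box N y -> ind N y = 0.
Proof. by move=> h; rewrite /ind indicE memNset. Qed.
Lemma ind_ge0 N y : 0 <= ind N y. Proof. by rewrite /ind indicE. Qed.
Lemma ind_le1 N y : ind N y <= 1.
Proof. by rewrite /ind indicE; case: (_ \in _). Qed.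
Lemma ind_meas N : M (ind N).
Proof. by apply: measurable_indic; exact: box_measurable. Qed.
Lemma ind_itg N : itg mu3 (ind N).
Proof. by apply: itg_indic; [exact: box_measurable|exact: box_finite]. Qed.

(** Local integrability and local boundedness are tested on boxes only, since every
    compact set lies in a box. *)
Definition Lloc f := M f /\ forall N, itg mu3 (fun y => ind N y * f y).
Definition Bloc f := M f /\ forall N, exists c, forall y, box N y -> `|f y| <= c.

Lemma BlocMLloc f g : Bloc f -> Lloc g -> Lloc (fun y => f y * g y).
Proof.
move=> [mf bf] [mg lg]; split; first exact: (measurable_funM mf mg).
move=> N; have [c fc] := bf N.
apply: (@itg_dom _ _ R mu3 _ (fun y => `|c| * `|ind N y * g y|)).
- by apply: measurable_funM; [exact: ind_meas|exact: (measurable_funM mf mg)].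
- by apply: itgZ; apply: itg_norm.
move=> y; have [By|By] := pselect (box N y); last first.
  by rewrite ind0// !mul0r normr0 mulr0.
rewrite ind1// !mul1r normrM ler_wpM2r//.
by rewrite (le_trans (fc y By))// ler_norm.
Qed.

Lemma Lloc1 : Lloc (fun=> 1).
Proof.
split; first exact: measurable_cst.
by move=> N; apply: (itg_ext _ (ind_itg N)) => y; rewrite mulr1.
Qed.

Lemma Bloc_Lloc f : Bloc f -> Lloc f.
Proof.
move=> bf; have := BlocMLloc bf Lloc1.
by rewrite (_ : (fun y => f y * 1) = f) //; apply/funext => y; rewrite mulr1.
Qed.

Lemma BlocM f g : Bloc f -> Bloc g -> Bloc (fun y => f y * g y).
Proof.
move=> [mf bf] [mg bg]; split; first exact: (measurable_funM mf mg).
move=> N; have [c fc] := bf N; have [d gd] := bg N; exists (c * d) => y By.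
by rewrite normrM ler_pM// ?fc ?gd.
Qed.

Lemma BlocD f g : Bloc f -> Bloc g -> Bloc (fun y => f y + g y).
Proof.
move=> [mf bf] [mg bg]; split; first exact: (measurable_funD mf mg).
move=> N; have [c fc] := bf N; have [d gd] := bg N; exists (c + d) => y By.
by rewrite (le_trans (ler_normD _ _))// lerD ?fc ?gd.
Qed.

Lemma Bloc_cst c : Bloc (fun=> c).
Proof. by split; [exact: measurable_cst|move=> N; exists `|c|]. Qed.

Lemma LlocD f g : Lloc f -> Lloc g -> Lloc (fun y => f y + g y).
Proof.
move=> [mf lf] [mg lg]; split; first exact: (measurable_funD mf mg).
move=> N; apply: (itg_ext _ (itgD (lf N) (lg N))) => y.
by rewrite mulrDr.
Qed.

Lemma elem_Bloc f : elem f -> Bloc f.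
Proof.
move=> af; split; first exact: elem_measurable.
move=> N; have [N0|N0] := ltP N 0.
  exists 0 => y /boxP /(_ ix1) h.
  by have := le_lt_trans h N0; rewrite ltNge normr_ge0.
have B0 : box N !=set0 by exists (0, 0, 0); apply/boxP => i;
  case: (ord3P i) => [->|[->|->]]; rewrite normr0.
have cf : {within box N, continuous (fun y => `|f y|)}.
  apply: continuous_subspaceT => y.
  apply: (@continuous_comp _ _ _ f Num.norm); first exact: elem_continuous.
  exact: norm_continuous.
have [c _ fc] := compact_EVT_max B0 (box_compact (N := N)) cf.
by exists `|f c| => y By; apply: fc; rewrite inE.
Qed.

(** These are fewer functions than all test functions. They suffice to identify
    locally integrable functions, see [flcv]. *)
Definition TF phi := elem phi /\ exists N, forall y, ~ box N y -> phi y = 0.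

Lemma TF_mul f phi : elem f -> TF phi -> TF (fun y => f y * phi y).
Proof.
move=> af [ap [N hN]]; split; first exact: elem_mul.
by exists N => y /hN ->; rewrite mulr0.
Qed.

Lemma TF_add f phi : TF f -> TF phi -> TF (fun y => f y + phi y).
Proof.
move=> [af [N hN]] [ap [N' hN']]; split; first exact: elem_add.
exists (Num.max N N') => y nB; rewrite hN ?hN' ?addr0// => By; apply: nB.
  by apply: box_sub By; rewrite le_max lexx orbT.
by apply: box_sub By; rewrite le_max lexx.
Qed.

Lemma partial_locally0 f j y (d : R) : 0 < d ->
  (forall h : R, `|h| < d -> f (y + h *: e j) = 0) -> partial j f y = 0.
Proof.
move=> d0 h0; suff d1 : is_derive y (e j) f 0 by rewrite /partial derive_val.
apply/is_derive_ray; apply: (@near_eq_is_derive _ _ _ (cst 0)).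
  exists d => //= z /=; rewrite sub0r normrN => zd.
  by rewrite h0.
Qed.

Lemma crd_ray i j (h : R) y : coord3 i (y + h *: e j) = coord3 i y + h * (i == j)%:R.
Proof.
case: (ord3P i) => [->|[->|->]]; case: (ord3P j) => [->|[->|->]] /=;
  by rewrite /coord3 /= /GRing.scale/= ?mulr1 ?mulr0 ?addr0.
Qed.

Lemma box_ray N j (h : R) y : box N (y + h *: e j) -> box (N + `|h|) y.
Proof.
move=> /boxP H; apply/boxP => i; have := H i; rewrite crd_ray => {}H.
rewrite -[coord3 i y](addrK (h * (i == j)%:R)).
rewrite (le_trans (ler_normB _ _))// lerD// normrM.
by case: (i == j); rewrite ?normr1 ?mulr1// normr0 mulr0.
Qed.

Lemma TF_partial j phi : TF phi -> TF (partial j phi).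
Proof.
move=> [ap [N hN]]; split; first exact: elem_partial.
exists (N + 1) => y nB; apply: (@partial_locally0 _ _ _ 1) => // h h1.
apply: hN => /box_ray By; apply: nB; apply: box_sub By.
by rewrite lerD2l ltW.
Qed.

Lemma TF_shift v phi : TF phi -> TF (fun y => phi (y + v)).
Proof.
move=> [ap [N hN]]; split; first exact: elem_shift.
pose V := `|coord3 ix1 v| + `|coord3 ix2 v| + `|coord3 ix3 v|.
exists (N + V) => y nB; apply: hN => /boxP By; apply: nB; apply/boxP => i.
have E : coord3 i (y + v) = coord3 i y + coord3 i v.
  by case: (ord3P i) => [->|[->|->]].
have := By i; rewrite E => H.
rewrite -[coord3 i y](addrK (coord3 i v)) (le_trans (ler_normB _ _))// lerD//.
rewrite /V; case: (ord3P i) => [->|[->|->]].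
- by rewrite -addrA lerDl addr_ge0.
- by rewrite addrAC lerDr addr_ge0.
- by rewrite lerDr addr_ge0.
Qed.

Lemma TF_bound phi : TF phi -> exists c, forall y, `|phi y| <= c.
Proof.
move=> [/elem_Bloc[_ bp] [N hN]]; have [c hc] := bp N.
exists `|c| => y; have [By|By] := pselect (box N y).
  by rewrite (le_trans (hc y By))// ler_norm.
by rewrite hN// normr0.
Qed.

Lemma TF_meas phi : TF phi -> M phi.
Proof. by move=> [/elem_measurable]. Qed.

Lemma Lloc_TF f phi : Lloc f -> TF phi -> itg mu3 (fun y => f y * phi y).
Proof.
move=> lf tp; have [ap [N hN]] := tp; have [c hc] := TF_bound tp.
have [_ /(_ N)] := BlocMLloc (elem_Bloc ap) lf.
apply: itg_ext => y; have [By|By] := pselect (box N y).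
  by rewrite ind1// mul1r mulrC.
by rewrite hN// !(mul0r, mulr0).
Qed.

Definition rad2 y : R := coord3 ix1 y * coord3 ix1 y + coord3 ix2 y * coord3 ix2 y.
Definition nrm2 y : R := rad2 y + coord3 ix3 y * coord3 ix3 y.

Lemma elem_rad2 : elem rad2.
Proof. by apply: elem_add; apply: elem_mul; exact: elem_crd. Qed.
Lemma elem_nrm2 : elem nrm2.
Proof. by apply: elem_add; [exact: elem_rad2|apply: elem_mul; exact: elem_crd]. Qed.

Lemma box_nrm2 N y : 0 <= N -> nrm2 y <= N ^+ 2 -> box N y.
Proof.
rewrite /nrm2 /rad2 => N0 H; apply/boxP => i.
rewrite -[leRHS]ger0_norm// -ler_sqr ?nnegrE// !real_normK ?num_real//.
by case: (ord3P i) => [->|[->|->]]; nra.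
Qed.

Lemma nrm2_box N y : box N y -> nrm2 y <= 3 * N ^+ 2.
Proof.
rewrite /nrm2 /rad2 => /boxP H.
have K i : coord3 i y * coord3 i y <= N ^+ 2.
  by rewrite -expr2 -real_normK ?num_real// ler_pXn2r ?nnegrE// (le_trans _ (H i)).
by have := K ix1; have := K ix2; have := K ix3; lra.
Qed.

Definition cut (a : R) y : R := zeta (nrm2 y + (- a)).

Lemma TF_cut a : TF (cut a).
Proof.
split; first by apply: elem_zeta; apply: elem_add; [exact: elem_nrm2|exact: elem_cst].
exists (`|a| + 1) => y nB; apply: zeta_eq0; rewrite leNgt; apply/negP => H.
apply: nB; apply: box_nrm2; first by rewrite addr_ge0.
have : nrm2 y <= a + 1 by move: H; rewrite ltrBlDr addrC => /ltW.
move=> /le_trans; apply; apply: (@le_trans _ _ (`|a| + 1)).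
  by rewrite lerD2r ler_norm.
by rewrite expr2 ler_peMl ?addr_ge0// lerDr.
Qed.

Lemma cut_eq1 a y : nrm2 y <= a -> cut a y = 1.
Proof. by move=> H; rewrite /cut zeta_eq1// subr_le0. Qed.

Lemma partial_cut a j y : partial j (cut a) y = dzeta (nrm2 y - a) * (2 * coord3 j y).
Proof.
have ac i := @elem_crd R i.
have a1 := elem_add elem_nrm2 (elem_cst (- a)).
rewrite /cut (partial_zeta j a1) (partialD j elem_nrm2 (elem_cst _)) partial_cst.
rewrite /nrm2 (partialD j elem_rad2 (elem_mul (ac _) (ac _))).
rewrite /rad2 (partialD j (elem_mul (ac _) (ac _)) (elem_mul (ac _) (ac _))).
rewrite !(partialM j (ac _) (ac _)) !partial_crd; congr (_ * _).
by case: (ord3P j) => [->|[->|->]] /=; rewrite !(mulr1, mulr0, addr0, add0r); ring.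
Qed.

End loc.

(** * The fundamental lemma of the calculus of variations *)

Section pi_lambda.
Context d d' (X : measurableType d) (Y : measurableType d') (R : realType)
  (mu : {measure set X -> \bar R}).
Variables (pi : X -> Y) (mpi : measurable_fun setT pi) (k : X -> R) (ik : itg mu k).
Variable G : set (set Y).
Hypothesis GI : setI_closed G.
Hypothesis Gmeas : @measurable _ Y `<=` <<s G >>.
Hypothesis Gsub : G `<=` @measurable _ Y.

Let mpiA A : measurable A -> measurable (pi @^-1` A).
Proof. by move=> mA; rewrite -[X in measurable X]setTI; exact: mpi. Qed.

Lemma itg_mul_indic (A : set X) : measurable A -> itg mu (fun x => k x * \1_A x).
Proof.
move=> mA; apply: (@itg_dom _ _ R mu _ (fun x => `|k x|)).
- by apply: measurable_funM; [exact: itg_meas ik|exact: measurable_indic].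
- exact: itg_norm.
- by move=> x; rewrite normrM indicE; case: (_ \in _); rewrite ?normr1 ?mulr1 ?normr0 ?mulr0.
Qed.

(** The sets [A] for which the integral of [k] over the preimage of [A] vanishes
    form a lambda-system, so a pi-system of generators is enough. *)
Lemma pi_lambda_integral :
  \int[mu]_(x in setT) k x = 0 ->
  (forall A, G A -> \int[mu]_(x in setT) (k x * \1_(pi @^-1` A) x) = 0) ->
  forall A, measurable A -> \int[mu]_(x in setT) (k x * \1_(pi @^-1` A) x) = 0.
Proof.
move=> k0 kG.
pose H : set (set Y) := [set A | measurable A /\
   \int[mu]_(x in setT) (k x * \1_(pi @^-1` A) x) = 0].
suff HH : @measurable _ Y `<=` H by move=> A /HH [].
apply: (subset_trans Gmeas).
apply: lambda_system_subset => //; last first.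
  by move=> A GA; split; [exact: Gsub|exact: kG].
split => //.
- split => //; rewrite preimage_setT -[RHS]k0; apply: I_ext => x.
  by rewrite indicT mulr1.
- move=> A B BA [mA kA] [mB kB]; split; first exact: measurableD.
  rewrite -[RHS](subrr (\int[mu]_(x in setT) (k x * \1_(pi @^-1` A) x))).
  rewrite [X in _ = _ - X](_ : _ = \int[mu]_(x in setT) (k x * \1_(pi @^-1` B) x)).
    rewrite -IB; try exact: itg_mul_indic (mpiA _).
    apply: I_ext => x; rewrite -mulrBr !indicE; congr (_ * _).
    have [Bx|nB] := pselect (B (pi x)).
      rewrite (@memNset _ (pi @^-1` (A `\` B))) => [|[]//].
      by rewrite !mem_set ?subrr//; exact: BA.
    rewrite (@memNset _ (pi @^-1` B))// subr0; congr (nat_of_bool _)%:R.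
    by apply/idP/idP; rewrite !inE => // -[].
  by rewrite kA kB.
- move=> F ndF HF; split; first by apply: bigcupT_measurable => i; have [] := HF i.
  pose f n x := k x * \1_(pi @^-1` F n) x.
  have [] := @I_dct _ X R mu f (fun x => k x * \1_(pi @^-1` (\bigcup_i F i)) x) (fun x => `|k x|).
  - by move=> n; apply: itg_meas; apply: itg_mul_indic; apply: mpiA; have [] := HF n.
  - apply: itg_meas; apply: itg_mul_indic; apply: mpiA.
    by apply: bigcupT_measurable => i; have [] := HF i.
  - exact: itg_norm.
  - by move=> n x; rewrite normrM indicE; case: (_ \in _); rewrite ?normr1 ?mulr1 ?normr0 ?mulr0.
  - apply: aeW => x; have [[N _ FN]|nF] := pselect ((\bigcup_i F i) (pi x)).
      apply: (@cvg_near_cst _ _ _ (f ^~ x)); exists N => // n /= Nn.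
      rewrite /f !indicE !mem_set//; first by exists N.
      by have /subsetPset := ndF N n Nn; apply.
    rewrite (_ : (fun n => f n x) = cst (k x * \1_(pi @^-1` (\bigcup_i F i)) x)); last first.
      apply/funext => n; rewrite /f !indicE !memNset// => Fn.
      by apply: nF; exists n.
    exact: cvg_cst.
  move=> _; rewrite (_ : (fun n => _) = cst 0); last first.
    by apply/funext => n; have [_] := HF n.
  by move=> /cvg_lim <-//; rewrite lim_cst.
Qed.

End pi_lambda.

Definition rects d1 d2 (X1 : measurableType d1) (X2 : measurableType d2) : set (set (X1 * X2)) :=
  [set A `*` B | A in measurable & B in measurable].

Lemma rects_setI d1 d2 (X1 : measurableType d1) (X2 : measurableType d2) :
  setI_closed (@rects _ _ X1 X2).
Proof.
move=> _ _ [A mA [B mB <-]] [A' mA' [B' mB' <-]].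
exists (A `&` A'); first exact: measurableI.
by exists (B `&` B'); [exact: measurableI|rewrite setXI].
Qed.

Lemma rects_sub d1 d2 (X1 : measurableType d1) (X2 : measurableType d2) :
  @rects _ _ X1 X2 `<=` measurable.
Proof. by move=> _ [A mA [B mB <-]]; exact: measurableX. Qed.

Lemma rects_gen d1 d2 (X1 : measurableType d1) (X2 : measurableType d2) :
  @measurable _ (X1 * X2)%type `<=` <<s @rects _ _ X1 X2 >>.
Proof. by rewrite measurable_prod_measurableType. Qed.

Section flcv.
Variable R : realType.
Local Notation T := (vec3 R).
Local Notation mu3 := (leb3 R).
Local Notation mT := (measurableTypeR R * measurableTypeR R * measurableTypeR R)%type.
Local Notation M f := (@measurable_fun _ _ mT R setT f).
Implicit Types (i : 'I_3) (f h phi : T -> R) (s t : R) (y : T).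

Definition oray (o : option R) : set R := if o is Some p then `]p, +oo[%classic else setT.
(** The functions exp(-1/(n (t - p))) increase to the indicator of the ray beyond
    [p]. *)
Definition bmp (o : option R) (n : nat) t : R :=
  if o is Some p then flat 0 (n.+1%:R * (t + (- p))) else 1.

Lemma bmp_ge0 o n t : 0 <= bmp o n t.
Proof. by case: o => //= p; exact: flat_ge0. Qed.
Lemma bmp_le1 o n t : bmp o n t <= 1.
Proof. by case: o => //= p; exact: flat0_le1. Qed.

Lemma bmp_cvg o t : bmp o n t @[n --> \oo] --> (\1_(oray o) t : R).
Proof.
case: o => [p|]; last by rewrite indicT; exact: cvg_cst.
have [tp|tp] := leP t p.
  rewrite indicE memNset; last by rewrite /= in_itv/= andbT ltNge tp.
  rewrite (_ : bmp _ ^~ t = cst 0); first exact: cvg_cst.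
  apply/funext => n /=; rewrite flat_le0//; rewrite mulr_ge0_le0// subr_le0//.
rewrite indicE mem_set; last by rewrite /= in_itv/= tp.
have d0 : 0 < t - p by rewrite subr_gt0.
rewrite (_ : bmp _ ^~ t = fun n => expR (- ((t - p)^-1 * n.+1%:R^-1))); last first.
  apply/funext => n /=; rewrite /flat mulr_gt0// expr0 mul1r invfM//.
  by rewrite mulrC.
have -> : (true%:R : R) = expR (- ((t - p)^-1 * 0)) by rewrite mulr0 oppr0 expR0.
apply: (@continuous_cvg _ R R _ _ (fun n => (t - p)^-1 * n.+1%:R^-1) (fun x : R => expR (- x))).
  by apply: continuous_comp; [exact: opp_continuous|exact: continuous_expR].
by apply: cvgM; [exact: cvg_cst|exact: cvg_harmonic].
Qed.

Lemma elem_bmp o n i : elem (fun y => bmp o n (coord3 i y)).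
Proof.
case: o => [p|] /=; last exact: elem_cst.
apply: elem_flat; apply: elem_mul; first exact: elem_cst.
by apply: elem_add; [exact: elem_crd|exact: elem_cst].
Qed.

Definition orays : set (set R) := range oray.

Lemma orays_setI : setI_closed orays.
Proof.
move=> _ _ [[p|] _ <-] [[q|] _ <-].
- exists (Some (Num.max p q)) => //=; apply/seteqP; split => x /=.
    by rewrite !in_itv/= !andbT gt_max => /andP.
  by rewrite !in_itv/= !andbT gt_max => -[-> ->].
- by exists (Some p); rewrite //= setIT.
- by exists (Some q); rewrite //= setTI.
- by exists None; rewrite //= setTI.
Qed.

Lemma orays_gen : @measurable _ (measurableTypeR R) `<=` <<s orays >>.
Proof.
rewrite [X in X `<=` _](_ : _ = <<s @RGenOInfty.G R >>).
  apply: smallest_sub; first exact: smallest_sigma_algebra.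
  by move=> _ [p ->]; apply: sub_sigma_algebra; exists (Some p).
exact: RGenOInfty.measurableE.
Qed.

Lemma orays_sub : orays `<=` @measurable _ (measurableTypeR R).
Proof. by move=> _ [[p|] _ <-] //=; exact: measurable_itv. Qed.

Definition cyl i (A : set R) : set T := coord3 i @^-1` A.

Lemma measurable_crd i : @measurable_fun _ _ mT (measurableTypeR R) setT (coord3 i).
Proof. by have := elem_measurable (@elem_crd R i). Qed.

Lemma measurable_cyl i (A : set R) : @measurable _ (measurableTypeR R) A ->
  @measurable _ mT (cyl i A).
Proof. by move=> mA; rewrite -[X in measurable X]setTI; exact: measurable_crd. Qed.

Lemma bmp_cvg_cyl o i y :
  bmp o n (coord3 i y) @[n --> \oo] --> (\1_(cyl i (oray o)) y : R).
Proof.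
rewrite (_ : \1_(cyl i (oray o)) y = \1_(oray o) (coord3 i y)); first exact: bmp_cvg.
by rewrite !indicE; congr (nat_of_bool _)%:R; apply/idP/idP; rewrite !inE.
Qed.

Section fixed.
Variables (h : T -> R) (lh : Lloc h).
Hypothesis h0 : forall phi, TF phi -> \int[mu3]_(y in setT) (h y * phi y) = 0.
Variable a : R.
Let k y := h y * cut a y.
Let ik : itg mu3 k. Proof. exact: Lloc_TF lh (TF_cut a). Qed.

(** Products of [bmp] functions with a cutoff are test functions and converge to
    indicators of products of rays. *)
Lemma flcv_rays (o1 o2 o3 : option R) :
  \int[mu3]_(y in setT) (k y * \1_(cyl ix1 (oray o1)) y *
    \1_(cyl ix2 (oray o2)) y * \1_(cyl ix3 (oray o3)) y) = 0.
Proof.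
pose F n y := k y * bmp o1 n (coord3 ix1 y) * bmp o2 n (coord3 ix2 y)
   * bmp o3 n (coord3 ix3 y).
have mo i o : M (\1_(cyl i (oray o))).
  by apply: measurable_indic; apply: measurable_cyl; apply: orays_sub; exists o.
have [] := @I_dct _ mT R mu3 F (fun y => k y * \1_(cyl ix1 (oray o1)) y *
    \1_(cyl ix2 (oray o2)) y * \1_(cyl ix3 (oray o3)) y) (fun y => `|k y|).
- move=> n; have mb o i := elem_measurable (elem_bmp o n i).
  exact: measurable_funM (measurable_funM (measurable_funM (itg_meas ik) (mb _ _)) (mb _ _)) (mb _ _).
- exact: measurable_funM (measurable_funM (measurable_funM (itg_meas ik) (mo _ _)) (mo _ _)) (mo _ _).
- exact: itg_norm.
- move=> n y; rewrite /F.
  have H o t : `|bmp o n t| <= 1 by rewrite ger0_norm ?bmp_ge0// bmp_le1.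
  have H3 (q x1 x2 x3 : R) : `|x1| <= 1 -> `|x2| <= 1 -> `|x3| <= 1 ->
      `|q * x1 * x2 * x3| <= `|q|.
    by move=> *; rewrite !normrM -!mulrA ler_piMr// !mulr_ile1 ?mulr_ge0.
  exact: H3.
- apply: aeW => y; rewrite /F.
  have C0 : (fun _ : nat => k y) @ \oo --> (k y : R) by exact: cvg_cst.
  have H := (cvgM (cvgM (cvgM C0 (@bmp_cvg_cyl o1 ix1 y)) (@bmp_cvg_cyl o2 ix2 y))
    (@bmp_cvg_cyl o3 ix3 y)).
  exact: H.
move=> _; rewrite (_ : (fun n => _) = cst 0); last first.
  apply/funext => n; rewrite /= -[RHS](h0 (phi := fun y => (bmp o1 n (coord3 ix1 y) *
    (bmp o2 n (coord3 ix2 y) * bmp o3 n (coord3 ix3 y))) * cut a y)).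
    by apply: I_ext => y; rewrite /F /k; ring.
  apply: TF_mul; last exact: TF_cut.
  by do 2?apply: elem_mul; exact: elem_bmp.
by move=> /cvg_lim <-//; rewrite lim_cst.
Qed.

Lemma itg_k_ind (B : set T) : @measurable _ mT B -> itg mu3 (fun y => k y * \1_B y).
Proof. exact: itg_mul_indic. Qed.

Let itg2 (B : set T) f : @measurable _ mT B -> itg mu3 f -> itg mu3 (fun y => f y * \1_B y).
Proof. by move=> mB fi; exact: itg_mul_indic. Qed.

Let moc i o : @measurable _ mT (cyl i (oray o)).
Proof. by apply: measurable_cyl; apply: orays_sub; exists o. Qed.

Let None1 i y : \1_(cyl i (oray None)) y = 1 :> R.
Proof. by rewrite indicE mem_set. Qed.

(** From rays to arbitrary measurable sets, one coordinate at a time. *)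
Lemma flcv_s1 o1 o2 A3 : @measurable _ (measurableTypeR R) A3 ->
  \int[mu3]_(y in setT) (k y * \1_(cyl ix1 (oray o1)) y *
    \1_(cyl ix2 (oray o2)) y * \1_(cyl ix3 A3) y) = 0.
Proof.
move=> m3.
apply: (pi_lambda_integral (@measurable_crd ix3) _ orays_setI orays_gen orays_sub) => //.
- by do 2?apply: itg2.
- rewrite -[RHS](flcv_rays o1 o2 None); apply: I_ext => y.
  by rewrite None1 mulr1.
- by move=> _ [w _ <-]; exact: flcv_rays.
Qed.

Lemma flcv_s2 o1 A2 A3 : @measurable _ (measurableTypeR R) A2 ->
  @measurable _ (measurableTypeR R) A3 ->
  \int[mu3]_(y in setT) (k y * \1_(cyl ix1 (oray o1)) y *
    \1_(cyl ix3 A3) y * \1_(cyl ix2 A2) y) = 0.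
Proof.
move=> m2 m3.
apply: (pi_lambda_integral (@measurable_crd ix2) _ orays_setI orays_gen orays_sub) => //.
- by do 2?apply: itg2 => //; exact: measurable_cyl.
- rewrite -[RHS](flcv_s1 o1 None m3); apply: I_ext => y.
  by rewrite None1 mulr1.
- move=> _ [w _ <-]; rewrite -[RHS](flcv_s1 o1 w m3); apply: I_ext => y.
  by rewrite mulrAC.
Qed.

Lemma flcv_s3 A1 A2 A3 : @measurable _ (measurableTypeR R) A1 ->
  @measurable _ (measurableTypeR R) A2 -> @measurable _ (measurableTypeR R) A3 ->
  \int[mu3]_(y in setT) (k y * \1_(cyl ix3 A3) y * \1_(cyl ix2 A2) y *
    \1_(cyl ix1 A1) y) = 0.
Proof.
move=> m1 m2 m3.
apply: (pi_lambda_integral (@measurable_crd ix1) _ orays_setI orays_gen orays_sub) => //.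
- by do 2?apply: itg2 => //; exact: measurable_cyl.
- rewrite -[RHS](flcv_s2 None m2 m3); apply: I_ext => y.
  by rewrite None1 mulr1.
- move=> _ [w _ <-]; rewrite -[RHS](flcv_s2 w m2 m3); apply: I_ext => y.
  by rewrite mulrAC; congr (_ * _); rewrite mulrAC.
Qed.

Let m2T := (measurableTypeR R * measurableTypeR R)%type.

Lemma flcv_s4 (B : set (R * R)) A3 : @measurable _ m2T B ->
  @measurable _ (measurableTypeR R) A3 ->
  \int[mu3]_(y in setT) (k y * \1_(cyl ix3 A3) y * \1_((fst : T -> R * R) @^-1` B) y) = 0.
Proof.
move=> mB m3.
have mfst : @measurable_fun _ _ mT m2T setT fst by exact: measurable_fst.
apply: (pi_lambda_integral mfst _ (@rects_setI _ _ _ _) (@rects_gen _ _ _ _) (@rects_sub _ _ _ _)) => //.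
- by apply: itg2 => //; exact: measurable_cyl.
- rewrite -[RHS](flcv_s3 measurableT measurableT m3); apply: I_ext => y.
  by rewrite /cyl !preimage_setT !indicT !mulr1.
- move=> _ [A1 m1 [A2 m2 <-]]; rewrite -[RHS](flcv_s3 m1 m2 m3); apply: I_ext => y.
  rewrite -[RHS]mulrA; congr (_ * _); rewrite !indicE -natrM mulnb; congr (nat_of_bool _)%:R.
  by apply/idP/andP; rewrite !inE /cyl /= => -[].
Qed.

Lemma flcv_s5 (B : set T) : @measurable _ mT B ->
  \int[mu3]_(y in setT) (k y * \1_B y) = 0.
Proof.
move=> mB.
have mid : @measurable_fun _ _ mT mT setT id by exact: measurable_id.
rewrite -[RHS](@pi_lambda_integral _ _ mT mT R mu3 id mid k ik _
  (@rects_setI _ _ _ _) (@rects_gen _ _ _ _) (@rects_sub _ _ _ _) _ _ B mB) //.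
- rewrite -[RHS](flcv_s4 measurableT measurableT); apply: I_ext => y.
  by rewrite /cyl !preimage_setT !indicT !mulr1.
- move=> _ [A1 m1 [A2 m2 <-]]; rewrite -[RHS](flcv_s4 m1 m2); apply: I_ext => y.
  rewrite -[RHS]mulrA; congr (_ * _); rewrite !indicE -natrM mulnb; congr (nat_of_bool _)%:R.
  by apply/idP/andP; rewrite !inE /cyl /= => -[].
Qed.

Lemma flcv_k : {ae mu3, forall y, k y = 0}.
Proof.
have mk := itg_meas ik.
have mP : @measurable _ mT (k @^-1` `]0, +oo[).
  by rewrite -[X in measurable X]setTI; apply: mk => //; exact: measurable_itv.
have mN : @measurable _ mT (k @^-1` `]-oo, 0[).
  by rewrite -[X in measurable X]setTI; apply: mk => //; exact: measurable_itv.
have aP := I_eq0 (itg_k_ind mP) _ _.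
have {aP} HP : {ae mu3, forall y, k y * \1_(k @^-1` `]0, +oo[) y = 0}.
  apply: aP; last by rewrite flcv_s5.
  move=> y; rewrite indicE; have [|] := pselect ((k @^-1` `]0, +oo[) y) => H.
    by rewrite mem_set// mulr1; move: H; rewrite /= in_itv/= andbT => /ltW.
  by rewrite memNset// mulr0.
have aN := I_eq0 (itgZ (-1) (itg_k_ind mN)) _ _.
have {aN} HN : {ae mu3, forall y, -1 * (k y * \1_(k @^-1` `]-oo, 0[) y) = 0}.
  apply: aN; last by rewrite IZ ?flcv_s5 ?mulr0//; exact: itg_k_ind.
  move=> y; rewrite indicE; have [|] := pselect ((k @^-1` `]-oo, 0[) y) => H.
    rewrite mem_set// mulr1 mulN1r oppr_ge0; move: H; rewrite /= in_itv/=; exact: ltW.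
  by rewrite memNset// !mulr0.
apply: (ae2 HN HP) => y {}HN {}HP.
have [k0|k0|//] := ltgtP (k y) 0.
- by move: HN; rewrite indicE mem_set /= ?in_itv//= mulr1 mulN1r => /eqP; rewrite oppr_eq0 => /eqP.
- by move: HP; rewrite indicE mem_set /= ?in_itv/= ?andbT//= mulr1.
Qed.

End fixed.

(** Testing with approximations of indicators of products of rays shows, by repeated
    pi-lambda arguments, that the integral of [h] times a cutoff vanishes over every
    measurable set; the sets where [h] is positive and where it is negative then
    conclude. *)
Lemma flcv h : Lloc h ->
  (forall phi, TF phi -> \int[mu3]_(y in setT) (h y * phi y) = 0) ->
  {ae mu3, forall y, h y = 0}.
Proof.
move=> lh h0.
have := ae_foralln (fun n : nat => flcv_k lh h0 n%:R).
apply: filterS => y Hy.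
have [n ny] : exists n : nat, nrm2 y <= n%:R.
  by exists (Num.truncn (nrm2 y)).+1; apply: ltW; exact: truncnS_gt.
by have := Hy n; rewrite cut_eq1// mulr1.
Qed.

End flcv.

(** * Weak derivatives *)

Section weak.
Variable R : realType.
Local Notation T := (vec3 R).
Local Notation e := (@std_basis R).
Local Notation mu1 := (@lebesgue_measure R).
Local Notation mu3 := (leb3 R).
Implicit Types (i : 'I_3) (f g h phi : T -> R) (c s t : R) (y v : T).

Lemma FTC_line (F f : R -> R) t : 0 < t -> (forall s, is_derive s 1 F (f s)) ->
  continuous f ->
  \int[mu1]_(s in setT) (\1_(`[0, t]%classic) s * f s) = F t - F 0.
Proof.
move=> t0 dF cf.
transitivity (\int[mu1]_(s in `[0, t]) f s).
  rewrite [RHS]Rintegral_mkcond; apply: eq_Rintegral => s _.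
  by rewrite patchE indicE; case: ifP => _; rewrite ?mul1r ?mul0r.
have cF : continuous F.
  move=> s; apply: differentiable_continuous; apply/derivable1_diffP.
  by have [] := dF s.
rewrite /Rintegral (@continuous_FTC2 R f F 0 t)//.
- exact: continuous_subspaceT.
- split.
  + by move=> s _; have [] := dF s.
  + by apply: cvg_at_right_filter; exact: cF.
  + by apply: cvg_at_left_filter; exact: cF.
- by move=> s _; rewrite derive1E; have [_ ->] := dF s.
Qed.

Lemma is_derive_ray_at (y v : T) (s : R) f (d : R) :
  is_derive (y + s *: v) v f d -> is_derive s 1 (fun h : R => f (y + h *: v)) d.
Proof.
move=> /is_derive_ray [d1 d2].
have E : (fun h : R => h^-1 *: (((fun h : R => f (y + h *: v)) \o shift s) (h *: 1) -
    f (y + s *: v))) = (fun h : R => h^-1 *: (((fun h : R => f (y + s *: v + h *: v)) \o shift 0) (h *: 1) -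
    f (y + s *: v + 0 *: v))).
  apply/funext => h /=; rewrite scale0r !addr0; congr (_ *: (f _ - _)).
  by rewrite -addrA -scalerDl [s + _]addrC.
split; rewrite /derivable /derive.
  by rewrite E.
by rewrite E.
Qed.

Lemma line_avg f g v t y : 0 < t -> (forall z, is_derive z v f (g z)) ->
  continuous g -> avg v t g y = f (y + t *: v) - f y.
Proof.
move=> t0 df cg.
apply: (etrans (@FTC_line (fun s => f (y + s *: v)) (fun s => g (y + s *: v)) t t0 _ _)).
- by move=> s; exact: is_derive_ray_at.
- move=> s; apply: (@continuous_comp _ _ _ (fun s : R => y + s *: v) g); last exact: cg.
  apply: continuousD; first exact: cst_continuous.
  exact: scalel_continuous.
- by rewrite scale0r addr0.
Qed.

Lemma is_deriveNdir (y v : T) f (d : R) : is_derive y v f d -> is_derive y (- v) f (- d).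
Proof.
move=> /is_derive_ray df; apply/is_derive_ray.
have dN : is_derive (0 : R) 1 (fun h : R => - h) (-1) by exact: is_deriveNid.
have := @is_derive1_comp R (fun h : R => f (y + h *: v)) (fun h : R => - h) 0 d (-1).
rewrite oppr0 => /(_ df dN); rewrite mulrN1.
by rewrite (_ : _ \o _ = (fun h : R => f (y + h *: - v))) //;
  apply/funext => h /=; rewrite scalerN scaleNr.
Qed.

Lemma elem_avg f i t y : elem f -> 0 < t ->
  avg (e i) t (partial i f) y = f (y + t *: e i) - f y.
Proof.
move=> af t0; apply: line_avg => //; first by move=> z; exact: elem_is_derive.
exact: elem_continuous (elem_partial i af).
Qed.

Lemma elem_avgN f i t y : elem f -> 0 < t ->
  avg (- e i) t (partial i f) y = f y - f (y + t *: - e i).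
Proof.
move=> af t0.
apply: (etrans (@line_avg (fun z => - f z) (partial i f) (- e i) t y t0 _ _)).
- move=> z; have dd := is_deriveN (is_deriveNdir (elem_is_derive z i af)).
  by rewrite opprK in dd.
- exact: elem_continuous (elem_partial i af).
- by rewrite opprK addrC.
Qed.

Definition wderiv i f g := [/\ Lloc f, Lloc g & forall phi, TF phi ->
  \int[mu3]_(y in setT) (f y * partial i phi y) =
  - \int[mu3]_(y in setT) (g y * phi y)].

Lemma TF_itg phi : TF phi -> itg mu3 phi.
Proof.
move=> tp; apply: itg_ext (Lloc_TF (Lloc1 R) tp) => y.
by rewrite mul1r.
Qed.

(** The average of a derivative over a unit segment is a difference of two
    translates, whose integrals agree; averaging does not change the integral. *)
Lemma int_partial0 i phi : TF phi -> \int[mu3]_(y in setT) partial i phi y = 0.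
Proof.
move=> tp; have [ap _] := tp; have tdp := TF_partial i tp.
have i1 := TF_itg tp; have i2 := TF_itg tdp.
have E : \int[mu3]_(y in setT) (1 * avg (e i) 1 (partial i phi) y) = 0.
  under I_ext => y do rewrite mul1r elem_avg//.
  rewrite IB//; last exact: itg_shift.
  by rewrite I_shift// subrr.
have := avg_dual (v := e i) (dual_ok1 i2) ler01 (itg_meas (avg_itg (e i) ler01 i2)).
rewrite E => H.
have B s : 0 <= s <= 1 -> `|\int[mu3]_(x in setT) (1 * partial i phi (x + s *: e i)) -
    \int[mu3]_(y in setT) partial i phi y| <= 0.
  move=> _; under I_ext => y do rewrite mul1r.
  by rewrite I_shift// subrr normr0.
have := I1_bound ler01 (kern_section (e i) (dual_ok1 i2) ler01) B.
by rewrite -H sub0r mulr0 mul1r normrN normr_le0 => /eqP.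
Qed.

Lemma wderiv_elem i a : elem a -> wderiv i a (partial i a).
Proof.
move=> aa; have ap := elem_partial i aa.
split; [exact: Bloc_Lloc (elem_Bloc aa)|exact: Bloc_Lloc (elem_Bloc ap)|].
move=> phi tp; have [aphi _] := tp.
have t1 := TF_mul aa (TF_partial i tp); have t2 := TF_mul ap tp.
apply/eqP; rewrite -addr_eq0 -ID; [|exact: TF_itg|exact: TF_itg].
rewrite -(int_partial0 i (TF_mul aa tp)) (partialM i aa aphi).
by apply/eqP; apply: I_ext => y; rewrite [partial i a y * _]mulrC.
Qed.

Lemma wderiv_elemM i a f g : elem a -> wderiv i f g ->
  wderiv i (fun y => a y * f y) (fun y => a y * g y + partial i a y * f y).
Proof.
move=> aa [lf lg fg]; have ap := elem_partial i aa.
have ba := elem_Bloc aa; have bp := elem_Bloc ap.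
have l1 := BlocMLloc ba lf; have l2 := BlocMLloc ba lg; have l3 := BlocMLloc bp lf.
split => //; first exact: LlocD.
move=> phi tp; have [aphi _] := tp.
have t1 := TF_mul aa tp; have := fg _ t1.
rewrite (partialM i aa aphi) => H.
have E1 : \int[mu3]_(y in setT) (f y * (a y * partial i phi y + phi y * partial i a y)) =
  \int[mu3]_(y in setT) (a y * f y * partial i phi y) +
  \int[mu3]_(y in setT) (partial i a y * f y * phi y).
  rewrite -ID; [|exact: Lloc_TF l1 (TF_partial i tp)|exact: Lloc_TF l3 tp].
  by apply: I_ext => y; ring.
have E2 : \int[mu3]_(y in setT) ((a y * g y + partial i a y * f y) * phi y) =
  \int[mu3]_(y in setT) (g y * (a y * phi y)) +
  \int[mu3]_(y in setT) (partial i a y * f y * phi y).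
  rewrite -ID; [|exact: Lloc_TF lg t1|exact: Lloc_TF l3 tp].
  by apply: I_ext => y; ring.
by rewrite E2 opprD -H E1 addrK.
Qed.

Lemma wderivD i f g f' g' : wderiv i f f' -> wderiv i g g' ->
  wderiv i (fun y => f y + g y) (fun y => f' y + g' y).
Proof.
move=> [lf lf' ff] [lg lg' gg]; split; [exact: LlocD|exact: LlocD|].
move=> phi tp; have tdp := TF_partial i tp.
under I_ext => y do rewrite mulrDl.
under [in RHS]I_ext => y do rewrite mulrDl.
rewrite !ID; try exact: Lloc_TF.
by rewrite ff// gg// opprD.
Qed.

Lemma wderivZ i c f f' : wderiv i f f' -> wderiv i (fun y => c * f y) (fun y => c * f' y).
Proof.
move=> H; have [lf lf' _] := H; have := wderiv_elemM (elem_cst c) H.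
rewrite partial_cst (_ : (fun y => c * f' y + 0 * f y) = (fun y => c * f' y)) //.
by apply/funext => y; rewrite mul0r addr0.
Qed.

Lemma wderiv_ae i f f' g g' : wderiv i f g -> Lloc f' -> Lloc g' ->
  {ae mu3, forall y, f y = f' y} -> {ae mu3, forall y, g y = g' y} -> wderiv i f' g'.
Proof.
move=> [lf lg H] lf' lg' ef eg; split => // phi tp.
have tdp := TF_partial i tp.
transitivity (\int[mu3]_(y in setT) (f y * partial i phi y)).
  apply: I_ae.
  - exact: itg_meas (Lloc_TF lf' tdp).
  - exact: itg_meas (Lloc_TF lf tdp).
  - by apply: (ae1 ef) => y ->.
rewrite H//; congr (- _); apply: I_ae.
- exact: itg_meas (Lloc_TF lg tp).
- exact: itg_meas (Lloc_TF lg' tp).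
- by apply: (ae1 eg) => y ->.
Qed.

End weak.

(** * The Leibniz rule for weak derivatives *)

Section weak_product.
Variable R : realType.
Local Notation T := (vec3 R).
Local Notation e := (@std_basis R).
Local Notation mu3 := (leb3 R).
Local Notation mT := (measurableTypeR R * measurableTypeR R * measurableTypeR R)%type.
Local Notation M f := (@measurable_fun _ _ mT R setT f).
Implicit Types (i : 'I_3) (f g h phi : T -> R) (c s t N : R) (y v : T).

Lemma itg_Lloc f : itg mu3 f -> Lloc f.
Proof.
move=> fi; split; first exact: itg_meas fi.
move=> N; apply: (@itg_dom _ _ R mu3 _ (fun y => `|f y|)).
- by apply: measurable_funM; [exact: ind_meas|exact: itg_meas fi].
- exact: itg_norm.
- move=> y; rewrite normrM ler_piMl//.
  by rewrite ger0_norm ?ind_ge0// ind_le1.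
Qed.

Lemma I_shift_mul v f g : itg mu3 (fun y => f y * g (y + v)) ->
  \int[mu3]_(y in setT) (f y * g (y + v)) =
  \int[mu3]_(y in setT) (f (y - v) * g y).
Proof.
move=> ii; rewrite -(I_shift (- v) ii); apply: I_ext => y.
by rewrite subrK.
Qed.

Lemma dual_ok_TF f phi : itg mu3 f -> TF phi -> dual_ok f phi.
Proof.
move=> fi tp; split; [exact: itg_meas fi|exact: TF_meas tp|right].
by have [c hc] := TF_bound tp; exists c.
Qed.

Lemma dual_ok_TF' f phi : itg mu3 f -> TF phi -> dual_ok phi f.
Proof.
move=> fi tp; split; [exact: TF_meas tp|exact: itg_meas fi|left].
by have [c hc] := TF_bound tp; exists c.
Qed.

Lemma elem_avgN_meas i t phi : 0 < t -> TF phi ->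
  M (avg (- e i) t (partial i phi)).
Proof.
move=> t0 tp; have [ap _] := tp.
rewrite (_ : avg _ _ _ = fun y => phi y - phi (y + t *: - e i)).
  by apply: measurable_funB; [exact: TF_meas tp|exact: measurable_comp_shift (TF_meas tp)].
by apply/funext => y; rewrite elem_avgN.
Qed.

(** Tested against a test function both sides agree, by translation invariance and
    the duality of averages; the fundamental lemma concludes. *)
Lemma weak_FTC i f g t : wderiv i f g -> itg mu3 f -> itg mu3 g -> 0 < t ->
  {ae mu3, forall x, f (x + t *: e i) - f x = avg (e i) t g x}.
Proof.
move=> [_ _ fg] fi gi t0; have t0' := ltW t0.
have ia := avg_itg (e i) t0' gi.
have fs := itg_shift (t *: e i) fi.
pose h x := f (x + t *: e i) - f x - avg (e i) t g x.
have ih : itg mu3 h by apply: itgB => //; exact: itgB.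
suff H : {ae mu3, forall y, h y = 0}.
  by apply: (ae1 H) => x /eqP; rewrite subr_eq0 => /eqP.
apply: flcv; first exact: itg_Lloc.
move=> phi tp; have tdp := TF_partial i tp; have [ap _] := tp.
have tps := TF_shift (- (t *: e i)) tp.
have l1 := Lloc_TF (itg_Lloc fs) tp; have l2 := Lloc_TF (itg_Lloc fi) tp.
have l3 := Lloc_TF (itg_Lloc ia) tp.
have l4 : itg mu3 (fun y => phi y * f (y + t *: e i)).
  by apply: itg_ext l1 => y; rewrite mulrC.
have E1 : \int[mu3]_(y in setT) (h y * phi y) =
  \int[mu3]_(y in setT) (f (y + t *: e i) * phi y) -
  \int[mu3]_(y in setT) (f y * phi y) -
  \int[mu3]_(y in setT) (phi y * avg (e i) t g y).
  rewrite -IB// -IB//; last 2 first.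
  - exact: itgB.
  - by apply: itg_ext l3 => y; rewrite mulrC.
  by apply: I_ext => y; rewrite /h; ring.
have E2 : \int[mu3]_(y in setT) (f (y + t *: e i) * phi y) =
  \int[mu3]_(y in setT) (f y * phi (y - t *: e i)).
  transitivity (\int[mu3]_(y in setT) (phi y * f (y + t *: e i))).
    by apply: I_ext => y; rewrite mulrC.
  by rewrite I_shift_mul//; apply: I_ext => y; rewrite mulrC.
(* Averaging forwards is dual to averaging backwards, and the backward average
   of a derivative of a test function is a difference of the test function. *)
have E3 : \int[mu3]_(y in setT) (phi y * avg (e i) t g y) =
   - \int[mu3]_(y in setT) (f y * avg (- e i) t (partial i phi) y).
  rewrite (avg_dual (dual_ok_TF' gi tp) t0' (itg_meas ia)).
  rewrite (avg_dual (dual_ok_TF fi tdp) t0' (elem_avgN_meas i t0 tp)).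
  rewrite -[RHS]mulN1r -IZ; last exact: kern_section (dual_ok_TF fi tdp) t0'.
  apply: I_ext => s; rewrite [RHS]mulrCA; congr (_ * _).
  have [c [_ H]] := dual_okP (dual_ok_TF' gi tp).
  rewrite I_shift_mul; last by have [] := H (e i) s.
  have tsp := TF_shift (- (s *: e i)) tp.
  transitivity (\int[mu3]_(x in setT) (g x * phi (x - s *: e i))).
    by apply: I_ext => y; rewrite mulrC.
  rewrite mulN1r; apply/eqP; rewrite -eqr_oppLR -(fg _ tsp) (partial_shift _ i ap).
  by apply/eqP; apply: I_ext => y; rewrite scalerN.
rewrite E1 E2 E3 opprK.
have dk := dual_ok_TF fi tdp.
have l5 := itg_mul_avg dk t0' (elem_avgN_meas i t0 tp).
rewrite -IB//; last by have := Lloc_TF (itg_Lloc fi) tps.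
rewrite -ID//; last by apply: itgB => //; have := Lloc_TF (itg_Lloc fi) tps.
rewrite (_ : (fun y => _) = fun=> 0); first by rewrite /Rintegral integral0.
apply/funext => y; rewrite elem_avgN// scalerN; ring.
Qed.

Lemma TF_lip i phi : TF phi -> exists c, forall x t,
  `|phi (x + t *: e i) - phi x| <= `|t| * c.
Proof.
move=> tp; have [ap _] := tp; have tdp := TF_partial i tp.
have [c hc] := TF_bound tdp; exists c => x t.
have [t0|t0|->] := ltgtP t 0; last by rewrite scale0r addr0 subrr normr0 mul0r.
- have nt0 : 0 < - t by rewrite oppr_gt0.
  rewrite (ltr0_norm t0) -normrN opprB.
  have := avg_bound (- e i) x (ltW nt0) (TF_meas tdp) hc.
  by rewrite elem_avgN// scalerN scaleNr opprK.
- rewrite (gtr0_norm t0).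
  have := avg_bound (e i) x (ltW t0) (TF_meas tdp) hc.
  by rewrite elem_avg.
Qed.

(** The L^1 norm of an increment is at most the step times the L^1 norm of the
    derivative, because the increment is an average of the derivative. *)
Lemma L1_mod i g g' t : wderiv i g g' -> itg mu3 g -> itg mu3 g' ->
  \int[mu3]_(x in setT) `|g (x + t *: e i) - g x| <=
  `|t| * \int[mu3]_(x in setT) `|g' x|.
Proof.
move=> wg gi gi'.
have ii s : itg mu3 (fun x => `|g (x + s *: e i) - g x|).
  by apply: itg_norm; apply: itgB => //; exact: itg_shift.
have pos s : 0 < s -> \int[mu3]_(x in setT) `|g (x + s *: e i) - g x| <=
    s * \int[mu3]_(x in setT) `|g' x|.
  move=> s0; have s0' := ltW s0.
  have ni := itg_norm gi'.
  have ia := avg_itg (e i) s0' gi'; have ian := avg_itg (e i) s0' ni.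
  apply: (@le_trans _ _ (\int[mu3]_(x in setT) (1 * avg (e i) s (fun z => `|g' z|) x))).
    rewrite (@I_ae _ mT R mu3 _ (fun x => `|avg (e i) s g' x|)); last 3 first.
    - exact: itg_meas (ii s).
    - exact: itg_meas (itg_norm ia).
    - by apply: (ae1 (weak_FTC wg gi gi' s0)) => x ->.
    rewrite -subr_ge0 -IB; [|by apply: itg_ext ian => x; rewrite mul1r|exact: itg_norm].
    have mm : M (fun x => 1 * avg (e i) s (fun z => `|g' z|) x - `|avg (e i) s g' x|).
      apply: measurable_funB; last exact: itg_meas (itg_norm ia).
      by apply: measurable_funM => //; exact: itg_meas ian.
    rewrite (@I_ae _ mT R mu3 _ (fun x => `|1 * avg (e i) s (fun z => `|g' z|) x - `|avg (e i) s g' x| |)) //.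
    - exact: I_ge0.
    - by apply: measurableT_comp.
    apply: (ae1 (ae_itg_line (e i) (dual_ok1 gi') s0')) => x ix.
    suff P0 : 0 <= avg (e i) s (fun z => `|g' z|) x - `|avg (e i) s g' x|.
      by rewrite mul1r (ger0_norm P0).
    rewrite subr_ge0.
    apply: (le_trans (I_norm ix)); apply: I_le; first exact: itg_norm.
      by apply: itg_ext (itg_norm ix) => w; rewrite normrM indicE ger0_norm.
    by move=> w; rewrite normrM indicE ger0_norm.
  rewrite (avg_dual (dual_ok1 ni) s0' (itg_meas ian)).
  have B w : 0 <= w <= s -> `|\int[mu3]_(x in setT) (1 * `|g' (x + w *: e i)|) -
      \int[mu3]_(x in setT) `|g' x| | <= 0.
    rewrite -(I_shift (w *: e i) ni) -IB; last 2 first.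
    - by apply: itg_ext (itg_shift (w *: e i) ni) => x; rewrite mul1r.
    - exact: itg_shift ni.
    rewrite (_ : (fun x => _) = fun=> 0); last by apply/funext => x; rewrite mul1r subrr.
    by rewrite /Rintegral integral0 normr0.
  have := I1_bound s0' (kern_section (e i) (dual_ok1 ni) s0') B.
  by rewrite mulr0 normr_le0 subr_eq0 => /eqP ->.
have [t0|t0|->] := ltgtP t 0; last first.
- rewrite normr0 mul0r (_ : (fun x => _) = fun=> 0); first by rewrite /Rintegral integral0.
  by apply/funext => x; rewrite scale0r addr0 subrr normr0.
- by rewrite (gtr0_norm t0); exact: pos.
rewrite (ltr0_norm t0); apply: le_trans (pos (- t) _); last by rewrite oppr_gt0.
rewrite -(I_shift (- t *: e i) (ii t)) le_eqVlt; apply/orP; left; apply/eqP.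
by apply: I_ext => x; rewrite -addrA -scalerDl addNr scale0r addr0 distrC.
Qed.

End weak_product.

Section weak_product2.
Variable R : realType.
Local Notation T := (vec3 R).
Local Notation e := (@std_basis R).
Local Notation mu3 := (leb3 R).
Local Notation mT := (measurableTypeR R * measurableTypeR R * measurableTypeR R)%type.
Local Notation M f := (@measurable_fun _ _ mT R setT f).
Implicit Types (i j : 'I_3) (f g k phi : T -> R) (c s t : R) (y : T).

Definition big k (n : nat) (x : T) : R := if n%:R < `|k x| then `|k x| else 0.

Lemma big_meas k n : M k -> M (big k n).
Proof.
move=> mk; rewrite /big; apply: measurable_fun_ifT => //.
- by apply: measurable_fun_ltr => //; apply: measurableT_comp.
- by apply: measurableT_comp.
Qed.

Lemma big_itg k n : itg mu3 k -> itg mu3 (big k n).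
Proof.
move=> ki; apply: (@itg_dom _ _ R mu3 _ (fun y => `|k y|)).
- exact: big_meas (itg_meas ki).
- exact: itg_norm.
- by move=> x; rewrite /big; case: ifP => _; rewrite ?normr_id ?normr0.
Qed.

Lemma tail_small k eps : itg mu3 k -> 0 < eps ->
  exists n, \int[mu3]_(x in setT) big k n x <= eps.
Proof.
move=> ki e0.
have [] := @I_dct _ mT R mu3 (big k) (fun=> 0) (fun x => `|k x|).
- by move=> n; exact: big_meas (itg_meas ki).
- exact: measurable_cst.
- exact: itg_norm.
- by move=> n x; rewrite /big; case: ifP => _; rewrite ?normr_id ?normr0.
- apply: aeW => x; apply: (@cvg_near_cst _ _ _ (big k ^~ x)).
  exists (Num.truncn `|k x|).+1 => // n /= Hn; rewrite /big ifN// -leNgt.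
  by apply/ltW/(lt_le_trans (truncnS_gt _)); rewrite ler_nat.
move=> _; rewrite {2}/Rintegral integral0 /= => /cvgrPdist_le /(_ _ e0) [n _ Hn].
exists n; have := Hn n (leqnn n); rewrite sub0r normrN; apply: le_trans.
exact: ler_norm.
Qed.

(** Translations of a bounded function [g] are continuous when tested against a
    merely integrable weight [k]. *)
Definition small_mod i k g := forall eps, 0 < eps -> exists2 d, 0 < d &
  forall t, `|t| <= d ->
  \int[mu3]_(x in setT) (`|k x| * `|g (x + t *: e i) - g x|) <= eps.

Lemma itg_mod i k g c t : itg mu3 k -> M g -> (forall x, `|g x| <= c) ->
  itg mu3 (fun x => `|k x| * `|g (x + t *: e i) - g x|).
Proof.
move=> ki mg gc.
apply: (@itg_dom _ _ R mu3 _ (fun y => (c + c) * `|k y|)).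
- apply: measurable_funM.
    by apply: measurableT_comp => //; exact: itg_meas ki.
  by apply: measurableT_comp => //; apply: measurable_funB => //; exact: measurable_comp_shift.
- by apply: itgZ; exact: itg_norm.
- move=> x; rewrite normrM !normr_id mulrC ler_wpM2r//.
  by rewrite (le_trans (ler_normB _ _))// lerD.
Qed.

Lemma small_modP i k g g' c : wderiv i g g' -> itg mu3 g -> itg mu3 g' ->
  (forall x, `|g x| <= c) -> itg mu3 k -> small_mod i k g.
Proof.
move=> wg gi gi' gc ki eps e0.
have c0 : 0 <= c by apply: le_trans (gc (0,0,0)).
have C1 : 0 < c + c + 1 by lra.
have e1 : 0 < eps / 2 / (c + c + 1) by rewrite !divr_gt0.
have [n Hn] := tail_small ki e1.
pose A := \int[mu3]_(x in setT) `|g' x|.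
have A0 : 0 <= A by exact: I_ge0.
have D0 : 0 < n%:R * A + 1 by rewrite ltr_wpDl// mulr_ge0.
exists (eps / 2 / (n%:R * A + 1)); first by rewrite !divr_gt0.
move=> t td.
have i1 := itg_mod i t ki (itg_meas gi) gc.
have i2 : itg mu3 (fun x => `|g (x + t *: e i) - g x|).
  by apply: itg_norm; apply: itgB => //; exact: itg_shift.
have i3 := big_itg n ki.
apply: (@le_trans _ _ (\int[mu3]_(x in setT) (n%:R * `|g (x + t *: e i) - g x| +
   (c + c) * big k n x))).
  apply: I_le => //; first by apply: itgD; exact: itgZ.
  move=> x; rewrite /big; case: ltP => kn.
    apply: ler_wpDl; first by rewrite mulr_ge0.
    by rewrite mulrC ler_wpM2r// (le_trans (ler_normB _ _))// lerD.
  by rewrite mulr0 addr0 ler_wpM2r.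
rewrite ID; [|exact: itgZ|exact: itgZ].
rewrite !IZ//.
(* Where |k| <= n the increment is small in L^1; the rest of k has a small integral. *)
have H1 : n%:R * \int[mu3]_(x in setT) `|g (x + t *: e i) - g x| <= eps / 2.
  have := L1_mod t wg gi gi'; rewrite -/A => /(ler_wpM2l (ler0n R n)) /le_trans; apply.
  apply: (@le_trans _ _ (n%:R * (eps / 2 / (n%:R * A + 1) * A))).
    by rewrite ler_wpM2l// ler_wpM2r.
  set D := n%:R * A + 1 in D0 *.
  have -> : n%:R * (eps / 2 / D * A) = eps / 2 * (n%:R * A / D) by ring.
  apply: ler_piMr; first by rewrite divr_ge0// ltW.
  rewrite ler_pdivrMr// mul1r /D lerDl.
  exact: ler01.
have H2 : (c + c) * \int[mu3]_(x in setT) big k n x <= eps / 2.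
  have cc : 0 <= c + c by lra.
  apply: (le_trans (ler_wpM2l cc Hn)).
  have -> : (c + c) * (eps / 2 / (c + c + 1)) = eps / 2 * ((c + c) / (c + c + 1)) by ring.
  apply: ler_piMr; first by rewrite divr_ge0// ltW.
  rewrite ler_pdivrMr// mul1r lerDl.
  exact: ler01.
by rewrite [leRHS](splitr eps) lerD.
Qed.

(** One of the two terms of the discrete Leibniz rule. The increment of [f] is an
    average of its derivative, and duality moves the translations onto the factor
    [phi * (g + g(. + t))], which converges to [2 phi g]. *)
Lemma half_product i f f' g g' c phi : wderiv i f f' -> itg mu3 f -> itg mu3 f' ->
  wderiv i g g' -> itg mu3 g -> itg mu3 g' -> (forall x, `|g x| <= c) -> TF phi ->
  forall eps, 0 < eps -> exists2 d, 0 < d & forall t, 0 < t <= d ->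
  `|\int[mu3]_(x in setT) (phi x * (g (x + t *: e i) + g x) * (f (x + t *: e i) - f x)) -
    t * \int[mu3]_(x in setT) (2 * (phi x * g x) * f' x)| <= t * eps.
Proof.
move=> wf fi fi' wg gi gi' gc tp eps e0.
have mg := itg_meas gi; have mp := TF_meas tp.
have c0 : 0 <= c by apply: le_trans (gc (0,0,0)).
have [L HL] := TF_lip i tp; have [P HP] := TF_bound tp.
have L0 : 0 <= L.
  by have := HL (0,0,0) 1; rewrite normr1 mul1r; apply: le_trans.
have P0 : 0 <= P by apply: le_trans (HP (0,0,0)).
pose A := \int[mu3]_(x in setT) `|f' x|; have A0 : 0 <= A by exact: I_ge0.
have e1 : 0 < eps / 4 / (P + 1) by rewrite !divr_gt0// ltr_wpDl.
have [d1 d10 Hd1] := small_modP wg gi gi' gc fi' e1.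
have D0 : 0 < 2 * c * L * A + 1 by rewrite ltr_wpDl// !mulr_ge0.
exists (Num.min d1 (eps / 2 / (2 * c * L * A + 1))).
  by rewrite lt_min d10 !divr_gt0.
move=> t /andP[t0]; rewrite le_min => /andP[td1 td2]; have t0' := ltW t0.
pose K x := phi x * (g (x + t *: e i) + g x).
have mK : M K.
  by apply: measurable_funM => //; apply: measurable_funD => //; exact: measurable_comp_shift.
have KB x : `|K x| <= P * (c + c).
  by rewrite normrM ler_pM// (le_trans (ler_normD _ _))// lerD.
have dk : dual_ok K f'.
  by split => //; [exact: itg_meas fi'|left; exists (P * (c + c))].
have ia := avg_itg (e i) t0' fi'.
have [B [_ HB]] := dual_okP dk.
rewrite (@I_ae _ mT R mu3 _ (fun x => K x * avg (e i) t f' x)); last 3 first.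
- apply: measurable_funM => //; apply: measurable_funB; last exact: itg_meas fi.
  exact: measurable_comp_shift (itg_meas fi).
- by apply: measurable_funM => //; exact: itg_meas ia.
- by apply: (ae1 (weak_FTC wf fi fi' t0)) => x ->.
rewrite (avg_dual dk t0' (itg_meas ia)).
apply: I1_bound => //; first exact: kern_section.
move=> s /andP[s0 st].
have [iK _] := HB (e i) s.
rewrite (I_shift_mul iK).
have i1 : itg mu3 (fun y => K (y - s *: e i) * f' y).
  have := itg_shift (- (s *: e i)) iK; apply: itg_ext => x.
  by rewrite subrK.
have i2 : itg mu3 (fun y => 2 * (phi y * g y) * f' y).
  apply: (@itg_dom _ _ R mu3 _ (fun y => (2 * (P * c)) * `|f' y|)).
  - by apply: measurable_funM; [do 2?apply: measurable_funM|exact: itg_meas fi'].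
  - by apply: itgZ; exact: itg_norm.
  - move=> x; rewrite normrM ler_wpM2r// normrM ger0_norm// ler_wpM2l//.
    by rewrite normrM ler_pM.
rewrite -IB//; apply: (le_trans (I_norm (itgB i1 i2))).
have j1 := itg_mod i (t - s) fi' mg gc; have j2 := itg_mod i (- s) fi' mg gc.
have j3 := itg_norm fi'.
apply: (@le_trans _ _ (\int[mu3]_(x in setT) ((2 * c * L * t) * `|f' x| +
  P * (`|f' x| * `|g (x + (t - s) *: e i) - g x| + `|f' x| * `|g (x + (- s) *: e i) - g x|)))).
  apply: I_le.
  - by apply: itg_norm; exact: itgB.
  - by apply: itgD; [exact: itgZ|apply: itgZ; exact: itgD].
  move=> x; rewrite -mulrBl normrM.
  have E1 : x - s *: e i + t *: e i = x + (t - s) *: e i.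
    by rewrite -addrA; congr (_ + _); rewrite addrC -scalerBl.
  have E2 : x - s *: e i = x + (- s) *: e i by rewrite scaleNr.
  rewrite /K E1 E2.
  have hp := HL x (- s); have hP := HP x.
  have hg1 := gc (x + (t - s) *: e i); have hg2 := gc (x + (- s) *: e i).
  move: (g _) (g _) (g x) (phi _) (phi x) (f' x) hp hP hg1 hg2 => g0 g1 gx p1 p0 fx hp hP hg1 hg0.
  have -> : 2 * c * L * t * `|fx| + P * (`|fx| * `|g1 - gx| + `|fx| * `|g0 - gx|) =
     (2 * c * L * t + P * (`|g1 - gx| + `|g0 - gx|)) * `|fx| by ring.
  rewrite ler_wpM2r//.
  have -> : p1 * (g1 + g0) - 2 * (p0 * gx) =
    (p1 - p0) * (g1 + g0) + p0 * ((g1 - gx) + (g0 - gx)) by ring.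
  rewrite (le_trans (ler_normD _ _))// !normrM lerD//.
    have -> : 2 * c * L * t = (t * L) * (c + c) by ring.
    rewrite ler_pM//; last by rewrite (le_trans (ler_normD _ _))// lerD.
    by apply: (le_trans hp); rewrite normrN ger0_norm// ler_wpM2r.
  by rewrite ler_pM// ler_normD.
rewrite ID; [|exact: itgZ|by apply: itgZ; exact: itgD].
rewrite !IZ//; last exact: itgD.
rewrite ID// -/A [leRHS](splitr eps) lerD//.
  set D := 2 * c * L * A + 1 in D0 td2.
  apply: (@le_trans _ _ (2 * c * L * (eps / 2 / D) * A)).
    by rewrite ler_wpM2r// ler_wpM2l// !mulr_ge0.
  have -> : 2 * c * L * (eps / 2 / D) * A = eps / 2 * (2 * c * L * A / D) by ring.
  apply: ler_piMr; first by rewrite divr_ge0// ltW.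
  by rewrite ler_pdivrMr// mul1r /D lerDl ler01.
have m1 := Hd1 (t - s); have m2 := Hd1 (- s).
have {}m1 : \int[mu3]_(x in setT) (`|f' x| * `|g (x + (t - s) *: e i) - g x|) <= eps / 4 / (P + 1).
  by apply: m1; rewrite ger0_norm ?subr_ge0// (le_trans _ td1)// gerBl.
have {}m2 : \int[mu3]_(x in setT) (`|f' x| * `|g (x + (- s) *: e i) - g x|) <= eps / 4 / (P + 1).
  by apply: m2; rewrite normrN ger0_norm// (le_trans st).
apply: (@le_trans _ _ (P * (eps / 4 / (P + 1) + eps / 4 / (P + 1)))).
  by rewrite ler_wpM2l// lerD.
have P1 : 0 < P + 1 by rewrite ltr_wpDl.
have -> : P * (eps / 4 / (P + 1) + eps / 4 / (P + 1)) = eps / 2 * (P / (P + 1)).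
  by field; rewrite gt_eqF.
apply: ler_piMr; first by rewrite divr_ge0// ltW.
by rewrite ler_pdivrMr// mul1r lerDl ler01.
Qed.

End weak_product2.

Section weak_product3.
Variable R : realType.
Local Notation T := (vec3 R).
Local Notation e := (@std_basis R).
Local Notation mu3 := (leb3 R).
Local Notation mT := (measurableTypeR R * measurableTypeR R * measurableTypeR R)%type.
Local Notation M f := (@measurable_fun _ _ mT R setT f).
Implicit Types (i j : 'I_3) (f g h k phi : T -> R) (c s t N : R) (y v : T).

Lemma itg_bmul f g c : M f -> (forall x, `|f x| <= c) -> itg mu3 g ->
  itg mu3 (fun x => f x * g x).
Proof.
move=> mf fc gi; apply: (@itg_dom _ _ R mu3 _ (fun y => c * `|g y|)).
- by apply: measurable_funM => //; exact: itg_meas gi.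
- by apply: itgZ; exact: itg_norm.
- by move=> x; rewrite normrM ler_wpM2r.
Qed.

(** The difference quotient of a test function differs from its derivative by at
    most the step times a Lipschitz constant. *)
Lemma quotient_limit i h phi : itg mu3 h -> TF phi -> exists2 c, 0 <= c &
  forall t, 0 < t ->
  `|\int[mu3]_(x in setT) (h x * (phi x - phi (x + t *: - e i))) -
    t * \int[mu3]_(x in setT) (h x * partial i phi x)| <= t * (c * t).
Proof.
move=> hi tp; have [ap _] := tp; have tdp := TF_partial i tp.
have [L HL] := TF_lip i tdp.
have L0 : 0 <= L.
  by have := HL (0,0,0) 1; rewrite normr1 mul1r; apply: le_trans.
pose A := \int[mu3]_(x in setT) `|h x|; have A0 : 0 <= A by exact: I_ge0.
exists (L * A); first by rewrite mulr_ge0.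
move=> t t0; have t0' := ltW t0.
have dk := dual_ok_TF hi tdp.
have [B [_ HB]] := dual_okP dk.
under I_ext => x do rewrite -(elem_avgN i x ap t0).
rewrite (avg_dual dk t0' (elem_avgN_meas i t0 tp)).
apply: I1_bound => //; first exact: kern_section.
move=> s /andP[s0 st].
have [i1 _] := HB (- e i) s.
have i2 : itg mu3 (fun x => h x * partial i phi x) := Lloc_TF (itg_Lloc hi) tdp.
rewrite -IB//; apply: (le_trans (I_norm (itgB i1 i2))).
have -> : L * A * t = \int[mu3]_(x in setT) ((L * t) * `|h x|).
  by rewrite IZ; [rewrite -/A mulrAC|exact: itg_norm].
apply: I_le; [by apply: itg_norm; exact: itgB|by apply: itgZ; exact: itg_norm|].
move=> x; rewrite -mulrBr normrM mulrC ler_wpM2r//.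
rewrite scalerN -scaleNr; apply: (le_trans (HL x (- s))).
by rewrite normrN ger0_norm// mulrC ler_wpM2l.
Qed.

Lemma product_arith (t eps tX tY tJ1 tJ2 tC I1 I2 Q : R) :
  - (t * (eps / 2)) <= I1 - tJ1 -> I1 - tJ1 <= t * (eps / 2) ->
  - (t * (eps / 2)) <= I2 - tJ2 -> I2 - tJ2 <= t * (eps / 2) ->
  - tC <= Q - tX -> Q - tX <= tC -> tC <= t * (eps / 2) ->
  tJ1 + tJ2 = 2 * tY -> 2 * Q = - (I1 + I2) ->
  - (t * eps) <= tX + tY <= t * eps.
Proof.
have -> : t * (eps / 2) = t * eps / 2 by rewrite mulrA.
move: (t * eps) => te *; apply/andP; split; lra.
Qed.

(** Divide the discrete Leibniz rule for the increments of [f g] by the step and let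
    the step tend to 0. Boundedness of [f] and [g] is what makes the products with
    the integrable derivatives converge. *)
Lemma wderivM_global i f f' g g' c phi : wderiv i f f' -> itg mu3 f -> itg mu3 f' ->
  wderiv i g g' -> itg mu3 g -> itg mu3 g' ->
  (forall x, `|f x| <= c) -> (forall x, `|g x| <= c) -> TF phi ->
  \int[mu3]_(x in setT) (f x * g x * partial i phi x) =
  - \int[mu3]_(x in setT) ((f x * g' x + f' x * g x) * phi x).
Proof.
move=> wf fi fi' wg gi gi' fc gc tp; have [ap _] := tp; have tdp := TF_partial i tp.
have mf := itg_meas fi; have mg := itg_meas gi; have mp := TF_meas tp.
have [P HP] := TF_bound tp.
have ifg : itg mu3 (fun x => f x * g x) by exact: itg_bmul fc gi.
have ifg' : itg mu3 (fun x => f x * g' x) by exact: itg_bmul fc gi'.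
have if'g : itg mu3 (fun x => g x * f' x) by exact: itg_bmul gc fi'.
have [C C0 HC] := quotient_limit i ifg tp.
set X := \int[mu3]_(x in setT) (f x * g x * partial i phi x) in HC *.
set Y := \int[mu3]_(x in setT) ((f x * g' x + f' x * g x) * phi x).
apply/eqP; rewrite -subr_eq0 opprK -normr_le0; apply/ler_addgt0Pr => eps e0.
rewrite add0r.
have e2 : 0 < eps / 2 by rewrite divr_gt0.
have [d1 d10 H1] := half_product wf fi fi' wg gi gi' gc tp e2.
have [d2 d20 H2] := half_product wg gi gi' wf fi fi' fc tp e2.
have D3 : 0 < eps / 2 / (C + 1) by rewrite divr_gt0// ltr_wpDl.
pose t := Num.min (Num.min d1 d2) (eps / 2 / (C + 1)).
have t0 : 0 < t by rewrite !lt_min d10 d20 D3.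
have td1 : 0 < t <= d1 by rewrite t0 !ge_min lexx.
have td2 : 0 < t <= d2 by rewrite t0 !ge_min lexx orbT.
have td3 : t <= eps / 2 / (C + 1) by rewrite ge_min lexx orbT.
have {}H1 := H1 t td1; have {}H2 := H2 t td2; have {}HC := HC t t0.
pose F x := f (x + t *: e i); pose G x := g (x + t *: e i).
have mF : M F by exact: measurable_comp_shift.
have mG : M G by exact: measurable_comp_shift.
have Fc x : `|F x| <= c by exact: fc.
have Gc x : `|G x| <= c by exact: gc.
have Fi : itg mu3 F by exact: itg_shift.
have Gi : itg mu3 G by exact: itg_shift.
have FGi : itg mu3 (fun x => F x * G x) by exact: (itg_shift (t *: e i) ifg).
(* The discrete Leibniz rule 2 (F G - f g) = (G + g) (F - f) + (F + f) (G - g). *)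
have E : 2 * \int[mu3]_(x in setT) (f x * g x * (phi x - phi (x + t *: - e i))) =
  - (\int[mu3]_(x in setT) (phi x * (G x + g x) * (F x - f x)) +
    \int[mu3]_(x in setT) (phi x * (F x + f x) * (G x - g x))).
  have Hb (k1 k2 : T -> R) : M k1 -> itg mu3 k2 -> (forall x, `|k1 x| <= c + c) ->
     itg mu3 (fun x => phi x * k1 x * k2 x).
    move=> m1 i2 b1; apply: (itg_bmul (c := P * (c + c))) => //.
      exact: measurable_funM.
    by move=> x; rewrite normrM ler_pM.
  have b1 : itg mu3 (fun x => phi x * (G x + g x) * (F x - f x)).
    apply: Hb; [exact: measurable_funD|exact: itgB|].
    by move=> x; rewrite (le_trans (ler_normD _ _))// lerD.
  have b2 : itg mu3 (fun x => phi x * (F x + f x) * (G x - g x)).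
    apply: Hb; [exact: measurable_funD|exact: itgB|].
    by move=> x; rewrite (le_trans (ler_normD _ _))// lerD.
  have j1 : itg mu3 (fun x => phi x * (F x * G x)) by exact: itg_bmul HP FGi.
  have j2 : itg mu3 (fun x => phi x * (f x * g x)) by exact: itg_bmul HP ifg.
  have j3 : itg mu3 (fun x => f x * g x * phi (x + t *: - e i)).
    exact: Lloc_TF (itg_Lloc ifg) (TF_shift _ tp).
  have j4 : itg mu3 (fun x => f x * g x * phi x) by apply: itg_ext j2 => x; rewrite mulrC.
  rewrite -ID//.
  rewrite [X in _ = - X](@I_ext _ _ R mu3 _ (fun x => 2 * (phi x * (F x * G x) - phi x * (f x * g x)))); last first.
    move=> x; move: (F x) (G x) (f x) (g x) (phi x) => q1 q2 q3 q4 q5; ring.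
  rewrite IZ; last exact: itgB.
  rewrite -mulrN; congr (2 * _); rewrite IB// opprB.
  under I_ext => x do rewrite mulrBr.
  rewrite IB//; congr (_ - _); first by apply: I_ext => x; rewrite mulrC.
  have := I_shift_mul (v := t *: e i) (f := phi) (g := fun x => f x * g x) j1.
  rewrite /F /G => ->; apply: I_ext => x; rewrite mulrC; congr (phi _ * _).
  by rewrite scalerN.
have EY : \int[mu3]_(x in setT) (2 * (phi x * g x) * f' x) +
   \int[mu3]_(x in setT) (2 * (phi x * f x) * g' x) = 2 * Y.
  have b1 : itg mu3 (fun x => 2 * (phi x * g x) * f' x).
    have := itgZ 2 (itg_bmul mp HP if'g); apply: itg_ext => x; ring.
  have b2 : itg mu3 (fun x => 2 * (phi x * f x) * g' x).
    have := itgZ 2 (itg_bmul mp HP ifg'); apply: itg_ext => x; ring.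
  rewrite -ID// -IZ; first by apply: I_ext => x; ring.
  by have := itgD (itgZ (2^-1) b1) (itgZ (2^-1) b2); apply: itg_ext => x; field.
move: H1 H2 HC E EY; rewrite -/F -/G.
set I1 := \int[mu3]_(x in setT) (phi x * (G x + g x) * (F x - f x)).
set I2 := \int[mu3]_(x in setT) (phi x * (F x + f x) * (G x - g x)).
set J1 := \int[mu3]_(x in setT) (2 * (phi x * g x) * f' x).
set J2 := \int[mu3]_(x in setT) (2 * (phi x * f x) * g' x).
set Q := \int[mu3]_(x in setT) (f x * g x * (phi x - phi (x + t *: - e i))).
move=> H1 H2 HC E EY.
have CT : C * t <= eps / 2.
  have C1 : 0 < C + 1 by rewrite ltr_wpDl.
  move: td3; rewrite ler_pdivlMr// => H; apply: le_trans H.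
  by rewrite mulrDr mulr1 [C * t]mulrC lerDl ltW.
rewrite -(ler_pM2l t0) -[X in X * _](gtr0_norm t0) -normrM.
have CT2 : t * (C * t) <= t * (eps / 2) by rewrite ler_pM2l.
move: H1 H2 HC; rewrite !ler_norml => /andP[H1a H1b] /andP[H2a H2b] /andP[H3a H3b].
have TY : t * J1 + t * J2 = 2 * (t * Y) by rewrite -mulrDr EY mulrCA.
rewrite mulrDr.
exact: (product_arith H1a H1b H2a H2b H3a H3b CT2 TY E).
Qed.

(** A cutoff makes locally controlled functions globally integrable and bounded
    without changing them on a ball. *)
Lemma cut_global i f f' a : wderiv i f f' -> Bloc f ->
  let F y := cut a y * f y in let F' y := cut a y * f' y + partial i (cut a) y * f y in
  [/\ wderiv i F F', itg mu3 F, itg mu3 F' & exists2 c, 0 <= c & forall y, `|F y| <= c].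
Proof.
move=> wf [mf bf] F F'; have tc := TF_cut a; have [ac [N hN]] := tc.
have tpc := TF_partial i tc; have [lf lf' _] := wf.
split.
- exact: wderiv_elemM.
- by apply: itg_ext (Lloc_TF lf tc) => y; rewrite mulrC.
- have := itgD (Lloc_TF lf' tc) (Lloc_TF lf tpc).
  by apply: itg_ext => y; rewrite mulrC [f y * _]mulrC.
have [c hc] := bf N; exists `|c| => // y.
have [By|By] := pselect (box N y); last by rewrite /F hN// mul0r normr0.
rewrite /F normrM -[leRHS]mul1r ler_pM//.
  by rewrite ger0_norm ?zeta_ge0// zeta_le1.
by rewrite (le_trans (hc y By))// ler_norm.
Qed.

(** Only the values on the support of the test function matter, so the global
    statement applies after multiplication by a cutoff. *)
Lemma wderivM i f f' g g' : wderiv i f f' -> wderiv i g g' -> Bloc f -> Bloc g ->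
  wderiv i (fun y => f y * g y) (fun y => f y * g' y + f' y * g y).
Proof.
move=> wf wg bf bg; have [lf lf' _] := wf; have [lg lg' _] := wg.
have l1 := BlocMLloc bf lg; have l2 := BlocMLloc bf lg'.
have l3 : Lloc (fun y => f' y * g y).
  rewrite (_ : (fun y => _) = (fun y => g y * f' y)); first exact: BlocMLloc.
  by apply/funext => y; rewrite mulrC.
split => //; first exact: LlocD.
move=> phi tp; have tdp := TF_partial i tp.
have [_ [N1 h1]] := tp; have [_ [N2 h2]] := tdp.
pose a := 3 * (N1 ^+ 2 + N2 ^+ 2) : R.
have in1 y : phi y != 0 -> nrm2 y <= a.
  move=> py; have [By|By] := pselect (box N1 y); last by rewrite h1// eqxx in py.
  by rewrite (le_trans (nrm2_box By))// ler_wpM2l// lerDl sqr_ge0.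
have in2 y : partial i phi y != 0 -> nrm2 y <= a.
  move=> py; have [By|By] := pselect (box N2 y); last by rewrite h2// eqxx in py.
  by rewrite (le_trans (nrm2_box By))// ler_wpM2l// lerDr sqr_ge0.
have [wF Fi Fi' [c c0 Fc]] := cut_global a wf bf.
have [wG Gi Gi' [d d0 Gd]] := cut_global a wg bg.
have H := @wderivM_global i _ _ _ _ (c + d) phi wF Fi Fi' wG Gi Gi' _ _ tp.
transitivity (\int[mu3]_(x in setT) (cut a x * f x * (cut a x * g x) * partial i phi x)).
  apply: I_ext => x; have [->|/in2 xa] := eqVneq (partial i phi x) 0; first by rewrite !mulr0.
  by rewrite cut_eq1// !mul1r.
rewrite H; last 2 first.
- by move=> x; rewrite (le_trans (Fc x))// lerDl.
- by move=> x; rewrite (le_trans (Gd x))// lerDr.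
congr (- _); apply: I_ext => x; have [->|/in1 xa] := eqVneq (phi x) 0; first by rewrite !mulr0.
by rewrite cut_eq1// partial_cut dzeta_eq0l ?subr_le0// !(mul1r, mul0r, addr0).
Qed.

End weak_product3.

(** * Testing off the axis *)

Section bridge.
Variable R : realType.
Local Notation T := (vec3 R).
Local Notation mu3 := (leb3 R).
Local Notation mT := (measurableTypeR R * measurableTypeR R * measurableTypeR R)%type.
Local Notation M f := (@measurable_fun _ _ mT R setT f).
Implicit Types (i : 'I_3) (f g h phi : T -> R) (t N : R) (y : T).

Lemma rad2_ge0 y : 0 <= rad2 y.
Proof. by rewrite /rad2 -!expr2 addr_ge0 ?sqr_ge0. Qed.

Lemma cyl_rE y : cyl_r y = Num.sqrt (rad2 y).
Proof. by rewrite /cyl_r /rad2 !expr2. Qed.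

Lemma cyl_r2 y : cyl_r y * cyl_r y = rad2 y.
Proof. by rewrite -expr2 cyl_rE sqr_sqrtr// rad2_ge0. Qed.

Lemma cyl_r_gt0 y : (0 < cyl_r y) = (0 < rad2 y).
Proof. by rewrite cyl_rE sqrtr_gt0. Qed.

Lemma cyl_r_ge0 y : 0 <= cyl_r y.
Proof. by rewrite cyl_rE sqrtr_ge0. Qed.

Lemma box_closed N : closed (@box R N).
Proof. by apply: compact_closed; [exact: norm_hausdorff|exact: box_compact]. Qed.

(** Test functions vanishing in a tube around the axis, where the coefficients of
    the cylindrical operators are smooth. *)
Definition TFo phi := TF phi /\ exists2 d, 0 < d & forall y, rad2 y <= d -> phi y = 0.

Lemma TF_test phi : TF phi -> test_function [set: T] phi.
Proof.
move=> [ap [N hN]]; split => //; first exact: elem_smooth.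
apply: (@subclosed_compact _ _ (box N)); [exact: closed_closure|exact: box_compact|].
rewrite [X in _ `<=` X](closure_id (box N)).1; last exact: box_closed.
apply: closureS => y /= py; apply/not_notP => nB.
by rewrite hN ?eqxx in py.
Qed.

Lemma TFo_test phi : TFo phi -> test_function (@off_axis R) phi.
Proof.
move=> [tp [d d0 hd]]; have [h1 h2 _] := TF_test tp; split => //.
pose F : set T := (@rad2 R) @^-1` [set x | d <= x].
have cF : closed F.
  apply: closed_comp; last exact: closed_ge.
  by move=> y _; exact: (elem_continuous (@elem_rad2 R)).
have : closure [set y | phi y != 0] `<=` F.
  rewrite [X in _ `<=` X](closure_id F).1//; apply: closureS => y /= py.
  by rewrite /F /= leNgt; apply/negP => /ltW /hd p0; rewrite p0 eqxx in py.
move=> H y /H; rewrite /F /off_axis /= cyl_r_gt0; exact: lt_le_trans.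
Qed.

Lemma loc_Lloc f : loc_integrable [set: T] f -> Lloc f.
Proof.
move=> [mf lf]; split; first exact: mf.
move=> N; have := lf (box N) (box_compact (N := N)) (fun _ _ => I).
move=> /(integrable_mkcond _ (box_measurable N)).1; rewrite /itg.
rewrite (_ : (EFin \o f) \_ (box N) = EFin \o (fun y => ind N y * f y)) //.
apply/funext => y; rewrite patchE /ind /= indicE; case: ifP => _ /=; first by rewrite mul1r.
by rewrite mul0r.
Qed.

Lemma weak_partial_wderiv i f g : weak_partial i f g -> wderiv i f g.
Proof.
move=> [lf lg H]; split; [exact: loc_Lloc|exact: loc_Lloc|].
move=> phi tp; have := H phi (TF_test tp).
by rewrite /dist_partial /dist_of => <-; rewrite opprK.
Qed.

(** A cutoff that vanishes where r^2 <= 1/(n+1) and equals 1 where r^2 >= 2/(n+1). *)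
Definition theta (n : nat) y : R := 1 + (-1) * zeta (n.+1%:R * rad2 y + (-1)).

Lemma elem_theta n : elem (theta n).
Proof.
apply: elem_add; first exact: elem_cst.
apply: elem_mul; first exact: elem_cst.
apply: elem_zeta; apply: elem_add; last exact: elem_cst.
by apply: elem_mul; [exact: elem_cst|exact: elem_rad2].
Qed.

Lemma theta0 n y : rad2 y <= n.+1%:R^-1 -> theta n y = 0.
Proof.
move=> H; rewrite /theta zeta_eq1 ?mulN1r ?subrr//.
by rewrite subr_le0 -ler_pdivlMl// mulr1.
Qed.

Lemma theta1 n y : 2 * n.+1%:R^-1 <= rad2 y -> theta n y = 1.
Proof.
move=> H; rewrite /theta zeta_eq0 ?mulr0 ?addr0//.
by rewrite lerBrDr -ler_pdivrMl// mulrC.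
Qed.

Lemma theta_ge0 n y : 0 <= theta n y.
Proof. by rewrite /theta mulN1r subr_ge0 zeta_le1. Qed.

Lemma theta_le1 n y : theta n y <= 1.
Proof. by rewrite /theta mulN1r gerBl zeta_ge0. Qed.

Lemma exists_nat_inv (d : R) : 0 < d -> exists n : nat, 2 * n.+1%:R^-1 <= d.
Proof.
move=> d0; exists (Num.truncn (2 / d)); rewrite ler_pdivrMr// mulrC -ler_pdivrMr//.
by apply: ltW; exact: truncnS_gt.
Qed.

Lemma TFo_theta n phi : TF phi -> TFo (fun y => theta n y * phi y).
Proof.
move=> tp; split; first exact: TF_mul (elem_theta n) tp.
by exists n.+1%:R^-1; [rewrite invr_gt0|move=> y /theta0 ->; rewrite mul0r].
Qed.

Lemma TFo_thetaE phi : TFo phi -> exists n, forall y, theta n y * phi y = phi y.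
Proof.
move=> [_ [d d0 hd]]; have [n Hn] := exists_nat_inv d0; exists n => y.
have [H|H] := leP (rad2 y) d; first by rewrite hd// mulr0.
by rewrite theta1 ?mul1r// (le_trans Hn)// ltW.
Qed.

(** Local integrability away from the axis, phrased with the cutoffs [theta]. *)
Definition Loff f := forall n, Lloc (fun y => theta n y * f y).

Lemma Lloc_Loff f : Lloc f -> Loff f.
Proof. by move=> lf n; apply: BlocMLloc => //; exact: elem_Bloc (elem_theta n). Qed.

Lemma LoffD f g : Loff f -> Loff g -> Loff (fun y => f y + g y).
Proof.
move=> lf lg n; have := LlocD (lf n) (lg n).
by rewrite (_ : (fun y => _) = (fun y => theta n y * (f y + g y))) //;
  apply/funext => y; rewrite mulrDr.
Qed.

Lemma BlocMLoff f g : Bloc f -> Loff g -> Loff (fun y => f y * g y).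
Proof.
move=> bf lg n; have := BlocMLloc bf (lg n).
by rewrite (_ : (fun y => _) = (fun y => theta n y * (f y * g y))) //;
  apply/funext => y; rewrite mulrCA.
Qed.

Lemma Loff_TFo f phi : Loff f -> TFo phi -> itg mu3 (fun y => f y * phi y).
Proof.
move=> lf tp; have [n Hn] := TFo_thetaE tp; have [t1 _] := tp.
apply: itg_ext (Lloc_TF (lf n) t1) => y.
by rewrite -[in RHS]Hn [RHS]mulrCA mulrA.
Qed.

Lemma measurable_off : @measurable _ mT (@off_axis R).
Proof.
have -> : @off_axis R = (@rad2 R) @^-1` `]0, +oo[%classic.
  by apply/seteqP; split => y; rewrite /off_axis /= in_itv/= andbT cyl_r_gt0.
rewrite -[X in measurable X]setTI.
by have := elem_measurable (@elem_rad2 R); apply => //; exact: measurable_itv.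
Qed.

Lemma loc_Loff f : loc_integrable (@off_axis R) f -> Loff f.
Proof.
move=> [mf lf] n.
have E : (fun y => theta n y * f y) = (fun y => theta n y * (f \_ (@off_axis R)) y).
  apply/funext => y; rewrite patchE; case: ifPn => // /negP ny.
  have -> : theta n y = 0; last by rewrite !mul0r.
  apply: theta0; rewrite (_ : rad2 y = 0) ?invr_ge0//; apply/eqP.
  rewrite eq_le rad2_ge0 andbT leNgt; apply/negP => H; apply: ny.
  by rewrite inE /off_axis /= cyl_r_gt0.
have mm : M (fun y => theta n y * f y).
  rewrite E; apply: measurable_funM; first exact: elem_measurable (elem_theta n).
  have := (measurable_restrictT f measurable_off).1; apply; exact: mf.
split => // N.
pose K : set T := box N `&` ((@rad2 R) @^-1` [set x | n.+1%:R^-1 <= x]).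
have cK : compact K.
  apply: compact_closedI; first exact: box_compact.
  apply: closed_comp; last exact: closed_ge.
  by move=> y _; exact: (elem_continuous (@elem_rad2 R)).
have mK : @measurable _ mT K.
  apply: measurableI; first exact: box_measurable.
  rewrite -[X in measurable X]setTI.
  have -> : [set x | n.+1%:R^-1 <= x] = `[n.+1%:R^-1, +oo[%classic :> set R.
    by apply/seteqP; split => x /=; rewrite in_itv/= andbT.
  by have := elem_measurable (@elem_rad2 R); apply => //; exact: measurable_itv.
have KW : K `<=` @off_axis R.
  by move=> y [_ /= H]; rewrite /off_axis /= cyl_r_gt0 (lt_le_trans _ H)// invr_gt0.
have iK : itg mu3 (f \_ K).
  have := (integrable_mkcond _ mK).1 (lf K cK KW); rewrite /itg.
  rewrite (_ : (EFin \o f) \_ K = EFin \o (f \_ K)) //.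
  by apply/funext => y; rewrite /= !patchE; case: ifP.
apply: (@itg_dom _ _ R mu3 _ (fun y => `|(f \_ K) y|)).
- by apply: measurable_funM => //; exact: ind_meas.
- exact: itg_norm.
- move=> y; rewrite patchE; case: ifPn => [_|/negP yK].
    rewrite !normrM (ger0_norm (ind_ge0 N y)) (ger0_norm (theta_ge0 n y)) mulrA ler_piMl//.
    by rewrite mulr_ile1 ?ind_ge0 ?theta_ge0 ?ind_le1 ?theta_le1.
  have [By|By] := pselect (box N y); last by rewrite ind0// mul0r normr0.
  rewrite theta0 ?mul0r ?mulr0 ?normr0// leNgt; apply/negP => H; apply: yK.
  by rewrite inE; split => //=; rewrite ltW.
Qed.

Lemma rad2_ae : {ae mu3, forall y, 0 < rad2 y}.
Proof.
have N0 : mu3 ([set 0] `*` setT `*` setT) = 0%E.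
  have m0 : measurable ([set 0] : set (measurableTypeR R)) by exact: measurable_set1.
  have H2 := @product_measure1E _ _ _ _ R (leb1s R) (leb1s R) [set 0] setT m0 measurableT.
  have H3 := @product_measure1E _ _ _ _ R (leb2s R) (leb1s R) ([set 0] `*` setT) setT
    (measurableX m0 measurableT) measurableT.
  apply: etrans H3 _.
  rewrite [X in (X * _)%E](_ : _ = 0%E) ?mul0e//; apply: etrans H2 _.
  by rewrite [X in (X * _)%E](_ : _ = 0%E) ?mul0e//; exact: lebesgue_measure_set1.
exists ([set 0] `*` setT `*` setT); split => //.
  by apply: measurableX => //; apply: measurableX => //; exact: measurable_set1.
move=> y /= H; split => //; split => //=.
apply/eqP; rewrite -sqrf_eq0 eq_le sqr_ge0 andbT.
have : rad2 y <= 0 by rewrite leNgt; apply/negP.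
apply: le_trans; rewrite /rad2 expr2 lerDl -expr2 sqr_ge0//.
Qed.

(** The functions [theta n * h] all vanish, and the axis is a null set. *)
Lemma flcv_off h : Loff h ->
  (forall phi, TFo phi -> \int[mu3]_(y in setT) (h y * phi y) = 0) ->
  {ae mu3, forall y, h y = 0}.
Proof.
move=> lh h0.
have H n : {ae mu3, forall y, theta n y * h y = 0}.
  apply: flcv => // phi tp; rewrite -[RHS](h0 _ (TFo_theta n tp)).
  by apply: I_ext => y; ring.
apply: (ae2 (ae_foralln H) rad2_ae) => y Hy y0.
have [n Hn] := exists_nat_inv y0.
by have := Hy n; rewrite theta1// mul1r.
Qed.

End bridge.

(** * Transport of the vorticity *)

Section core.
Variable R : realType.
Local Notation T := (vec3 R).
Local Notation mu3 := (leb3 R).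
Local Notation mT := (measurableTypeR R * measurableTypeR R * measurableTypeR R)%type.
Local Notation M f := (@measurable_fun _ _ mT R setT f).
Implicit Types (i j : 'I_3) (f g h phi : T -> R) (c t : R) (y v : T).
Local Notation X := (@coord3 R).
Local Notation d_ := (@partial R).

(** The integrated equations all have this form. Keeping integrability together with
    the vanishing of the integral lets them be added without side conditions. *)
Definition nullint f := itg mu3 f /\ \int[mu3]_(y in setT) f y = 0.

Lemma nullintD f g : nullint f -> nullint g -> nullint (fun y => f y + g y).
Proof.
by move=> [fi f0] [gi g0]; split; [exact: itgD|rewrite ID// f0 g0 addr0].
Qed.

Lemma nullintZ c f : nullint f -> nullint (fun y => c * f y).
Proof. by move=> [fi f0]; split; [exact: itgZ|rewrite IZ// f0 mulr0]. Qed.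

Lemma nullint_ext f g : nullint f -> (forall y, f y = g y) -> nullint g.
Proof. by move=> zf /funext <-. Qed.

Lemma nullint_ae f g : nullint f -> M g -> {ae mu3, forall y, f y = g y} -> nullint g.
Proof.
move=> [fi f0] mg fg; split; first exact: itg_ae mg fi fg.
by rewrite -[RHS]f0; apply: I_ae => //; [exact: itg_meas fi|apply: (ae1 fg) => y ->].
Qed.

Lemma nullint_wderiv i f g phi : wderiv i f g -> TF phi -> nullint (fun y => f y * d_ i phi y + g y * phi y).
Proof.
move=> [lf lg H] tp; have tdp := TF_partial i tp; split.
  by apply: itgD; exact: Lloc_TF.
by rewrite ID ?H ?addNr//; exact: Lloc_TF.
Qed.

Variables (u : 'I_3 -> T -> R) (a : 'I_3 -> 'I_3 -> T -> R)
  (b : 'I_3 -> 'I_3 -> 'I_3 -> T -> R) (mu : T -> R) (bt k : R).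
Hypothesis wdu : forall i j, wderiv j (u i) (a i j).
Hypothesis wda : forall i j l, wderiv l (a i j) (b i j l).
Hypothesis Bu : forall i, Bloc (u i).
Hypothesis Ba : forall i j, Bloc (a i j).
Hypothesis Bmu : Bloc mu.
Hypothesis u1E : forall y, u ix1 y = mu y * X ix1 y.
Hypothesis u2E : forall y, u ix2 y = mu y * X ix2 y.
Hypothesis diva : {ae mu3, forall y, a ix1 ix1 y + a ix2 ix2 y + a ix3 ix3 y = 0}.

(** The full transport velocity u + bt y of the self-similar equation: the profile
    plus the scaling field. *)
Definition V i y := u i y + bt * X i y.
(** The momentum equation without its pressure term. *)
Definition accel i y := (k + bt) * u i y +
  (V ix1 y * a i ix1 y + V ix2 y * a i ix2 y + V ix3 y * a i ix3 y).
(** The pair of tests (- y_i d_3 phi for the horizontal components, [chi3 phi] for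
    the vertical one) is divergence free: it is the curl of phi (- y_2, y_1, 0). *)
Definition chi3 phi y := X ix1 y * d_ ix1 phi y + X ix2 y * d_ ix2 phi y + 2 * phi y.
Hypothesis momentum : forall phi, TFo phi ->
  nullint (fun y => (X ix1 y * accel ix1 y + X ix2 y * accel ix2 y) * (- d_ ix3 phi y) +
     accel ix3 y * chi3 phi y).

(** This is r times the angular component of the vorticity, written with Cartesian
    derivatives. For an axisymmetric field without swirl it is the only vorticity
    component. *)
Definition rvort y := X ix1 y * (a ix1 ix3 y - a ix3 ix1 y) +
                    X ix2 y * (a ix2 ix3 y - a ix3 ix2 y).
(** The ratio of the radial transport velocity to r. Its boundedness is what allows
    the singular weight r^-4 below. *)
Definition lam y := mu y + bt.

Lemma V1E y : V ix1 y = lam y * X ix1 y. Proof. by rewrite /V u1E /lam mulrDl. Qed.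
Lemma V2E y : V ix2 y = lam y * X ix2 y. Proof. by rewrite /V u2E /lam mulrDl. Qed.

(** The Bernoulli function |u|^2 / 2 + bt y.u, whose gradient is the part of the
    nonlinearity that the divergence free tests do not see. *)
Definition bern y := 2^-1 * (u ix1 y * u ix1 y + u ix2 y * u ix2 y + u ix3 y * u ix3 y) +
  bt * (X ix1 y * u ix1 y + X ix2 y * u ix2 y + X ix3 y * u ix3 y).
Definition dbern i y := (V ix1 y * a ix1 i y + V ix2 y * a ix2 i y + V ix3 y * a ix3 i y) +
  bt * u i y.

Lemma wderiv_ext i f g f' g' : wderiv i f g -> (forall y, f y = f' y) -> (forall y, g y = g' y) ->
  wderiv i f' g'.
Proof. by move=> H /funext <- /funext <-. Qed.

Lemma wderiv_bern i : wderiv i bern (dbern i).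
Proof.
have vel j := wderivM (wdu j i) (wdu j i) (Bu j) (Bu j).
have xu j := wderiv_elemM (@elem_crd R j) (wdu j i).
have := wderivD (wderivZ (2^-1) (wderivD (wderivD (vel ix1) (vel ix2)) (vel ix3)))
  (wderivZ bt (wderivD (wderivD (xu ix1) (xu ix2)) (xu ix3))).
move=> /wderiv_ext; apply => // y; rewrite !partial_crd /dbern /V.
by case: (ord3P i) => [->|[->|->]] /=; field.
Qed.

Lemma TF_chi3 phi : TF phi -> TF (chi3 phi).
Proof.
move=> tp; apply: TF_add; last exact: TF_mul (elem_cst _) tp.
by apply: TF_add; (apply: TF_mul; [exact: elem_crd|exact: TF_partial]).
Qed.

(** Carrying membership in [elem] along with the derivative lets the rules below
    compose without side conditions. *)
Definition der i f g := elem f /\ partial i f = g.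

Lemma der_partial i f : elem f -> der i f (d_ i f).
Proof. by split. Qed.

Lemma derD i f g f' g' : der i f f' -> der i g g' -> der i (fun y => f y + g y) (fun y => f' y + g' y).
Proof. by move=> [af <-] [ag <-]; split; [exact: elem_add|exact: partialD]. Qed.

Lemma derM i f g f' g' : der i f f' -> der i g g' ->
  der i (fun y => f y * g y) (fun y => f y * g' y + g y * f' y).
Proof. by move=> [af <-] [ag <-]; split; [exact: elem_mul|exact: partialM]. Qed.

Lemma der_crd i j : der i (X j) (fun=> (j == i)%:R).
Proof. by split; [exact: elem_crd|exact: partial_crd]. Qed.

Lemma der_cst i c : der i (fun=> c) (fun=> 0).
Proof. by split; [exact: elem_cst|exact: partial_cst]. Qed.

Lemma partial_chi3 phi i y : elem phi -> d_ i (chi3 phi) y =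
  X ix1 y * d_ i (d_ ix1 phi) y + d_ ix1 phi y * (ix1 == i)%:R +
  (X ix2 y * d_ i (d_ ix2 phi) y + d_ ix2 phi y * (ix2 == i)%:R) + (2 * d_ i phi y + phi y * 0).
Proof.
move=> ap; have ap1 := elem_partial ix1 ap; have ap2 := elem_partial ix2 ap.
have [_ H] := derD (derD (derM (der_crd i ix1) (der_partial i ap1))
  (derM (der_crd i ix2) (der_partial i ap2))) (derM (der_cst i 2) (der_partial i ap)).
exact: (congr1 (fun f => f y) H).
Qed.

Lemma partial_Xmul i j phi y : elem phi -> d_ i (fun z => X j z * phi z) y =
  X j y * d_ i phi y + phi y * (j == i)%:R.
Proof.
move=> ap; have [_ H] := derM (der_crd i j) (der_partial i ap).
exact: (congr1 (fun f => f y) H).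
Qed.

Lemma partialC_pt i j phi y : elem phi -> d_ i (d_ j phi) y = d_ j (d_ i phi) y.
Proof. by move=> ap; have := congr1 (fun f => f y) (partialC i j ap). Qed.

Let grad_arith (g g1 g2 g3 x1 x2 p p1 p2 p3 p31 p13 p32 p23 q1 q2 c c3 : R) :
  p31 = p13 -> p32 = p23 -> q1 = x1 * p13 + p3 * 1 -> q2 = x2 * p23 + p3 * 1 ->
  c3 = x1 * p31 + p1 * 0 + (x2 * p32 + p2 * 0) + (2 * p3 + p * 0) ->
  c = x1 * p1 + x2 * p2 + 2 * p ->
  -1 * (g * q1 + g1 * (x1 * p3)) + -1 * (g * q2 + g2 * (x2 * p3)) + (g * c3 + g3 * c) =
  (x1 * g1 + x2 * g2) * - p3 + g3 * c.
Proof. by move=> -> -> -> -> -> _; ring. Qed.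

(** Gradients vanish against divergence free tests. *)
Lemma nullint_grad phi : TF phi ->
  nullint (fun y => (X ix1 y * dbern ix1 y + X ix2 y * dbern ix2 y) * (- d_ ix3 phi y) +
     dbern ix3 y * chi3 phi y).
Proof.
move=> tp; have [ap _] := tp; have t3 := TF_partial ix3 tp; have [a3 _] := t3.
have z1 := nullint_wderiv (wderiv_bern ix1) (TF_mul (@elem_crd R ix1) t3).
have z2 := nullint_wderiv (wderiv_bern ix2) (TF_mul (@elem_crd R ix2) t3).
have z3 := nullint_wderiv (wderiv_bern ix3) (TF_chi3 tp).
apply: (nullint_ext (nullintD (nullintD (nullintZ (-1) z1) (nullintZ (-1) z2)) z3)) => y.
have E1 := partial_Xmul ix1 ix1 y a3; have E2 := partial_Xmul ix2 ix2 y a3.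
have E3 := partial_chi3 ix3 y ap.
have C1 := partialC_pt ix3 ix1 y ap; have C2 := partialC_pt ix3 ix2 y ap.
have E4 : chi3 phi y = X ix1 y * d_ ix1 phi y + X ix2 y * d_ ix2 phi y + 2 * phi y by [].
exact: (grad_arith _ _ _ _ C1 C2 E1 E2 E3 E4).
Qed.

Let wdB := wderivD (wderiv_elemM (@elem_crd R ix1) (wdu ix1 ix3)) (wderiv_elemM (@elem_crd R ix2) (wdu ix2 ix3)).

Let upart_arith (x1 x2 a13 a23 v1 v2 v3 a31 a32 p p1 p2 p3 q1 q2 : R) :
  q1 = x1 * p1 + p * 1 -> q2 = x2 * p2 + p * 1 ->
  -1 * ((x1 * v1 + x2 * v2) * p3 + (x1 * a13 + 0 * v1 + (x2 * a23 + 0 * v2)) * p) +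
    (v3 * q1 + a31 * (x1 * p) + (v3 * q2 + a32 * (x2 * p))) =
  (x1 * v1 + x2 * v2) * - p3 + v3 * (x1 * p1 + x2 * p2 + 2 * p) -
  (x1 * (a13 - a31) + x2 * (a23 - a32)) * p.
Proof. by move=> -> ->; ring. Qed.

(** Against the same tests the velocity itself leaves only its curl. *)
Lemma nullint_velocity phi : TF phi ->
  nullint (fun y => (X ix1 y * u ix1 y + X ix2 y * u ix2 y) * (- d_ ix3 phi y) +
     u ix3 y * chi3 phi y - rvort y * phi y).
Proof.
move=> tp; have [ap _] := tp.
have z1 := nullint_wderiv wdB tp.
have z2 := nullint_wderiv (wdu ix3 ix1) (TF_mul (@elem_crd R ix1) tp).
have z3 := nullint_wderiv (wdu ix3 ix2) (TF_mul (@elem_crd R ix2) tp).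
apply: (nullint_ext (nullintD (nullintZ (-1) z1) (nullintD z2 z3))) => y.
have E1 := partial_Xmul ix1 ix1 y ap; have E2 := partial_Xmul ix2 ix2 y ap.
rewrite !partial_crd.
exact: (upart_arith _ _ _ _ _ _ _ _ E1 E2).
Qed.

Let E2_arith (x1 x2 v1 v2 v3 l a11 a12 a13 a21 a22 a23 a31 a32 a33 u1 u2 u3 p p1 p2 p3 : R) :
  v1 = l * x1 -> v2 = l * x2 ->
  ((x1 * ((k + bt) * u1 + (v1 * a11 + v2 * a12 + v3 * a13)) +
    x2 * ((k + bt) * u2 + (v1 * a21 + v2 * a22 + v3 * a23))) * (- p3) +
   ((k + bt) * u3 + (v1 * a31 + v2 * a32 + v3 * a33)) * (x1 * p1 + x2 * p2 + 2 * p)) * (-1) +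
  (((x1 * ((v1 * a11 + v2 * a21 + v3 * a31) + bt * u1) +
    x2 * ((v1 * a12 + v2 * a22 + v3 * a32) + bt * u2)) * (- p3) +
   ((v1 * a13 + v2 * a23 + v3 * a33) + bt * u3) * (x1 * p1 + x2 * p2 + 2 * p)) +
  k * ((x1 * u1 + x2 * u2) * (- p3) + u3 * (x1 * p1 + x2 * p2 + 2 * p) -
    (x1 * (a13 - a31) + x2 * (a23 - a32)) * p)) =
  (x1 * (a13 - a31) + x2 * (a23 - a32)) * (v1 * p1 + v2 * p2 + v3 * p3 + (2 * l - k) * p).
Proof. by move=> -> ->; ring. Qed.

(** The momentum equation minus the gradient of the Bernoulli function minus k times
    the velocity equation. Every remaining term contains the vorticity, because y_i
    y_j (a_ij - a_ji) cancels for the horizontal indices. *)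
Lemma nullint_vorticity phi : TFo phi ->
  nullint (fun y => rvort y * (V ix1 y * d_ ix1 phi y + V ix2 y * d_ ix2 phi y + V ix3 y * d_ ix3 phi y
     + (2 * lam y - k) * phi y)).
Proof.
move=> tp; have [t1 _] := tp.
apply: (nullint_ext (nullintD (nullintZ (-1) (momentum tp)) (nullintD (nullint_grad t1) (nullintZ k (nullint_velocity t1))))) => y.
rewrite [-1 * _]mulrC; exact: (E2_arith _ _ _ _ _ _ _ _ _ _ _ _ _ _ _ _ _ (V1E y) (V2E y)).
Qed.

Lemma BlocX i : Bloc (X i). Proof. exact: elem_Bloc (@elem_crd R i). Qed.

Lemma Bloc_V i : Bloc (V i).
Proof. by apply: BlocD => //; apply: BlocM; [exact: Bloc_cst|exact: BlocX]. Qed.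

Lemma Bloc_sub f g : Bloc f -> Bloc g -> Bloc (fun y => f y - g y).
Proof.
move=> bf bg; have := BlocD bf (BlocM (Bloc_cst (-1)) bg).
by congr Bloc; apply/funext => y; rewrite mulN1r.
Qed.

Lemma Bloc_rvort : Bloc rvort.
Proof. by apply: BlocD; apply: BlocM; try exact: BlocX; apply: Bloc_sub. Qed.

Lemma Bloc_lam : Bloc lam.
Proof. by apply: BlocD => //; exact: Bloc_cst. Qed.

Lemma wderiv_rvort i : exists DL, wderiv i rvort DL.
Proof.
have w p q := wderivD (wda p q i) (wderivZ (-1) (wda q p i)).
have H := wderivD (wderiv_elemM (@elem_crd R ix1) (w ix1 ix3)) (wderiv_elemM (@elem_crd R ix2) (w ix2 ix3)).
eexists; apply: (wderiv_ext H) => // y.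
by rewrite /rvort !mulN1r.
Qed.

Lemma wderiv_V i : wderiv i (V i) (fun y => a i i y + bt).
Proof.
have H := wderivD (wdu i i) (wderivZ bt (wderiv_elem i (@elem_crd R i))).
by apply: (wderiv_ext H) => // y; rewrite partial_crd eqxx mulr1.
Qed.

Let transport_arith (l v1 v2 v3 p p1 p2 p3 l1 l2 l3 a1 a2 a3 lm : R) :
  (v1 * l) * p1 + (v1 * l1 + (a1 + bt) * l) * p +
  ((v2 * l) * p2 + (v2 * l2 + (a2 + bt) * l) * p +
  ((v3 * l) * p3 + (v3 * l3 + (a3 + bt) * l) * p)) +
  -1 * (l * (v1 * p1 + v2 * p2 + v3 * p3 + (2 * lm - k) * p)) =
  (v1 * l1 + v2 * l2 + v3 * l3 + (a1 + a2 + a3 + (3 * bt + k + -2 * lm)) * l) * p.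
Proof. by ring. Qed.

(** The vorticity is weakly differentiable, as the profile has a weak Hessian, so
    the Leibniz rule turns the weak transport equation into an identity between
    functions. *)
Lemma vorticity_pointwise DL : (forall i, wderiv i rvort (DL i)) ->
  {ae mu3, forall y, V ix1 y * DL ix1 y + V ix2 y * DL ix2 y + V ix3 y * DL ix3 y =
     (2 * lam y - k - 3 * bt) * rvort y}.
Proof.
move=> wL; have w i := wderivM (wderiv_V i) (wL i) (Bloc_V i) Bloc_rvort.
pose h y := V ix1 y * DL ix1 y + V ix2 y * DL ix2 y + V ix3 y * DL ix3 y +
  (a ix1 ix1 y + a ix2 ix2 y + a ix3 ix3 y + (3 * bt + k + -2 * lam y)) * rvort y.
have : {ae mu3, forall y, h y = 0}.
  apply: flcv_off.
    have lD i : Lloc (fun y => V i y * DL i y).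
      by apply: BlocMLloc; [exact: Bloc_V|have [] := wL i].
    apply: Lloc_Loff; apply: LlocD; first by apply: LlocD => //; apply: LlocD.
    apply: Bloc_Lloc; apply: BlocM; last exact: Bloc_rvort.
    apply: BlocD; first by apply: BlocD => //; apply: BlocD.
    apply: BlocD; first exact: Bloc_cst.
    by apply: BlocM; [exact: Bloc_cst|exact: Bloc_lam].
  move=> phi tp; have [t1 _] := tp.
  have z := nullintD (nullintD (nullint_wderiv (w ix1) t1) (nullintD (nullint_wderiv (w ix2) t1) (nullint_wderiv (w ix3) t1)))
    (nullintZ (-1) (nullint_vorticity tp)).
  rewrite -[RHS](proj2 z); apply: I_ext => y; symmetry; exact: transport_arith.
move=> H; apply: (ae2 H diva) => y hy da; move: hy; rewrite /h da.
rewrite add0r => /eqP; rewrite addr_eq0 => /eqP ->; ring.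
Qed.

Let square_arith (l v1 v2 v3 p p1 p2 p3 l1 l2 l3 a1 a2 a3 lm : R) :
  a1 + a2 + a3 = 0 -> v1 * l1 + v2 * l2 + v3 * l3 = (2 * lm - k - 3 * bt) * l ->
  (v1 * (l * l)) * p1 + (v1 * (l * l1 + l1 * l) + (a1 + bt) * (l * l)) * p +
  ((v2 * (l * l)) * p2 + (v2 * (l * l2 + l2 * l) + (a2 + bt) * (l * l)) * p +
  ((v3 * (l * l)) * p3 + (v3 * (l * l3 + l3 * l) + (a3 + bt) * (l * l)) * p)) =
  (l * l) * (v1 * p1 + v2 * p2 + v3 * p3 + (4 * lm - (2 * k + 3 * bt)) * p).
Proof.
move=> da tr.
have -> : (v1 * (l * l)) * p1 + (v1 * (l * l1 + l1 * l) + (a1 + bt) * (l * l)) * p +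
  ((v2 * (l * l)) * p2 + (v2 * (l * l2 + l2 * l) + (a2 + bt) * (l * l)) * p +
  ((v3 * (l * l)) * p3 + (v3 * (l * l3 + l3 * l) + (a3 + bt) * (l * l)) * p)) =
  (l * l) * (v1 * p1 + v2 * p2 + v3 * p3) + (2 * l * (v1 * l1 + v2 * l2 + v3 * l3) +
   (a1 + a2 + a3 + 3 * bt) * (l * l)) * p by ring.
by rewrite da tr; ring.
Qed.

(** The Leibniz rule for the square and the pointwise equation. Both hold across the
    axis, so the tests need not vanish near it. *)
Lemma nullint_vorticity_sq phi : TF phi ->
  nullint (fun y => (rvort y * rvort y) * (V ix1 y * d_ ix1 phi y + V ix2 y * d_ ix2 phi y +
     V ix3 y * d_ ix3 phi y + (4 * lam y - (2 * k + 3 * bt)) * phi y)).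
Proof.
move=> tp; have [DL wL] := choice wderiv_rvort.
have w2 i := wderivM (wL i) (wL i) Bloc_rvort Bloc_rvort.
have w i := wderivM (wderiv_V i) (w2 i) (Bloc_V i) (BlocM Bloc_rvort Bloc_rvort).
apply: (nullint_ae (nullintD (nullint_wderiv (w ix1) tp) (nullintD (nullint_wderiv (w ix2) tp) (nullint_wderiv (w ix3) tp)))).
  have mV i : M (V i) by have [] := Bloc_V i.
  have mL : M rvort by have [] := Bloc_rvort.
  have ml : M lam by have [] := Bloc_lam.
  have md i : M (d_ i phi) by apply: TF_meas; exact: TF_partial.
  have mp := TF_meas tp.
  have mVd i : M (fun y => V i y * d_ i phi y) by exact: measurable_funM.
  apply: measurable_funM; first exact: measurable_funM.
  apply: measurable_funD; first by apply: measurable_funD => //; apply: measurable_funD.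
  apply: measurable_funM => //; apply: measurable_funB; last exact: measurable_cst.
  by apply: measurable_funM => //; exact: measurable_cst.
apply: (ae2 diva (vorticity_pointwise wL)) => y; exact: square_arith.
Qed.

End core.

(** * Vanishing of the vorticity *)

Section monotone.
Context d (X : measurableType d) (R : realType) (mu : {measure set X -> \bar R}).
Implicit Types f g h : X -> R.

(** Monotone convergence, used to prove integrability of a limit from a uniform
    bound on integrals. *)
Lemma itg_mono (F : nat -> X -> R) f (K : R) : (forall n, itg mu (F n)) ->
  (forall n x, 0 <= F n x) -> (forall n m, (n <= m)%N -> forall x, F n x <= F m x) ->
  (forall n, \int[mu]_(x in setT) F n x <= K) ->
  (forall x, F n x @[n --> \oo] --> f x) -> itg mu f.
Proof.
move=> Fi F0 Fm FK Ff.
have mf : measurable_fun setT f.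
  by apply: measurable_fun_cvg (fun x _ => Ff x) => n; exact: itg_meas.
have f0 x : 0 <= f x.
  by rewrite -(cvg_lim _ (Ff x))//; apply: (@limr_ge _ _ eventually_filter); [exact: cvgP (Ff x)|exact: nearW].
have fE x : (f x)%:E = limn (fun n => (F n x)%:E).
  by apply/esym/cvg_lim => //; apply: cvg_EFin; [exact: nearW|exact: Ff].
apply/integrableP; split; first exact/measurable_EFinP.
apply: (@le_lt_trans _ _ K%:E); last exact: ltry.
rewrite (_ : (\int[mu]_x _ = \int[mu]_x limn (fun n => (F n x)%:E))%E); last first.
  by apply: eq_integral => x _; rewrite -fE /= ger0_norm.
have H1 n : measurable_fun setT (fun x => (F n x)%:E).
  by apply/measurable_EFinP; exact: itg_meas.
have H2 n x : setT x -> (0 <= (F n x)%:E)%E by rewrite lee_fin.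
have H3 x : setT x -> nondecreasing_seq (fun n => (F n x)%:E).
  by move=> _ n m nm; rewrite lee_fin; exact: Fm.
rewrite (@monotone_convergence _ X R mu setT measurableT (fun n x => (F n x)%:E) H1 H2 H3).
apply: lime_le.
  apply: ereal_nondecreasing_is_cvgn => n m nm; apply: ge0_le_integral => //.
  - by move=> x _; rewrite lee_fin.
  - by move=> x _; rewrite lee_fin; exact: Fm.
by apply: nearW => n; rewrite -I_EFin// lee_fin.
Qed.

End monotone.

Section thin.
Variable R : realType.
Local Notation T := (vec3 R).
Local Notation mu1 := (@lebesgue_measure R).
Local Notation mu3 := (leb3 R).
Local Notation mT := (measurableTypeR R * measurableTypeR R * measurableTypeR R)%type.

Lemma mono_zeta (s t : R) : s <= t -> zeta t <= zeta s.
Proof.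
move=> st; rewrite /zeta ler_wpM2l ?invr_ge0 ?flat_ge0//.
by apply: flat0_mono; rewrite lerD2l !mulN1r lerN2; exact: flat0_mono.
Qed.

Lemma mono_theta n m (y : T) : (n <= m)%N -> theta n y <= theta m y.
Proof.
move=> nm; rewrite /theta lerD2l !mulN1r lerN2 mono_zeta// lerD2r.
by rewrite ler_wpM2r ?rad2_ge0// ler_nat.
Qed.

Definition tube (d N : R) : set T := (`[-d, d] `*` `[-d, d]) `*` `[-N, N].

Lemma tube_measurable d N : @measurable _ mT (tube d N).
Proof. by apply: measurableX; [apply: measurableX|]; exact: measurable_itv. Qed.

Lemma tubeE d N : 0 <= d -> 0 <= N -> mu3 (tube d N) = (8 * d * d * N)%:E.
Proof.
move=> d0 N0.
pose J := `[-d, d]%classic : set R; pose K := `[-N, N]%classic : set R.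
have mJ : measurable J by exact: measurable_itv.
have mK : measurable K by exact: measurable_itv.
have len (a : R) : 0 <= a -> mu1 `[-a, a]%classic = (2 * a)%:E.
  move=> a0; rewrite lebesgue_measure_itv/= lte_fin; case: ltP => aa.
    by rewrite -EFinB; congr EFin; ring.
  by congr EFin; lra.
have H2 := @product_measure1E _ _ _ _ R (leb1s R) (leb1s R) J J mJ mJ.
have H3 := @product_measure1E _ _ _ _ R (leb2s R) (leb1s R) (J `*` J) K (measurableX mJ mJ) mK.
apply: etrans H3 _; rewrite (_ : 8 * d * d * N = (2 * d) * (2 * d) * (2 * N)); last by ring.
rewrite !EFinM; congr (_ * _)%E; last exact: len.
by apply: etrans H2 _; congr (_ * _)%E; exact: len.
Qed.

Lemma I_tube d N : 0 <= d -> 0 <= N -> itg mu3 (\1_(tube d N) : T -> R) /\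
  \int[mu3]_(y in setT) (\1_(tube d N) y : R) = 8 * d * d * N.
Proof.
move=> d0 N0; have mt := tube_measurable d N.
have i1 : itg mu3 (\1_(tube d N) : T -> R).
  by apply: itg_indic => //; rewrite [X in (X < _)%E]tubeE// ltry.
split => //; apply: EFin_inj; rewrite I_EFin//.
by rewrite integral_indic// setIT tubeE.
Qed.

End thin.

Section vanish.
Variable R : realType.
Local Notation T := (vec3 R).
Local Notation mu3 := (leb3 R).
Local Notation mT := (measurableTypeR R * measurableTypeR R * measurableTypeR R)%type.
Local Notation M f := (@measurable_fun _ _ mT R setT f).
Implicit Types (i : 'I_3) (f g h phi : T -> R) (c s t N : R) (y v : T) (n : nat).
Local Notation X := (@coord3 R).
Local Notation d_ := (@partial R).

Lemma der_zeta i f f' : der i f f' -> der i (fun y => zeta (f y)) (fun y => dzeta (f y) * f' y).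
Proof. by move=> [af <-]; split; [exact: elem_zeta|exact: partial_zeta]. Qed.

Lemma der_rad2 i : der i (@rad2 R) (fun y => X ix1 y * (ix1 == i)%:R + X ix1 y * (ix1 == i)%:R +
  (X ix2 y * (ix2 == i)%:R + X ix2 y * (ix2 == i)%:R)).
Proof. by apply: derD; apply: derM; exact: der_crd. Qed.

(** A positive smooth function equal to r^2 away from the axis, so that its powers
    are admissible. *)
Definition rreg n y : R := rad2 y + zeta (2 * n.+1%:R * rad2 y + (-1)).

Lemma elem_rreg n : elem (rreg n).
Proof.
apply: elem_add; first exact: elem_rad2.
apply: elem_zeta; apply: elem_add; last exact: elem_cst.
by apply: elem_mul; [exact: elem_cst|exact: elem_rad2].
Qed.

Lemma rreg_gt0 n y : 0 < rreg n y.
Proof.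
have [H|H] := ltP 0 (rad2 y); first by rewrite ltr_pwDl// zeta_ge0.
have E : rad2 y = 0 by apply/eqP; rewrite eq_le H rad2_ge0.
by rewrite /rreg E mulr0 !add0r zeta_eq1// oppr_le0.
Qed.

Lemma rregE n y : n.+1%:R^-1 <= rad2 y -> rreg n y = rad2 y.
Proof.
move=> H; rewrite /rreg zeta_eq0 ?addr0//.
have n0 : 0 < n.+1%:R :> R by [].
have : 1 <= n.+1%:R * rad2 y by rewrite -ler_pdivrMl// mulr1.
by move=> ?; lra.
Qed.

(** The weight r^-4, cut off near the axis. For this power the coefficient 4 lam of
    the squared transport equation cancels exactly, see [wgt_radial]. *)
Definition wgt n y : R :=
  theta n y * ((isq (rreg n y) * isq (rreg n y)) * (isq (rreg n y) * isq (rreg n y))).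

Lemma elem_wgt n : elem (wgt n).
Proof.
have a := elem_isq (elem_rreg n) (@rreg_gt0 n).
by apply: elem_mul; [exact: elem_theta|do 2!apply: elem_mul].
Qed.

Lemma wgtE n y : rad2 y * rad2 y * wgt n y = theta n y.
Proof.
have [H|/ltW H] := leP (rad2 y) n.+1%:R^-1; first by rewrite /wgt theta0// mul0r mulr0.
rewrite /wgt (rregE H).
have s0 : 0 < rad2 y by apply: lt_le_trans H; rewrite invr_gt0.
have := isq_sqr s0; rewrite expr2 => ->; by field; rewrite (gt_eqF s0).
Qed.

Lemma wgt_ge0 n y : 0 <= wgt n y.
Proof. by rewrite /wgt mulr_ge0 ?theta_ge0// -!expr2 sqr_ge0. Qed.

(** The derivative of [theta n] in the direction of the horizontal position vector. *)
Definition rdtheta n y : R := 2 * (- dzeta (n.+1%:R * rad2 y - 1)) * (n.+1%:R * rad2 y).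

Let der_thetaE n i : exists2 f', der i (theta n) f' & forall y, f' y =
   - dzeta (n.+1%:R * rad2 y - 1) * (n.+1%:R * (2 * (X ix1 y * (ix1 == i)%:R + X ix2 y * (ix2 == i)%:R))).
Proof.
have H := derD (der_cst i 1) (derM (der_cst i (-1)) (der_zeta (derD (derM (der_cst i n.+1%:R) (der_rad2 i)) (der_cst i (-1))))).
by eexists; first exact: H; move=> y /=; ring.
Qed.

(** Obtained by differentiating r^4 wgt = theta instead of the definition. *)
Lemma wgt_eq n i y :
  rad2 y * rad2 y * d_ i (wgt n) y + 4 * (rad2 y * wgt n y) * (X ix1 y * (ix1 == i)%:R + X ix2 y * (ix2 == i)%:R) =
   - dzeta (n.+1%:R * rad2 y - 1) * (n.+1%:R * (2 * (X ix1 y * (ix1 == i)%:R + X ix2 y * (ix2 == i)%:R))).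
Proof.
have [t' [_ tE] <-] := der_thetaE n i; rewrite -{}tE.
have [_ H] := derM (derM (der_rad2 i) (der_rad2 i)) (der_partial i (elem_wgt n)).
have E : (fun z => rad2 z * rad2 z * wgt n z) = theta n by apply/funext => z; exact: wgtE.
have := congr1 (fun f => d_ i f y) E; rewrite /= => <-.
have := congr1 (fun f => f y) H; rewrite /= => ->.
by ring.
Qed.

Let radial_arith (s x1 x2 N z h h1 h2 : R) : s = x1 * x1 + x2 * x2 ->
  s * s * h1 + 4 * (s * h) * (x1 * 1 + x2 * 0) = - z * (N * (2 * (x1 * 1 + x2 * 0))) ->
  s * s * h2 + 4 * (s * h) * (x1 * 0 + x2 * 1) = - z * (N * (2 * (x1 * 0 + x2 * 1))) ->
  s * s * (x1 * h1 + x2 * h2) = 2 * - z * (N * s) - 4 * (s * s * h).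
Proof.
move=> sE E1 E2.
have -> : s * s * (x1 * h1 + x2 * h2) =
  x1 * (s * s * h1 + 4 * (s * h) * (x1 * 1 + x2 * 0)) +
  x2 * (s * s * h2 + 4 * (s * h) * (x1 * 0 + x2 * 1)) - 4 * (s * h) * (x1 * x1 + x2 * x2) by ring.
by rewrite E1 E2 -sE sE; ring.
Qed.

(** The homogeneity of degree -4 of the weight, up to the derivative of the cutoff. *)
Lemma wgt_radial n y : rad2 y * rad2 y * (X ix1 y * d_ ix1 (wgt n) y + X ix2 y * d_ ix2 (wgt n) y) =
  rdtheta n y - 4 * theta n y.
Proof.
rewrite -wgtE.
exact: (radial_arith (erefl _) (wgt_eq n ix1 y) (wgt_eq n ix2 y)).
Qed.

Lemma wgt_axial n y : rad2 y * rad2 y * d_ ix3 (wgt n) y = 0.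
Proof. by have := wgt_eq n ix3 y; rewrite /= !(mulr0, addr0) => ->. Qed.

Lemma rdtheta_ge0 n y : 0 <= rdtheta n y.
Proof.
by rewrite /rdtheta !mulr_ge0 ?rad2_ge0// oppr_ge0 dzeta_le0.
Qed.

Lemma rdtheta_le n y : rdtheta n y <= 4 * czeta R.
Proof.
rewrite /rdtheta; set N := _ * rad2 y.
have [z0|z0] := leP 1 (N - 1).
  by rewrite dzeta_eq0r// oppr0 mulr0 mul0r mulr_ge0// ltW// czeta_gt0.
have N2 : N <= 2 by lra.
have -> : 4 * czeta R = 2 * czeta R * 2 by ring.
have N0 : 0 <= N by rewrite mulr_ge0// rad2_ge0.
apply: ler_pM => //; last by rewrite ler_pM2l// dzeta_bound.
by rewrite mulr_ge0// oppr_ge0 dzeta_le0.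
Qed.

Lemma rdtheta_out n y : 2 * n.+1%:R^-1 <= rad2 y -> rdtheta n y = 0.
Proof.
move=> H; rewrite /rdtheta dzeta_eq0r ?oppr0 ?mulr0 ?mul0r//.
by rewrite lerBrDr -ler_pdivrMl// mulrC.
Qed.

Lemma rdtheta_in n y : rad2 y <= n.+1%:R^-1 -> rdtheta n y = 0.
Proof.
move=> H; rewrite /rdtheta dzeta_eq0l ?oppr0 ?mulr0 ?mul0r//.
by rewrite subr_le0 -ler_pdivlMl// mulr1.
Qed.

Variables (rvort lam : T -> R) (V : 'I_3 -> T -> R) (C Lb kap A0 : R).
Hypothesis mrvort : M rvort.
Hypothesis mlam : M lam.
Hypothesis rvortB : forall y, rvort y * rvort y <= C * rad2 y.
Hypothesis lamB : forall y, `|lam y| <= Lb.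
Hypothesis V1E : forall y, V ix1 y = lam y * X ix1 y.
Hypothesis V2E : forall y, V ix2 y = lam y * X ix2 y.
Hypothesis outward : forall y, A0 <= nrm2 y ->
  0 <= V ix1 y * X ix1 y + V ix2 y * X ix2 y + V ix3 y * X ix3 y.
Hypothesis kap0 : 0 < kap.
Hypothesis transport_sq : forall phi, TF phi ->
  nullint (fun y => (rvort y * rvort y) * (V ix1 y * d_ ix1 phi y + V ix2 y * d_ ix2 phi y +
     V ix3 y * d_ ix3 phi y + (4 * lam y - kap) * phi y)).

(** The square of the quotient of the vorticity by r, times a spatial cutoff.
    Division by zero gives 0 on the axis, where [rvort] vanishes as well. *)
Definition W A y : R := rvort y * rvort y * cut A y / (rad2 y * rad2 y).

Lemma rvort2_ge0 y : 0 <= rvort y * rvort y.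
Proof. by rewrite -expr2 sqr_ge0. Qed.

Lemma cut_ge0 A y : 0 <= cut A y. Proof. exact: zeta_ge0. Qed.
Lemma cut_le1 A y : cut A y <= 1. Proof. exact: zeta_le1. Qed.

Lemma W_ge0 A y : 0 <= W A y.
Proof. by apply: divr_ge0; apply: mulr_ge0; rewrite ?rad2_ge0 ?cut_ge0 ?rvort2_ge0. Qed.

Lemma rvort20 y : rad2 y = 0 -> rvort y * rvort y = 0.
Proof. by move=> E; apply/eqP; rewrite eq_le rvort2_ge0 andbT; have := rvortB y; rewrite E mulr0. Qed.

Lemma DW_ge0 A n y : 0 <= rdtheta n y * W A y.
Proof. exact: mulr_ge0 (rdtheta_ge0 n y) (W_ge0 A y). Qed.

Lemma thetaW A n y : theta n y * W A y = rvort y * rvort y * (wgt n y * cut A y).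
Proof.
have [s0|s0] := eqVneq (rad2 y) 0; first by rewrite /W (rvort20 s0) !mul0r mulr0.
by rewrite /W -(wgtE n y); field.
Qed.

Lemma rvort_itg phi : TF phi -> itg mu3 (fun y => rvort y * rvort y * phi y).
Proof.
move=> tp; apply: Lloc_TF => //; apply: Bloc_Lloc; split; first exact: measurable_funM.
have [_ br] := elem_Bloc (@elem_rad2 R).
move=> N; have [c hc] := br N; exists (`|C| * c) => y By.
rewrite ger0_norm ?rvort2_ge0// (le_trans (rvortB y))// (le_trans (ler_norm _))//.
by rewrite normrM ler_wpM2l// hc.
Qed.

Lemma TF_wcut n A : TF (fun y => wgt n y * cut A y).
Proof. by apply: TF_mul (TF_cut A); exact: elem_wgt. Qed.

Lemma thetaW_itg A n : itg mu3 (fun y => theta n y * W A y).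
Proof. by apply: itg_ext (rvort_itg (TF_wcut n A)) => y; rewrite thetaW. Qed.

Lemma theta_cvg y : 0 < rad2 y -> theta n y @[n --> \oo] --> (1 : R).
Proof.
move=> y0; have [N HN] := exists_nat_inv y0.
have := @cvg_near_cst nat R (1 : R) (fun n => theta n y) _ eventually_filter; apply; exists N => // n /= Nn.
apply: theta1; apply: le_trans HN; rewrite ler_pM2l// lef_pV2 ?posrE//.
by rewrite ler_nat.
Qed.

Lemma thetaW_cvg A y : theta n y * W A y @[n --> \oo] --> W A y.
Proof.
have [s0|s0] := eqVneq (rad2 y) 0.
  have W0 : W A y = 0 by rewrite /W (rvort20 s0) !mul0r.
  by rewrite W0; under eq_fun do rewrite mulr0; exact: cvg_cst.
have y0 : 0 < rad2 y by rewrite lt_def s0 rad2_ge0.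
rewrite -[X in _ --> X]mul1r; apply: cvgM; [exact: theta_cvg|exact: cvg_cst].
Qed.

Lemma W_meas A : M (W A).
Proof.
apply: (@measurable_fun_cvg _ mT R setT (fun n y => theta n y * W A y) (W A)) => [n|y _]; last exact: thetaW_cvg.
exact: itg_meas (thetaW_itg A n).
Qed.

Lemma rdtheta_meas n : M (rdtheta n).
Proof.
have mr := elem_measurable (@elem_rad2 R).
have [ag aE] : exists2 g, elem g & rdtheta n = g.
  pose f y : R := n.+1%:R * rad2 y + (-1).
  have af : elem f.
    by apply: elem_add; [apply: elem_mul; [exact: elem_cst|exact: elem_rad2]|exact: elem_cst].
  exists (rdtheta n) => //; rewrite /rdtheta /dzeta.
  apply: elem_mul; last by apply: elem_mul; [exact: elem_cst|exact: elem_rad2].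
  apply: elem_mul; first exact: elem_cst.
  rewrite (_ : (fun y => _) = (fun y => (flat 0 (flat1 R))^-1 *
    (flat 2 (flat1 R + (-1) * flat 0 (f y)) * flat 2 (f y)))); last first.
    by apply/funext => y; rewrite opprK.
  apply: elem_mul; first exact: elem_cst.
  apply: elem_mul; last exact: elem_flat.
  apply: elem_flat; apply: elem_add; first exact: elem_cst.
  by apply: elem_mul; [exact: elem_cst|exact: elem_flat].
by move=> ->; exact: elem_measurable.
Qed.

Lemma WD_le A n y : rdtheta n y * W A y <= 4 * czeta R * W A y.
Proof. by rewrite ler_wpM2r ?W_ge0// rdtheta_le. Qed.

Let C0 : 0 <= C.
Proof.
have := rvortB (1, 0, 0); rewrite /rad2 /coord3 /= !(mulr0, addr0, mulr1).
by apply: le_trans; exact: rvort2_ge0.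
Qed.

Let box_cut A y : 0 <= A -> cut A y != 0 -> nrm2 y <= A + 1.
Proof.
move=> A0' H; rewrite leNgt; apply/negP => H1; move: H; rewrite /cut zeta_eq0 ?eqxx//.
by rewrite lerBrDr addrC ltW.
Qed.

(** The derivative of [theta n] lives in a tube of radius O(n^(-1/2)), where [W] is
    O(n) because [rvort]^2 is O(r^2). Since the tube has area O(1/n) the integral
    stays bounded. *)
Lemma WD_tube A n y : 0 <= A ->
  rdtheta n y * W A y <= 4 * czeta R * (C * n.+1%:R) * \1_(tube (Num.sqrt (2 * n.+1%:R^-1)) (A + 1)) y.
Proof.
move=> A_ge0.
have n0 : 0 < n.+1%:R :> R by [].
have R0 : 0 <= 4 * czeta R * (C * n.+1%:R) * (\1_(tube (Num.sqrt (2 * n.+1%:R^-1)) (A + 1)) y : R).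
  by have cz := ltW (czeta_gt0 R); rewrite indicE; apply: mulr_ge0; rewrite ?ler0n// mulr_ge0 ?(mulr_ge0 _ cz)// mulr_ge0.
have [H|H] := leP (2 * n.+1%:R^-1) (rad2 y); first by rewrite rdtheta_out// mul0r.
have [K|K] := leP (rad2 y) n.+1%:R^-1; first by rewrite rdtheta_in// mul0r.
have [c0|c0] := eqVneq (cut A y) 0; first by rewrite /W c0 mulr0 mul0r mulr0.
have tb : tube (Num.sqrt (2 * n.+1%:R^-1)) (A + 1) y.
  have sq x : x * x <= 2 * n.+1%:R^-1 -> `|x| <= Num.sqrt (2 * n.+1%:R^-1).
    move=> xs; rewrite -(@ger0_norm _ (Num.sqrt _)) ?sqrtr_ge0//.
    by rewrite -ler_sqr ?nnegrE// !real_normK ?num_real// sqr_sqrtr ?expr2// mulr_ge0.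
  have c1 : `|y.1.1| <= Num.sqrt (2 * n.+1%:R^-1).
    apply: sq; apply: le_trans (ltW H); rewrite /rad2 lerDl -expr2 sqr_ge0//.
  have c2 : `|y.1.2| <= Num.sqrt (2 * n.+1%:R^-1).
    apply: sq; apply: le_trans (ltW H); rewrite /rad2 lerDr -expr2 sqr_ge0//.
  have c3 : `|y.2| <= A + 1.
    have : box (A + 1) y.
      apply: box_nrm2; first by rewrite addr_ge0.
      by rewrite (le_trans (box_cut A_ge0 c0))// expr2 ler_peMl ?addr_ge0// lerDr.
    by move=> /boxP /(_ ix3).
  by rewrite /tube /= !in_itv/= -!ler_norml.
rewrite indicE mem_set// mulr1; apply: ler_pM; [exact: rdtheta_ge0|exact: W_ge0|exact: rdtheta_le|].
have s0 : 0 < rad2 y by apply: lt_trans K; rewrite invr_gt0.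
apply: (@le_trans _ _ (C * rad2 y * 1 / (rad2 y * rad2 y))).
  rewrite /W ler_wpM2r ?invr_ge0 ?mulr_ge0 ?rad2_ge0//.
  by apply: ler_pM; rewrite ?rvort2_ge0 ?cut_ge0 ?cut_le1.
have -> : C * rad2 y * 1 / (rad2 y * rad2 y) = C * (rad2 y)^-1 by field; rewrite gt_eqF.
by rewrite ler_wpM2l// -[leRHS]invrK lef_pV2 ?posrE ?invr_gt0// ltW.
Qed.

Lemma WD_itg A n : 0 <= A -> itg mu3 (fun y => rdtheta n y * W A y) /\
  \int[mu3]_(y in setT) (rdtheta n y * W A y) <= 64 * czeta R * C * (A + 1).
Proof.
move=> A_ge0; have A1 : 0 <= A + 1 by rewrite addr_ge0.
have n0 : 0 < n.+1%:R :> R by [].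
have [ti tI] := I_tube (sqrtr_ge0 (2 * n.+1%:R^-1)) A1.
have tZ := itgZ (4 * czeta R * (C * n.+1%:R)) ti.
have Wi : itg mu3 (fun y => rdtheta n y * W A y).
  apply: itg_dom tZ _; first by apply: measurable_funM; [exact: rdtheta_meas|exact: W_meas].
  by move=> y; rewrite ger0_norm ?DW_ge0//; exact: (WD_tube n y A_ge0).
split => //.
apply: (le_trans (I_le Wi tZ (fun y => WD_tube n y A_ge0))).
rewrite IZ// tI -(mulrA 8) -expr2 sqr_sqrtr ?mulr_ge0//.
by rewrite le_eqVlt; apply/orP; left; apply/eqP; field; rewrite gt_eqF.
Qed.

Let key_arith (L2 h ch v1 v2 v3 l c1 c2 c3 h1 h2 h3 x1 x2 s D th : R) :
  v1 = l * x1 -> v2 = l * x2 -> s * s * (x1 * h1 + x2 * h2) = D - 4 * th ->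
  s * s * h3 = 0 -> s * s * h = th -> s != 0 ->
  L2 * (v1 * (h * c1 + ch * h1) + v2 * (h * c2 + ch * h2) + v3 * (h * c3 + ch * h3) +
   (4 * l - kap) * (h * ch)) =
  L2 * h * (v1 * c1 + v2 * c2 + v3 * c3) + l * (D * (L2 * ch / (s * s))) -
   kap * (th * (L2 * ch / (s * s))).
Proof.
move=> -> -> E1 E2 E3 s0.
have -> : h3 = 0.
  by apply/eqP; move/eqP: E2; rewrite mulf_eq0 mulf_eq0 (negbTE s0).
have E4 : D = s * s * (x1 * h1 + x2 * h2) + 4 * th by rewrite E1; ring.
by rewrite E4 -E3; field.
Qed.

(** Where the cutoff is not constant the field points outwards, while the cutoff
    decreases outwards. *)
Lemma transport_cut A y : A0 <= A ->
  V ix1 y * d_ ix1 (cut A) y + V ix2 y * d_ ix2 (cut A) y + V ix3 y * d_ ix3 (cut A) y <= 0.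
Proof.
move=> A0A; rewrite !partial_cut.
have -> : V ix1 y * (dzeta (nrm2 y - A) * (2 * X ix1 y)) +
  V ix2 y * (dzeta (nrm2 y - A) * (2 * X ix2 y)) + V ix3 y * (dzeta (nrm2 y - A) * (2 * X ix3 y)) =
  dzeta (nrm2 y - A) * 2 * (V ix1 y * X ix1 y + V ix2 y * X ix2 y + V ix3 y * X ix3 y).
  by ring.
have [H|H] := leP (nrm2 y) A; first by rewrite dzeta_eq0l ?mul0r// subr_le0.
rewrite mulr_le0_ge0//; first by rewrite mulr_le0_ge0// dzeta_le0.
by apply: outward; rewrite (le_trans A0A)// ltW.
Qed.

(** The squared transport equation tested with the cutoff weight. The term with the
    spatial cutoff has a sign and is dropped. *)
Lemma thetaW_le A n : 0 <= A -> A0 <= A ->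
  kap * \int[mu3]_(y in setT) (theta n y * W A y) <=
  Lb * \int[mu3]_(y in setT) (rdtheta n y * W A y).
Proof.
move=> A_ge0 A0A; have [Di _] := WD_itg n A_ge0; have Ti := thetaW_itg A n.
have [zi z0] := transport_sq (TF_wcut n A).
rewrite -IZ// -IZ//.
rewrite -[leRHS]addr0 -[X in _ + X]oppr0 -{}z0 -IB//; last exact: itgZ.
apply: I_le; [exact: itgZ|by apply: itgB => //; exact: itgZ|].
move=> y; have [s0|s0] := eqVneq (rad2 y) 0.
  by rewrite /W (rvort20 s0) !mul0r !mulr0 subr0.
have [aw [ac _]] := (elem_wgt n, TF_cut A).
have dM i := congr1 (fun f => f y) (proj2 (derM (der_partial i aw) (der_partial i ac))).
rewrite /= in dM; rewrite !{}dM.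
rewrite (key_arith (rvort y * rvort y) (cut A y) (V ix3 y) (d_ ix1 (cut A) y) (d_ ix2 (cut A) y) (d_ ix3 (cut A) y)
  (V1E y) (V2E y) (wgt_radial n y) (wgt_axial n y) (wgtE n y) s0) -/(W A y).
have H1 : rvort y * rvort y * wgt n y * (V ix1 y * d_ ix1 (cut A) y + V ix2 y * d_ ix2 (cut A) y +
  V ix3 y * d_ ix3 (cut A) y) <= 0.
  by rewrite mulr_ge0_le0 ?transport_cut// mulr_ge0 ?wgt_ge0 ?rvort2_ge0.
have H2 : lam y * (rdtheta n y * W A y) <= Lb * (rdtheta n y * W A y).
  by rewrite ler_wpM2r ?DW_ge0// (le_trans (ler_norm _)).
by move: H1 H2; move: (_ * wgt n y * _) (lam y * _) (Lb * _) (kap * _) => *; lra.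
Qed.

Lemma W_itg A : 0 <= A -> A0 <= A -> itg mu3 (W A).
Proof.
move=> A_ge0 A0A.
have L0 : 0 <= Lb by apply: le_trans (lamB (0, 0, 0)).
apply: (@itg_mono _ _ _ mu3 (fun n y => theta n y * W A y) _ (kap^-1 * (Lb * (64 * czeta R * C * (A + 1))))).
- by move=> n; exact: thetaW_itg.
- by move=> n y; rewrite mulr_ge0 ?theta_ge0 ?W_ge0.
- by move=> n m nm y; exact: ler_wpM2r (W_ge0 A y) _ _ (mono_theta y nm).
- move=> n; rewrite -ler_pdivrMl ?invr_gt0// invrK.
  apply: (le_trans (thetaW_le n A_ge0 A0A)); rewrite ler_wpM2l//.
  by have [] := WD_itg n A_ge0.
- exact: thetaW_cvg.
Qed.

(** The bound of [thetaW_le] first makes [W] integrable; then its right-hand side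
    tends to 0 by dominated convergence, because the tubes shrink to the axis. *)
Lemma W_eq0 A : 0 <= A -> A0 <= A -> {ae mu3, forall y, W A y = 0}.
Proof.
move=> A_ge0 A0A; have Wi := W_itg A_ge0 A0A.
apply: I_eq0 => //; first exact: W_ge0.
have [_ c1] : itg mu3 (W A) /\ \int[mu3]_(y in setT) (theta n y * W A y) @[n --> \oo] --> (\int[mu3]_(y in setT) W A y : R).
  apply: (@I_dct _ mT R mu3 (fun n y => theta n y * W A y) (W A) (W A)) => //.
  - by move=> n; exact: itg_meas (thetaW_itg A n).
  - exact: W_meas.
  - move=> n y; rewrite normrM (ger0_norm (theta_ge0 n y)) (ger0_norm (W_ge0 A y)).
    exact: ler_piMl (W_ge0 A y) (theta_le1 n y).
  - by apply: aeW => y; exact: thetaW_cvg.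
have [_ c2] : itg mu3 (fun=> 0 : R) /\ \int[mu3]_(y in setT) (rdtheta n y * W A y) @[n --> \oo] --> (\int[mu3]_(y in (setT : set T)) (0 : R) : R).
  apply: (@I_dct _ mT R mu3 (fun n y => rdtheta n y * W A y) (fun=> 0) (fun y => 4 * czeta R * W A y)).
  - by move=> n; apply: measurable_funM; [exact: rdtheta_meas|exact: W_meas].
  - exact: measurable_cst.
  - exact: itgZ.
  - by move=> n y; rewrite ger0_norm ?DW_ge0//; exact: WD_le.
  - apply: (ae1 (rad2_ae R)) => y y0; have [N HN] := exists_nat_inv y0.
    have := @cvg_near_cst nat R (0 : R) (fun n => rdtheta n y * W A y) _ eventually_filter; apply; exists N => // n /= Nn.
    rewrite rdtheta_out ?mul0r//; apply: le_trans HN; rewrite ler_pM2l// lef_pV2 ?posrE//.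
    by rewrite ler_nat.
rewrite (_ : \int[mu3]_(y in setT) 0 = 0) in c2; last first.
  by rewrite /Rintegral integral0.
rewrite -(pmulr_rle0 _ kap0).
have c3 := cvgM (cvg_cst kap) c1; have c4 := cvgM (cvg_cst Lb) c2.
rewrite mulr0 in c4.
have K := @ler_cvg_to nat \oo _ R _ _ _ _ (c3 _ _) (c4 _ _); apply: K; apply: nearW => n; exact: thetaW_le.
Qed.

Lemma rvort_eq0 : {ae mu3, forall y, rvort y = 0}.
Proof.
have H n : {ae mu3, forall y, W (n%:R + `|A0|) y = 0}.
  by apply: W_eq0; [rewrite addr_ge0|rewrite (le_trans (ler_norm _))// lerDr].
apply: (ae2 (ae_foralln H) (rad2_ae R)) => y Hy y0.
have := Hy (Num.truncn (nrm2 y)).+1; rewrite /W cut_eq1; last first.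
  by rewrite (@le_trans _ _ (Num.truncn (nrm2 y)).+1%:R) ?lerDl// ltW// truncnS_gt.
move/eqP; rewrite mulr1 !mulf_eq0 invr_eq0 mulf_eq0 !orbb (gt_eqF y0) orbF.
by move/eqP.
Qed.

End vanish.

(** * A Pohozaev identity *)

Section pohozaev.
Variable R : realType.
Local Notation T := (vec3 R).
Local Notation mu3 := (leb3 R).
Local Notation mT := (measurableTypeR R * measurableTypeR R * measurableTypeR R)%type.
Local Notation M f := (@measurable_fun _ _ mT R setT f).
Implicit Types (i j : 'I_3) (f g h phi : T -> R) (c s : R) (y : T) (n : nat).
Local Notation X := (@coord3 R).
Local Notation d_ := (@partial R).

(** With this factor the Pohozaev identity controls |u|^2 (1 + |y|^2)^(-3/2), with a
    favourable sign for the remaining terms. *)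
Definition decay y : R := isq (1 + nrm2 y).
Definition cutr r y : R := zeta ((r * r)^-1 * nrm2 y + (-1)).

Lemma nrm2_ge0 y : 0 <= nrm2 y.
Proof. by rewrite /nrm2 addr_ge0 ?rad2_ge0// -expr2 sqr_ge0. Qed.

Lemma nrm2p_gt0 y : 0 < 1 + nrm2 y.
Proof. by rewrite ltr_pwDl// nrm2_ge0. Qed.

Lemma decay_gt0 y : 0 < decay y. Proof. exact: isq_gt0. Qed.

Lemma decayE y : decay y * decay y * (1 + nrm2 y) = 1.
Proof.
have := isq_sqr (nrm2p_gt0 y); rewrite expr2 /decay => ->.
by rewrite mulVf// gt_eqF// nrm2p_gt0.
Qed.

Lemma elem_1nrm2 : elem (fun y : T => 1 + nrm2 y).
Proof. by apply: elem_add; [exact: elem_cst|exact: elem_nrm2]. Qed.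

Lemma elem_decay : elem decay.
Proof. by apply: elem_isq; [exact: elem_1nrm2|exact: nrm2p_gt0]. Qed.

Lemma TF_cutr r : 0 < r -> TF (cutr r).
Proof.
move=> r0; split.
  apply: elem_zeta; apply: elem_add; last exact: elem_cst.
  by apply: elem_mul; [exact: elem_cst|exact: elem_nrm2].
exists (2 * r) => y nB; apply: zeta_eq0; rewrite lerBrDr.
rewrite leNgt; apply/negP => H; apply: nB; apply: box_nrm2; first by rewrite mulr_ge0// ltW.
move: H; rewrite mulrC ltr_pdivrMr ?mulr_gt0// => /ltW /le_trans; apply.
by rewrite expr2; nra.
Qed.

Lemma der_nrm2 i : exists2 f', der i (@nrm2 R) f' & forall y, f' y = 2 * X i y.
Proof.
have H := derD (@der_rad2 R i) (derM (@der_crd R i ix3) (@der_crd R i ix3)).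
eexists; first exact: H.
by move=> y /=; case: (ord3P i) => [->|[->|->]] /=; ring.
Qed.

Lemma der_isq i f f' : der i f f' -> (forall y, 0 < f y) -> der i (fun y => isq (f y))
  (fun y => (- 2^-1) * (isq (f y) * (isq (f y) * isq (f y))) * f' y).
Proof. by move=> [af <-] f0; split; [exact: elem_isq|exact: partial_isq]. Qed.

(** The gradient of [cutr r * decay] is radial, with this factor in front of the
    position vector. *)
Definition radfac r y := - cutr r y * (decay y * decay y * decay y) +
  2 * (r * r)^-1 * (decay y * dzeta ((r * r)^-1 * nrm2 y + (-1))).

Lemma partial_cutr_decay r i y : d_ i (fun z => cutr r z * decay z) y = X i y * radfac r y.
Proof.
have [n' nD nE] := der_nrm2 i.
have [_ H] := derM (der_zeta (derD (derM (der_cst i (r * r)^-1) nD) (der_cst i (-1))))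
  (der_isq (derD (der_cst i 1) nD) nrm2p_gt0).
apply: etrans (congr1 (fun f => f y) H) _; cbv beta; rewrite nE /radfac /cutr /decay.
move: (r * r)^-1 (X i y) (isq (1 + nrm2 y)) => b x q; move: (zeta (b * nrm2 y - 1)) (dzeta (b * nrm2 y - 1)) => z d; by field.
Qed.

Lemma cylinder_measurable (b : R) : @measurable _ mT (cylinder b).
Proof.
have -> : cylinder b = ((@cyl_r R) @^-1` `]-oo, b[%classic) `&` ((fun y : T => `|y.2|) @^-1` `]-oo, b[%classic).
  by apply/seteqP; split => y /=; rewrite !in_itv.
apply: measurableI.
  rewrite -[X in measurable X]setTI.
  have H : M (@cyl_r R).
    rewrite (_ : @cyl_r R = fun y => Num.sqrt (rad2 y)); last by apply/funext => y; rewrite cyl_rE.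
    apply: measurableT_comp; last exact: elem_measurable (@elem_rad2 R).
    exact: continuous_measurable_fun (@sqrt_continuous R).
  by apply: H => //; exact: measurable_itv.
rewrite -[X in measurable X]setTI.
have H : M (fun y : T => `|y.2|).
  apply: measurableT_comp; first exact: normr_measurable.
  exact: elem_measurable (@elem_crd R ix3).
by apply: H => //; exact: measurable_itv.
Qed.

Variables (u : 'I_3 -> T -> R) (a : 'I_3 -> 'I_3 -> T -> R) (mu : T -> R).
Hypothesis wdu : forall i j, wderiv j (u i) (a i j).
Hypothesis Bu : forall i, Bloc (u i).
Hypothesis u1E : forall y, u ix1 y = mu y * X ix1 y.
Hypothesis u2E : forall y, u ix2 y = mu y * X ix2 y.
Hypothesis diva : {ae mu3, forall y, a ix1 ix1 y + a ix2 ix2 y + a ix3 ix3 y = 0}.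
Hypothesis rvort0 : {ae mu3, forall y, rvort a y = 0}.

Definition usq y := u ix1 y * u ix1 y + u ix2 y * u ix2 y + u ix3 y * u ix3 y.
Definition udotx y := u ix1 y * X ix1 y + u ix2 y * X ix2 y + u ix3 y * X ix3 y.

Let arith (x1 x2 x3 u1 u2 u3 m f f1 f2 f3 a11 a12 a13 a21 a22 a23 a31 a32 a33
   q11 q12 q13 q21 q22 q23 q31 q32 q33 : R) :
  u1 = m * x1 -> u2 = m * x2 ->
  q11 = x1 * f1 + f * 1 -> q12 = x1 * f2 + f * 0 -> q13 = x1 * f3 + f * 0 ->
  q21 = x2 * f1 + f * 0 -> q22 = x2 * f2 + f * 1 -> q23 = x2 * f3 + f * 0 ->
  q31 = x3 * f1 + f * 0 -> q32 = x3 * f2 + f * 0 -> q33 = x3 * f3 + f * 1 ->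
  a11 + a22 + a33 = 0 -> x1 * (a13 - a31) + x2 * (a23 - a32) = 0 ->
  (u1 * u1 * q11 + (u1 * a11 + a11 * u1) * (x1 * f) +
   (u1 * u2 * q12 + (u1 * a22 + a12 * u2) * (x1 * f) +
    (u1 * u3 * q13 + (u1 * a33 + a13 * u3) * (x1 * f)))) +
  (u2 * u1 * q21 + (u2 * a11 + a21 * u1) * (x2 * f) +
   (u2 * u2 * q22 + (u2 * a22 + a22 * u2) * (x2 * f) +
    (u2 * u3 * q23 + (u2 * a33 + a23 * u3) * (x2 * f)))) +
  (u3 * u1 * q31 + (u3 * a11 + a31 * u1) * (x3 * f) +
   (u3 * u2 * q32 + (u3 * a22 + a32 * u2) * (x3 * f) +
    (u3 * u3 * q33 + (u3 * a33 + a33 * u3) * (x3 * f)))) +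
  - 2^-1 * (((u1 * u1 + u2 * u2 + u3 * u3) * q11 +
    (u1 * a11 + a11 * u1 + (u2 * a21 + a21 * u2) + (u3 * a31 + a31 * u3)) * (x1 * f)) +
   ((u1 * u1 + u2 * u2 + u3 * u3) * q22 +
    (u1 * a12 + a12 * u1 + (u2 * a22 + a22 * u2) + (u3 * a32 + a32 * u3)) * (x2 * f)) +
   ((u1 * u1 + u2 * u2 + u3 * u3) * q33 +
    (u1 * a13 + a13 * u1 + (u2 * a23 + a23 * u2) + (u3 * a33 + a33 * u3)) * (x3 * f))) =
  f * (u1 * u1 + u2 * u2 + u3 * u3) + (u1 * x1 + u2 * x2 + u3 * x3) * (u1 * f1 + u2 * f2 + u3 * f3) -
  2^-1 * ((u1 * u1 + u2 * u2 + u3 * u3) * (3 * f + (x1 * f1 + x2 * f2 + x3 * f3))).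
Proof.
move=> E1 E2 -> -> -> -> -> -> -> -> -> dv L0.
apply/eqP; rewrite -subr_eq0; apply/eqP.
rewrite (_ : _ - _ = f * (u1 * x1 + u2 * x2 + u3 * x3) * (a11 + a22 + a33) +
  f * (u3 - m * x3) * (x1 * (a13 - a31) + x2 * (a23 - a32))); first by rewrite dv L0 !mulr0 addr0.
by rewrite E1 E2; field.
Qed.

(** Without vorticity the nonlinearity is a gradient: the divergence of the tensor u
    u equals the gradient of |u|^2 / 2. Testing with the radial field f y suffices,
    and there the only curl component that appears is [rvort]. *)
Lemma nullint_pohozaev f : TF f ->
  nullint (fun y => f y * usq y + udotx y * (u ix1 y * d_ ix1 f y + u ix2 y * d_ ix2 f y + u ix3 y * d_ ix3 f y) -
     2^-1 * (usq y * (3 * f y + (X ix1 y * d_ ix1 f y + X ix2 y * d_ ix2 f y + X ix3 y * d_ ix3 f y)))).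
Proof.
move=> tf; have [af _] := tf.
have tx i : TF (fun y => X i y * f y) by exact: TF_mul (@elem_crd R i) tf.
have A i j := nullint_wderiv (wderivM (wdu i j) (wdu j j) (Bu i) (Bu j)) (tx i).
have vel j k := wderivM (wdu j k) (wdu j k) (Bu j) (Bu j).
have B k := nullint_wderiv (wderivD (wderivD (vel ix1 k) (vel ix2 k)) (vel ix3 k)) (tx k).
have S i := nullintD (A i ix1) (nullintD (A i ix2) (A i ix3)).
apply: (nullint_ae (nullintD (nullintD (nullintD (S ix1) (S ix2)) (S ix3)) (nullintZ (- 2^-1) (nullintD (nullintD (B ix1) (B ix2)) (B ix3))))).
  have mu_ i : M (u i) by have [] := Bu i.
  have mX i : M (X i) by exact: elem_measurable (@elem_crd R i).
  have md i : M (d_ i f) by apply: TF_meas; exact: TF_partial.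
  have mf := TF_meas tf.
  have mm g h (mg : M g) (mh : M h) : M (fun y => g y * h y) := measurable_funM mg mh.
  have ma g h (mg : M g) (mh : M h) : M (fun y => g y + h y) := measurable_funD mg mh.
  have mc c : M (fun=> c) := measurable_cst c.
  have s3 (g h : 'I_3 -> T -> R) (mg : forall i, M (g i)) (mh : forall i, M (h i)) :=
    ma _ _ (ma _ _ (mm _ _ (mg ix1) (mh ix1)) (mm _ _ (mg ix2) (mh ix2))) (mm _ _ (mg ix3) (mh ix3)).
  have musq : M usq := s3 _ _ mu_ mu_.
  apply: (@measurable_funB _ mT R).
    exact: (ma _ _ (mm _ _ mf musq) (mm _ _ (s3 _ _ mu_ mX) (s3 _ _ mu_ md))).
  exact: (mm _ _ (mc 2^-1) (mm _ _ musq (ma _ _ (mm _ _ (mc 3) mf) (s3 _ _ mX md)))).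
apply: (ae2 diva rvort0) => y dv L0.
have q i j := partial_Xmul j i y af.
exact: (arith _ _ _ (u1E y) (u2E y) (q ix1 ix1) (q ix1 ix2) (q ix1 ix3) (q ix2 ix1) (q ix2 ix2) (q ix2 ix3)
  (q ix3 ix1) (q ix3 ix2) (q ix3 ix3) dv L0).
Qed.

Let arith2 (us ud z q b d s x1 x2 x3 u1 u2 u3 g I : R) : 0 <= us -> d <= 0 -> 0 < q -> 0 <= b ->
  q * q * (1 + s) = 1 -> 0 <= z -> ud = u1 * x1 + u2 * x2 + u3 * x3 -> s = x1 * x1 + x2 * x2 + x3 * x3 ->
  g = - z * (q * q * q) + 2 * b * (q * d) ->
  I = z * q * us + ud * (u1 * (x1 * g) + u2 * (x2 * g) + u3 * (x3 * g)) -
     2^-1 * (us * (3 * (z * q) + (x1 * (x1 * g) + x2 * (x2 * g) + x3 * (x3 * g)))) ->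
  us * (z * (q * q * q)) <= - 2 * I + 2 * q * (- d) * (b * s) * us.
Proof.
move=> us0 d0 q0 b0 qs z0 udE sE gE IE.
have -> : - 2 * I = us * (z * q) + g * (us * s - 2 * (ud * ud)).
  by rewrite IE udE sE; field.
have zq : z * q = z * (q * q * q) * (1 + s).
  by rewrite (_ : z * (q * q * q) * (1 + s) = z * q * (q * q * (1 + s))); [rewrite qs mulr1|ring].
rewrite zq gE.
have -> : us * (z * (q * q * q) * (1 + s)) + (- z * (q * q * q) + 2 * b * (q * d)) * (us * s - 2 * (ud * ud)) +
  2 * q * - d * (b * s) * us = us * (z * (q * q * q)) + 2 * (z * (q * q * q)) * (ud * ud) + 4 * (b * (q * - d)) * (ud * ud).
  by ring.
have q3 : 0 <= q * q * q by rewrite !mulr_ge0// ltW.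
have ud2 : 0 <= ud * ud by rewrite -expr2 sqr_ge0.
rewrite -addrA lerDl addr_ge0// mulr_ge0// mulr_ge0//; first exact: mulr_ge0.
by apply: mulr_ge0 => //; apply: mulr_ge0; [exact: ltW|rewrite oppr_ge0].
Qed.

Lemma usq_ge0 y : 0 <= usq y.
Proof. by rewrite /usq -!expr2 !addr_ge0// sqr_ge0. Qed.

Lemma Bloc_usq : Bloc usq.
Proof. by do 2?apply: BlocD; apply: BlocM. Qed.

(** The gradient of the cutoff is supported where r^2 <= |y|^2 <= 2 r^2, and there
    [decay] is at most 1 / r. *)
Lemma dz_bound r y : 0 < r ->
  2 * decay y * (- dzeta ((r * r)^-1 * nrm2 y + (-1))) * ((r * r)^-1 * nrm2 y) * usq y <=
  4 * czeta R / r * (usq y * \1_(cylinder (2 * r)) y).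
Proof.
move=> r0; have rr : 0 < r * r by rewrite mulr_gt0.
have cz := czeta_gt0 R.
have R0 : 0 <= 4 * czeta R / r * (usq y * (\1_(cylinder (2 * r)) y : R)).
  apply: mulr_ge0; first by apply: divr_ge0; [apply: mulr_ge0 => //; exact: ltW|exact: ltW].
  by rewrite mulr_ge0 ?usq_ge0// indicE.
set b := (r * r)^-1 * nrm2 y; have b0 : 0 <= b by rewrite mulr_ge0 ?nrm2_ge0// invr_ge0 ltW.
have [b1|b1] := leP (b + -1) 0; first by rewrite dzeta_eq0l// oppr0 mulr0 !mul0r.
have [b2|b2] := leP 1 (b + -1); first by rewrite dzeta_eq0r// oppr0 mulr0 !mul0r.
have nE : nrm2 y = r * r * b by rewrite /b mulVKf// gt_eqF.
have yc : cylinder (2 * r) y.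
  have n2 : nrm2 y < (2 * r) ^+ 2 by rewrite nE expr2; nra.
  have r2 : 0 <= 2 * r by rewrite mulr_ge0// ltW.
  split.
    rewrite -[X in _ < X]ger0_norm// -[X in X < _]ger0_norm ?cyl_r_ge0//.
    rewrite -ltr_sqr ?nnegrE// !real_normK ?num_real// expr2 cyl_r2.
    by apply: le_lt_trans n2; rewrite /nrm2 lerDl -expr2 sqr_ge0.
  rewrite -[X in _ < X]ger0_norm// -ltr_sqr ?nnegrE// !real_normK ?num_real//.
  by apply: le_lt_trans n2; rewrite /nrm2 expr2 lerDr rad2_ge0.
rewrite indicE mem_set// mulr1; apply: ler_wpM2r; first exact: usq_ge0.
have q0 := decay_gt0 y.
have qr : decay y <= r^-1.
  rewrite -[leRHS]ger0_norm ?invr_ge0 ?(ltW r0)// -[leLHS]ger0_norm ?(ltW q0)//.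
  rewrite -ler_sqr ?nnegrE// !real_normK ?num_real//.
  rewrite {1}/decay isq_sqr ?nrm2p_gt0// exprVn lef_pV2 ?posrE ?exprn_gt0 ?nrm2p_gt0//.
  by rewrite nE expr2; nra.
have d1 := dzeta_bound (b + -1); have d0 : 0 <= - dzeta (b + -1) by rewrite oppr_ge0 dzeta_le0.
have b3 : b <= 2 by lra.
have -> : 4 * czeta R / r = 2 * r^-1 * czeta R * 2 by ring.
apply: ler_pM => //; first by rewrite !mulr_ge0// ltW.
apply: ler_pM => //; first by rewrite mulr_ge0// ltW.
by rewrite ler_pM2l.
Qed.

Lemma usq_cyl_itg b : itg mu3 (fun y => usq y * \1_(cylinder b) y).
Proof.
have [mu_ _] := Bloc_usq.
have [_ /(_ b) Hi] := Bloc_Lloc Bloc_usq.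
apply: itg_dom Hi _.
  apply: measurable_funM => //; apply: measurable_indic; exact: cylinder_measurable.
move=> y; have [yb|yb] := pselect (cylinder b y).
  rewrite indicE mem_set// mulr1 ger0_norm ?usq_ge0// ind1 ?mul1r//.
  have [r1 r2] := yb; have b0 : 0 < b by apply: le_lt_trans r1; exact: cyl_r_ge0.
  apply/boxP => i.
  have sq x : x * x <= rad2 y -> `|x| <= b.
    move=> xs; apply: le_trans (ltW r1); rewrite -(@ger0_norm _ (cyl_r y)) ?cyl_r_ge0//.
    by rewrite -ler_sqr ?nnegrE// !real_normK ?num_real// !expr2 cyl_r2.
  case: (ord3P i) => [->|[->|->]]; last exact: ltW.
    by apply: sq; rewrite /rad2 lerDl -expr2 sqr_ge0.
  by apply: sq; rewrite /rad2 lerDr -expr2 sqr_ge0.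
rewrite indicE memNset// mulr0 normr0; apply: mulr_ge0; [exact: ind_ge0|exact: usq_ge0].
Qed.

Let w y := usq y * (decay y * decay y * decay y).

Lemma w_ge0 y : 0 <= w y.
Proof.
have q0 := ltW (decay_gt0 y); apply: mulr_ge0; first exact: usq_ge0.
by apply: mulr_ge0 => //; apply: mulr_ge0.
Qed.

Lemma w_itg phi : TF phi -> itg mu3 (fun y => w y * phi y).
Proof.
move=> tp; apply: Lloc_TF => //; apply: Bloc_Lloc; apply: BlocM; first exact: Bloc_usq.
by apply: BlocM; [apply: BlocM|]; exact: elem_Bloc elem_decay.
Qed.

(** The Pohozaev identity with [f = cutr r * decay]; the terms with (u.y)^2 have a
    good sign. *)
Lemma pohozaev_le r : 0 < r ->
  \int[mu3]_(y in setT) (w y * cutr r y) <=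
  4 * czeta R / r * \int[mu3]_(y in setT) (usq y * \1_(cylinder (2 * r)) y).
Proof.
move=> r0; have tz := TF_cutr r0.
have tf : TF (fun y => cutr r y * decay y).
  have H := TF_mul elem_decay tz; rewrite (_ : (fun y => _) = (fun y => decay y * cutr r y))//.
  by apply/funext => y; rewrite mulrC.
have [zi z0] := nullint_pohozaev tf; have ci := usq_cyl_itg (2 * r).
rewrite -IZ// -[leRHS]add0r -[X in X + _](mulr0 (-2)) -{}z0 -IZ// -ID//; [|exact: itgZ|exact: itgZ].
apply: I_le; [exact: w_itg|by apply: itgD; exact: itgZ|].
move=> y; set I := _ - _.
apply: (@le_trans _ _ (- 2 * I + 2 * decay y * (- dzeta ((r * r)^-1 * nrm2 y + (-1))) *
    ((r * r)^-1 * nrm2 y) * usq y)); last by rewrite lerD2l; exact: dz_bound.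
have -> : w y * cutr r y = usq y * (cutr r y * (decay y * decay y * decay y)) by rewrite /w; ring.
have IE : I = cutr r y * decay y * usq y + udotx y * (u ix1 y * (X ix1 y * radfac r y) +
    u ix2 y * (X ix2 y * radfac r y) + u ix3 y * (X ix3 y * radfac r y)) -
  2^-1 * (usq y * (3 * (cutr r y * decay y) + (X ix1 y * (X ix1 y * radfac r y) +
    X ix2 y * (X ix2 y * radfac r y) + X ix3 y * (X ix3 y * radfac r y)))).
  have := partial_cutr_decay r ix1 y; have := partial_cutr_decay r ix2 y; have := partial_cutr_decay r ix3 y.
  by rewrite /I => -> -> ->.
have b0 : 0 <= (r * r)^-1 by rewrite invr_ge0 mulr_ge0// ltW.
exact: (arith2 (usq_ge0 y) (dzeta_le0 _) (decay_gt0 y) b0 (decayE y) (zeta_ge0 _) (erefl (udotx y))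
  (erefl (nrm2 y)) (erefl (radfac r y)) IE).
Qed.

Hypothesis growth : forall eps r0 : R, 0 < eps -> exists2 r, r0 <= r &
  \int[mu3]_(y in setT) (usq y * \1_(cylinder (2 * r)) y) <= eps * r.

(** The energy in balls of radius r is o(r), so the right-hand side of [pohozaev_le]
    tends to 0 along a sequence of radii. *)
Lemma usq_eq0 : {ae mu3, forall y, usq y = 0}.
Proof.
have cz := czeta_gt0 R.
have H n : {ae mu3, forall y, w y * cut n%:R y = 0}.
  have wi := w_itg (TF_cut n%:R).
  apply: I_eq0 => //; first by move=> y; apply: mulr_ge0; [exact: w_ge0|exact: zeta_ge0].
  apply/ler_addgt0Pl => eps eps0; rewrite addr0.
  have [r rn rI] := growth (n%:R + 1) (divr_gt0 eps0 (mulr_gt0 (ltr0n R 4) cz)).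
  have r1 : 1 <= r by apply: le_trans rn; rewrite lerDr.
  have r0 : 0 < r by apply: lt_le_trans r1.
  have rr : 0 < r * r by rewrite mulr_gt0.
  apply: (@le_trans _ _ (\int[mu3]_(y in setT) (w y * cutr r y))).
    apply: I_le; [exact: wi|exact: w_itg (TF_cutr r0)|].
    move=> y; apply: ler_wpM2l; first exact: w_ge0.
    have [c0|c0] := leP 1 (nrm2 y - n%:R); first by rewrite /cut zeta_eq0// zeta_ge0.
    rewrite [leRHS]zeta_eq1 ?zeta_le1// addrC addrC subr_le0 ler_pdivrMl// mulr1.
    apply: (@le_trans _ _ (n%:R + 1)); first by rewrite addrC -lerBlDr ltW.
    by apply: (le_trans rn); rewrite ler_peMr// ltW.
  apply: (le_trans (pohozaev_le r0)).
  have -> : eps = 4 * czeta R / r * (eps / (4 * czeta R) * r).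
    by field; rewrite !gt_eqF.
  by rewrite ler_pM2l// divr_gt0// mulr_gt0.
apply: (ae1 (ae_foralln H)) => y Hy.
have := Hy (Num.truncn (nrm2 y)).+1; rewrite cut_eq1; last by rewrite ltW// truncnS_gt.
by move/eqP; rewrite mulr1 /w !mulf_eq0 !(gt_eqF (decay_gt0 y)) !orbF => /eqP.
Qed.

End pohozaev.

(** * Odd functions with bounded weak derivative *)

Section lipschitz.
Variable R : realType.
Local Notation T := (vec3 R).
Local Notation e := (@std_basis R).
Local Notation mu1 := (@lebesgue_measure R).
Local Notation mu3 := (leb3 R).
Local Notation mT := (measurableTypeR R * measurableTypeR R * measurableTypeR R)%type.
Implicit Types (i : 'I_3) (f g : T -> R) (c s t N : R) (y v : T) (n : nat).
Local Notation X := (@coord3 R).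
Local Notation d_ := (@partial R).

Lemma ae_shift (P : T -> Prop) v : {ae mu3, forall x, P x} -> {ae mu3, forall x, P (x + v)}.
Proof.
move=> [A [mA A0 HA]]; exists ((fun x : T => x + v) @^-1` A); split.
- by apply: (measurable_preim (measurable_shift3 v)).
- by rewrite -A0; exact: leb3_shift.
- by move=> x /= Hx; apply: HA.
Qed.

Let partial_cut0 a i y : nrm2 y <= a -> d_ i (cut a) y = 0.
Proof. by move=> H; rewrite partial_cut dzeta_eq0l ?mul0r// subr_le0. Qed.

Let nrm2_ray i x s t : 0 <= s <= t ->
  nrm2 (x + s *: e i) <= nrm2 x + 2 * (`|X i x| * t) + t * t.
Proof.
move=> /andP[s0 st].
have -> : nrm2 (x + s *: e i) = nrm2 x + 2 * (X i x * s) + s * s.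
  by rewrite /nrm2 /rad2 !crd_ray; case: (ord3P i) => [->|[->|->]] /=; ring.
have t0 := le_trans s0 st.
have H1 : X i x * s <= `|X i x| * t.
  by apply: le_trans (ler_norm _) _; rewrite normrM (ger0_norm s0) ler_wpM2l.
have H2 : s * s <= t * t by apply: ler_pM.
by lra.
Qed.

(** The weak fundamental theorem, localized with the cutoffs [cut n]. *)
Lemma weak_lip_pos i f g c t : wderiv i f g -> Bloc f -> (forall y, `|g y| <= c) -> 0 < t ->
  {ae mu3, forall x, `|f (x + t *: e i) - f x| <= c * t}.
Proof.
move=> wf bf gc t0.
have H n : {ae mu3, forall x, nrm2 x + 2 * (`|X i x| * t) + t * t <= n%:R ->
    `|f (x + t *: e i) - f x| <= c * t}.
  have [wF iF iF' _] := cut_global n%:R wf bf.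
  apply: (ae2 (weak_FTC wF iF iF' t0) (ae_itg_line (e i) (dual_ok1 iF') (ltW t0))).
  move=> x Ex Ix xn.
  have seg s : 0 <= s <= t -> nrm2 (x + s *: e i) <= n%:R.
    by move=> st; apply: le_trans xn; exact: nrm2_ray.
  have st : 0 <= t <= t by rewrite lexx ltW.
  have s0 : 0 <= (0 : R) <= t by rewrite lexx ltW.
  have n0 : nrm2 x <= n%:R by have := seg 0 s0; rewrite scale0r addr0.
  have -> : f (x + t *: e i) - f x = cut n%:R (x + t *: e i) * f (x + t *: e i) - cut n%:R x * f x.
    by rewrite !cut_eq1 ?mul1r// seg.
  rewrite Ex; have := I1_bound (b := 0) (B := c) (ltW t0) Ix.
  rewrite mulr0 subr0 [c * t]mulrC; apply => s /seg Hs.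
  by rewrite subr0 cut_eq1// mul1r partial_cut0// mul0r addr0.
apply: (ae1 (ae_foralln H)) => x /(_ (Num.truncn (nrm2 x + 2 * (`|X i x| * t) + t * t)).+1).
by apply; rewrite ltW// truncnS_gt.
Qed.

Lemma weak_lip i f g c t : wderiv i f g -> Bloc f -> (forall y, `|g y| <= c) ->
  {ae mu3, forall x, `|f (x + t *: e i) - f x| <= c * `|t|}.
Proof.
move=> wf bf gc; have [t0|t0|->] := ltgtP t 0; last first.
- by apply: aeW => x; rewrite scale0r addr0 subrr normr0 mulr0.
- by rewrite (ger0_norm (ltW t0)); exact: weak_lip_pos wf bf gc t0.
have nt0 : 0 < - t by rewrite oppr_gt0.
apply: (ae1 (ae_shift (t *: e i) (weak_lip_pos wf bf gc nt0))) => x.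
by rewrite -addrA -scalerDl subrr scale0r addr0 distrC (ltr0_norm t0).
Qed.

(** Fubini's theorem for null sets: the sections in one variable being null, so are
    almost all sections in the other one. *)
Lemma ae_sections (B : set (mT * measurableTypeR R)) : measurable B ->
  (forall t, {ae mu3, forall x, ~ B (x, t)}) -> {ae mu3, forall x, mu1 (xsection B x) = 0%E}.
Proof.
move=> mB H.
have E := @indic_fubini_tonelli _ _ mT (measurableTypeR R) R (leb3s R) (leb1s R) B mB.
rewrite (indic_fubini_tonelli_FE (leb1s R) mB) (indic_fubini_tonelli_GE (leb3s R) mB) in E.
have Y0 t : mu3 (ysection B t) = 0%E.
  have [A [mA A0 HA]] := H t.
  apply/eqP; rewrite eq_le measure_ge0 andbT -A0; apply: le_measure; rewrite ?inE//.
    exact: measurable_ysection.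
  by move=> x /ysectionP Bx; apply: HA => /=.
have {}E : (\int[mu3]_x mu1 (xsection B x) = 0)%E.
  apply: etrans E _; rewrite -[RHS](integral0 (leb1s R) setT).
  by apply: eq_integral => t _ /=; exact: Y0.
have mF := measurable_fun_xsection (leb1s R) mB.
have {}E : (\int[mu3]_x `|(leb1s R \o xsection B) x| = 0)%E.
  by rewrite -[RHS]E; apply: eq_integral => x _ /=; rewrite gee0_abs.
have /(ae_eq_integral_abs mu3 measurableT mF) := E.
by move=> K; apply: (ae1 K) => x /(_ I).
Qed.

(** Almost every point [x] is compared with its mirror image: for almost every [t]
    the increments from [x] to [x + t e] and to the mirror image of that point are
    both Lipschitz, and the values there are opposite. *)
Lemma odd_bound i f g c : wderiv i f g -> Bloc f -> (forall y, `|g y| <= c) -> 0 <= c ->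
  (forall x t, f (x + t *: e i) = - f (x + (- 2 * X i x - t) *: e i)) ->
  {ae mu3, forall x, `|f x| <= c * `|X i x|}.
Proof.
move=> wf bf gc c0 fodd; have [mf _] := bf.
pose B : set (mT * measurableTypeR R) :=
  [set z | c * `|z.2 : R| < `|f ((z.1 : T) + z.2 *: e i) - f z.1|].
have mB : measurable B.
  have m2 : measurable_fun setT (fun z : mT * measurableTypeR R => (z.2 : R)) by exact: measurable_snd.
  have m1 : measurable_fun setT (fun z : mT * measurableTypeR R => c * `|z.2 : R|).
    apply: measurable_funM; first exact: measurable_cst.
    by apply: measurableT_comp => //; exact: normr_measurable.
  have m3 : measurable_fun setT (fun z : mT * measurableTypeR R =>
      `|f ((z.1 : T) + z.2 *: e i) - f z.1|).
    apply: measurableT_comp; first exact: normr_measurable.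
    apply: measurable_funB; first exact: (measurableT_comp mf (measurable_ray (e i))).
    exact: (measurableT_comp mf measurable_fst).
  have mlt := measurable_fun_ltr m1 m3.
  have mt : measurable [set true] by [].
  by have := mlt measurableT [set true] mt; rewrite setTI.
have Bt t : {ae mu3, forall x, ~ B (x, t)}.
  by apply: (ae1 (weak_lip t wf bf gc)) => x H; rewrite /B /= ltNge H.
apply: (ae1 (ae_sections mB Bt)) => x N0.
set N := xsection B x in N0; have mN : measurable N by exact: measurable_xsection.
have [x0|x0] := eqVneq (X i x) 0.
  have := fodd x 0; rewrite x0 mulr0 subr0 scale0r addr0 normr0 mulr0 => /eqP.
  by rewrite -addr_eq0 -mulr2n mulrn_eq0/= => /eqP ->; rewrite normr0.
pose w : R := - 2 * X i x.
pose N' : set R := (fun t : R => w - t) @^-1` N.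
have mop : measurable_fun setT (-%R : R -> R) by exact: oppr_measurable.
have NE : N' = (-%R : R -> R) @^-1` ((fun t : R => t + w) @^-1` N).
  by apply/funext => t; rewrite /N' /preimage /= addrC.
have mNw : measurable ((fun t : R => t + w) @^-1` N) by exact: (measurable_preim (measurable_shift1 w)).
have N'0 : mu1 N' = 0%E.
  by rewrite NE -N0 -(leb1_shift w mN); exact: (lebesgue_measureN mNw).
have mN' : measurable N' by rewrite NE; exact: (measurable_preim mop).
pose J := `[Num.min 0 w, Num.max 0 w]%classic : set R.
have mJ : measurable J by exact: measurable_itv.
have w0 : w != 0 by rewrite mulf_neq0// oppr_eq0.
have J0 : (0 < mu1 J)%E.
  rewrite lebesgue_measure_itv/= lte_fin; case: (ltgtP 0 w) => [H|H|H].
  - by rewrite H lte_fin subr_gt0.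
  - by rewrite H lte_fin subr_gt0.
  - by rewrite -H eqxx in w0.
(* [t] lies between the parameters of [x] and of its mirror image, and both
   [t] and its reflection [w - t] avoid the null set. *)
have [t [Jt Nt N't]] : exists t, [/\ J t, ~ N t & ~ N' t].
  apply/not_existsP => H.
  have JN : J `<=` N `|` N'.
    move=> t Jt; have := H t; apply: contra_notP => /not_orP[nN nN']; by split.
  suff : (mu1 J <= 0)%E by rewrite leNgt J0.
  apply: (@le_trans _ _ (mu1 (N `|` N'))).
    by apply: le_measure; rewrite ?inE//; exact: measurableU.
  have := @measureU2 _ _ _ mu1 N N' mN mN'; rewrite [X in (_ <= X + _)%E -> _]N0 [X in (_ <= _ + X)%E -> _]N'0 adde0.
  by [].
have G s : ~ N s -> `|f (x + s *: e i) - f x| <= c * `|s|.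
  move=> Ns; rewrite leNgt; apply/negP => H; apply: Ns.
  by apply/xsectionP.
have G1 := G _ Nt; have G2 := G (w - t) N't.
rewrite fodd -/w in G1.
have tt : `|t| + `|w - t| = 2 * `|X i x|.
  have -> : 2 * `|X i x| = `|w| by rewrite /w normrM normrN normr_nat.
  move: Jt; rewrite /J /= in_itv/=; case: (ltgtP 0 w) => [H|H|H] /andP[t1 t2].
  - by rewrite (ger0_norm t1) ger0_norm ?subr_ge0// (ger0_norm (ltW H)) addrC subrK.
  - rewrite (ler0_norm t2) ler0_norm ?subr_le0// (ltr0_norm H); ring.
  - by rewrite -H eqxx in w0.
set F := f (x + (w - t) *: e i) in G1 G2.
have H2 : 2 * `|f x| <= `|- F - f x| + `|F - f x|.
  rewrite -{1}[2](@normr_nat R) -normrM.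
  have -> : 2 * f x = - ((- F - f x) + (F - f x)) by ring.
  by rewrite normrN ler_normD.
rewrite -(@ler_pM2l _ 2)// (le_trans H2)// (le_trans (lerD G1 G2))//.
by rewrite -mulrDr tt mulrCA.
Qed.

End lipschitz.

(** * From cylindrical to Cartesian equations *)

Section offaxis.
Variable R : realType.
Local Notation T := (vec3 R).
Local Notation mu3 := (leb3 R).
Implicit Types (i : 'I_3) (f g x phi psi : T -> R) (c t N : R) (y : T) (n : nat).
Local Notation X := (@coord3 R).
Local Notation d_ := (@partial R).

Lemma TFo_mul f phi : elem f -> TFo phi -> TFo (fun y => f y * phi y).
Proof.
move=> af [tp [d d0 hd]]; split; first exact: TF_mul.
by exists d => // y /hd ->; rewrite mulr0.
Qed.

Lemma TFo_add phi psi : TFo phi -> TFo psi -> TFo (fun y => phi y + psi y).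
Proof.
move=> [tp [d d0 hd]] [tq [d' d0' hd']]; split; first exact: TF_add.
exists (Num.min d d'); first by rewrite lt_min d0.
by move=> y; rewrite le_min => /andP[/hd -> /hd' ->]; rewrite addr0.
Qed.

Lemma TFo_vanish phi : TFo phi -> exists n,
  (forall y, theta n y * phi y = phi y) /\ forall i y, rad2 y <= n.+1%:R^-1 -> d_ i phi y = 0.
Proof.
move=> tp; have [n Hn] := TFo_thetaE tp; exists n; split => // i y yn.
have [[ap _] _] := tp.
have [_ H] := derM (der_partial i (elem_theta R n)) (der_partial i ap).
have E : (fun y => theta n y * phi y) = phi by apply/funext.
have := congr1 (fun f => f y) H; rewrite E => ->.
by rewrite -(Hn y) theta0// !mul0r addr0.
Qed.

Lemma TFo_partial i phi : TFo phi -> TFo (d_ i phi).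
Proof.
move=> tp; have [t1 _] := tp; split; first exact: TF_partial.
by have [n [_ Hn]] := TFo_vanish tp; exists n.+1%:R^-1; [rewrite invr_gt0|exact: Hn].
Qed.

(** A smooth function that equals r away from the axis. It makes r times a test
    function a test function again. *)
Definition rho n y : R := rreg n y * isq (rreg n y).

Lemma elem_rho n : elem (rho n).
Proof.
apply: elem_mul; first exact: elem_rreg.
by apply: elem_isq; [exact: elem_rreg|exact: rreg_gt0].
Qed.

Lemma rho_gt0 n y : 0 < rho n y.
Proof. by apply: mulr_gt0; [exact: rreg_gt0|exact: isq_gt0]. Qed.

Lemma rho2 n y : rho n y * rho n y = rreg n y.
Proof.
have r0 := rreg_gt0 n y; have := isq_sqr r0; rewrite expr2 /rho => H.
rewrite (_ : _ * _ = rreg n y * rreg n y * (isq (rreg n y) * isq (rreg n y))); last by ring.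
by rewrite H mulfK// gt_eqF.
Qed.

Lemma rhoE n y : n.+1%:R^-1 <= rad2 y -> rho n y = cyl_r y.
Proof.
move=> yn; rewrite cyl_rE -(rregE yn) -rho2 -expr2 sqrtr_sqr ger0_norm//.
exact: ltW (rho_gt0 n y).
Qed.

(** Obtained by differentiating [rho2]. *)
Lemma partial_rho n i y : n.+1%:R^-1 <= rad2 y ->
  rho n y * d_ i (rho n) y = X ix1 y * (ix1 == i)%:R + X ix2 y * (ix2 == i)%:R.
Proof.
move=> yn.
have [_ H1] := derM (der_partial i (elem_rho n)) (der_partial i (elem_rho n)).
have [_ H2] := derD (@der_rad2 R i) (der_zeta (derD (derM (der_cst i (2 * n.+1%:R)) (@der_rad2 R i)) (der_cst i (-1)))).
have E : (fun y => rho n y * rho n y) = rreg n by apply/funext => z; exact: rho2.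
have := congr1 (fun f => f y) H1; rewrite E => E1.
have := etrans (esym E1) (congr1 (fun f => f y) H2).
rewrite dzeta_eq0r; last first.
  have : 1 <= n.+1%:R * rad2 y by rewrite -ler_pdivrMl// mulr1.
  by move=> ?; lra.
rewrite mul0r addr0 => {E1 H1 H2 E}.
by move: (rho n y * _) => a; lra.
Qed.

Lemma TFo_r phi : TFo phi -> TFo (fun y => cyl_r y * phi y) /\ forall i y,
  cyl_r y * d_ i (fun z => cyl_r z * phi z) y =
  rad2 y * d_ i phi y + (X ix1 y * (ix1 == i)%:R + X ix2 y * (ix2 == i)%:R) * phi y.
Proof.
move=> tp; have [n [Hn Hd]] := TFo_vanish tp; have [[ap _] _] := tp.
have E : (fun y => cyl_r y * phi y) = (fun y => rho n y * phi y).
  apply/funext => y; have [H|/ltW H] := leP (rad2 y) n.+1%:R^-1; last by rewrite rhoE.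
  by rewrite -(Hn y) theta0// !mul0r !mulr0.
rewrite E; split; first exact: TFo_mul (elem_rho n) tp.
move=> i y; have [_ H] := derM (der_partial i (elem_rho n)) (der_partial i ap).
have -> := congr1 (fun f => f y) H.
have [H1|/ltW H1] := leP (rad2 y) n.+1%:R^-1.
  by rewrite Hd// -(Hn y) theta0// !mul0r !mulr0 addr0 mulr0.
rewrite -(partial_rho i H1) -cyl_r2 -(rhoE H1); ring.
Qed.

Lemma TFo_axis phi y : TFo phi -> cyl_r y = 0 -> phi y = 0.
Proof.
move=> [_ [d d0 hd]] y0; apply: hd; rewrite -cyl_r2 y0 mul0r; exact: ltW.
Qed.

(** The fundamental lemma in the form used to identify the cylindrical derivatives
    with combinations of the Cartesian ones. *)
Lemma eq_off f g : Loff f -> Loff g -> (forall psi, TFo psi ->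
  \int[mu3]_(y in setT) (f y * psi y) = \int[mu3]_(y in setT) (g y * psi y)) ->
  {ae mu3, forall y, f y = g y}.
Proof.
move=> lf lg H.
have lg' : Loff (fun y => -1 * g y) by apply: BlocMLoff => //; exact: Bloc_cst.
have : {ae mu3, forall y, f y + -1 * g y = 0}.
  apply: flcv_off; first exact: LoffD.
  move=> phi tp.
  have i1 := Loff_TFo lf tp; have i2 := Loff_TFo lg tp.
  transitivity (\int[mu3]_(y in setT) (f y * phi y - g y * phi y)).
    by apply: I_ext => y; ring.
  by rewrite IB// H// subrr.
by move=> K; apply: (ae1 K) => y /eqP; rewrite mulN1r subr_eq0 => /eqP.
Qed.

Lemma cyl_r_Bloc : Bloc (@cyl_r R).
Proof.
split.
  rewrite (_ : @cyl_r R = fun y => Num.sqrt (rad2 y)); last by apply/funext => y; rewrite cyl_rE.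
  apply: measurableT_comp; last exact: elem_measurable (@elem_rad2 R).
  exact: continuous_measurable_fun (@sqrt_continuous R).
move=> N; have [_ /(_ N) [c hc]] := elem_Bloc (elem_add (@elem_rad2 R) (elem_cst 1)).
exists c => y /hc H; rewrite (ger0_norm (cyl_r_ge0 y)).
apply: le_trans (le_trans (ler_norm _) H) => /=; rewrite -cyl_r2.
have := sqr_ge0 (cyl_r y - 2^-1); by move: (cyl_r y) => r; rewrite expr2 => K; nra.
Qed.

Lemma divr_cancel x psi : TFo psi ->
  (fun y => x y / cyl_r y * (cyl_r y * psi y)) = (fun y => x y * psi y).
Proof.
move=> tp; apply/funext => y; have [r0|r0] := eqVneq (cyl_r y) 0.
  by rewrite (TFo_axis tp r0) !mulr0.
by rewrite mulrA divfK.
Qed.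

(** Testing the radial derivative against r psi cancels the singular coefficients
    y_i / r. *)
Lemma dr_test f g psi : weak_dr f g -> TFo psi ->
  \int[mu3]_(y in setT) (g y * (cyl_r y * psi y)) =
  - (\int[mu3]_(y in setT) (f y * d_ ix1 (fun z => X ix1 z * psi z) y))
  - \int[mu3]_(y in setT) (f y * d_ ix2 (fun z => X ix2 z * psi z) y).
Proof.
move=> [_ _ H] tp; have [tr _] := TFo_r tp; have := H _ (TFo_test tr).
rewrite /dist_dr /dist_add /dist_mul /dist_partial /dist_of => <-.
have E1 := divr_cancel (X ix1) tp; have E2 := divr_cancel (X ix2) tp.
by rewrite -E1 -E2.
Qed.

End offaxis.

Section cylindrical.
Variable R : realType.
Local Notation T := (vec3 R).
Local Notation mu3 := (leb3 R).
Implicit Types (i j : 'I_3) (f g phi psi : T -> R) (s t : R) (y : T).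
Local Notation X := (@coord3 R).
Local Notation d_ := (@partial R).
Local Notation "'II' f" := (\int[mu3]_(y in setT) f y) (at level 10, f at level 9).

Variables (U : T -> T) (Ur U3 P : T -> R) (a : 'I_3 -> 'I_3 -> T -> R).
Hypothesis UE : forall y, U y = Ur y *: e_r y + U3 y *: e_3 R.
Hypothesis wgU : weak_gradient U a.

Definition vel i y := X i (U y).
(** This ratio stays bounded near the axis, see [ang_bound]; on the axis its value
    is 0. *)
Definition ang y : R := Ur y / cyl_r y.

Lemma vel1 y : vel ix1 y = ang y * X ix1 y.
Proof. by rewrite /vel UE /ang /coord3 /= /GRing.scale /= mulr0 addr0 mulrA mulrAC. Qed.
Lemma vel2 y : vel ix2 y = ang y * X ix2 y.
Proof. by rewrite /vel UE /ang /coord3 /= /GRing.scale /= mulr0 addr0 mulrA mulrAC. Qed.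
Lemma vel3 y : vel ix3 y = U3 y.
Proof. by rewrite /vel UE /coord3 /= /GRing.scale /= mulr0 add0r mulr1. Qed.

(** The product r Ur is a Cartesian expression, so it has weak derivatives on the
    whole space. *)
Definition rUr y := X ix1 y * vel ix1 y + X ix2 y * vel ix2 y.

Lemma rUrE y : rUr y = ang y * rad2 y.
Proof. by rewrite /rUr vel1 vel2 /rad2; ring. Qed.

Lemma UrE y : cyl_r y != 0 -> Ur y = ang y * cyl_r y.
Proof. by move=> y0; rewrite /ang divfK. Qed.

Lemma wderiv_vel i j : wderiv j (vel i) (a i j).
Proof. exact: weak_partial_wderiv (wgU i j). Qed.

Definition DrUr i y := X ix1 y * a ix1 i y + (ix1 == i)%:R * vel ix1 y +
  (X ix2 y * a ix2 i y + (ix2 == i)%:R * vel ix2 y).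

Lemma wrUr i : wderiv i rUr (DrUr i).
Proof.
have := wderivD (wderiv_elemM (@elem_crd R ix1) (wderiv_vel ix1 i)) (wderiv_elemM (@elem_crd R ix2) (wderiv_vel ix2 i)).
by rewrite !partial_crd.
Qed.

Lemma La i j : Lloc (a i j). Proof. by have [] := wderiv_vel i j. Qed.

Lemma LX i f : Lloc f -> Lloc (fun y => X i y * f y).
Proof. by apply: BlocMLloc; exact: elem_Bloc (@elem_crd R i). Qed.

Lemma I_wderiv i f g phi : wderiv i f g -> TF phi ->
  II (fun y => f y * d_ i phi y) = - II (fun y => g y * phi y).
Proof. by move=> [_ _]; apply. Qed.

Lemma TFoX i psi : TFo psi -> TFo (fun y => X i y * psi y).
Proof. exact: TFo_mul (@elem_crd R i). Qed.

(** Derivatives of r chi give back r times the derivative and a lower order term, so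
    that only r Ur and the Cartesian components remain. *)
Lemma Ur_partial i chi y : TFo chi -> Ur y * d_ i (fun z => cyl_r z * chi z) y =
  rUr y * d_ i chi y + (vel ix1 y * (ix1 == i)%:R + vel ix2 y * (ix2 == i)%:R) * chi y.
Proof.
move=> tc; have [tr E] := TFo_r tc; have [y0|y0] := eqVneq (cyl_r y) 0.
  by rewrite (TFo_axis (TFo_partial i tr) y0) (TFo_axis (TFo_partial i tc) y0) (TFo_axis tc y0) !mulr0 addr0.
rewrite (UrE y0) -mulrA E rUrE vel1 vel2; ring.
Qed.

Section swirlfree.
Variables Ur_r Ur_3 U3_r U3_3 : T -> R.
Hypothesis hUr_r : weak_dr Ur Ur_r.
Hypothesis hUr_3 : weak_d3 Ur Ur_3.
Hypothesis hU3_r : weak_dr U3 U3_r.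
Hypothesis hU3_3 : weak_d3 U3 U3_3.

Lemma U3_vel : U3 = vel ix3. Proof. by apply/funext => y; rewrite vel3. Qed.

Lemma rU3_r : {ae mu3, forall y, cyl_r y * U3_r y = X ix1 y * a ix3 ix1 y + X ix2 y * a ix3 ix2 y}.
Proof.
have [_ lr _] := hU3_r.
apply: eq_off.
- by apply: BlocMLoff; [exact: cyl_r_Bloc|exact: loc_Loff].
- by apply: Lloc_Loff; apply: LlocD; apply: LX; exact: La.
move=> psi tp; have [t1 _] := TFoX ix1 tp; have [t2 _] := TFoX ix2 tp.
transitivity (II (fun y => U3_r y * (cyl_r y * psi y))); first by apply: I_ext => y; ring.
rewrite (dr_test hU3_r tp) U3_vel (I_wderiv (wderiv_vel ix3 ix1) t1) (I_wderiv (wderiv_vel ix3 ix2) t2) !opprK.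
rewrite -ID; [|exact: Lloc_TF (La _ _) t1|exact: Lloc_TF (La _ _) t2].
by apply: I_ext => y; ring.
Qed.

Lemma U3_3E : {ae mu3, forall y, U3_3 y = a ix3 ix3 y}.
Proof.
have [_ lr H] := hU3_3.
apply: eq_off; [exact: loc_Loff|exact: Lloc_Loff (La _ _)|move=> psi tp; have [t1 _] := tp].
have := H _ (TFo_test tp); rewrite /dist_d3 /dist_partial /dist_of => <-.
by rewrite U3_vel (I_wderiv (wderiv_vel ix3 ix3) t1) opprK.
Qed.

Lemma rUr_3 : {ae mu3, forall y, cyl_r y * Ur_3 y = X ix1 y * a ix1 ix3 y + X ix2 y * a ix2 ix3 y}.
Proof.
have [_ lr H] := hUr_3.
apply: eq_off.
- by apply: BlocMLoff; [exact: cyl_r_Bloc|exact: loc_Loff].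
- by apply: Lloc_Loff; apply: LlocD; apply: LX; exact: La.
move=> psi tp; have [t1 _] := tp; have [tr _] := TFo_r tp.
transitivity (II (fun y => Ur_3 y * (cyl_r y * psi y))); first by apply: I_ext => y; ring.
have := H _ (TFo_test tr); rewrite /dist_d3 /dist_partial /dist_of => <-.
rewrite (_ : II (fun y => Ur y * _) = II (fun y => rUr y * d_ ix3 psi y)); last first.
  by apply: I_ext => y; rewrite (Ur_partial ix3 y tp) /= !mulr0 addr0 mul0r addr0.
rewrite (I_wderiv (wrUr ix3) t1) opprK; apply: I_ext => y.
by rewrite /DrUr /= !mul0r !addr0.
Qed.

Lemma rad2Ur_r : {ae mu3, forall y, rad2 y * Ur_r y =
  X ix1 y * (X ix1 y * a ix1 ix1 y + X ix2 y * a ix2 ix1 y) +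
  X ix2 y * (X ix1 y * a ix1 ix2 y + X ix2 y * a ix2 ix2 y)}.
Proof.
have [_ lr _] := hUr_r.
apply: eq_off.
- by apply: BlocMLoff; [exact: elem_Bloc (@elem_rad2 R)|exact: loc_Loff].
- by apply: Lloc_Loff; do ![apply: LlocD|apply: LX]; exact: La.
move=> psi tp; have [t1 _] := TFoX ix1 tp; have [t2 _] := TFoX ix2 tp; have [tr _] := TFo_r tp.
transitivity (II (fun y => Ur_r y * (cyl_r y * (cyl_r y * psi y)))).
  by apply: I_ext => y; rewrite -cyl_r2; ring.
rewrite (dr_test hUr_r tr).
have K i : TFo (fun y => X i y * psi y) -> ix3 != i ->
   II (fun y => Ur y * d_ i (fun z => X i z * (cyl_r z * psi z)) y) =
   - II (fun y => (X ix1 y * a ix1 i y + X ix2 y * a ix2 i y) * (X i y * psi y)).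
  move=> tx i3; have [tx1 _] := tx.
  have E : (fun z => X i z * (cyl_r z * psi z)) = (fun z => cyl_r z * (X i z * psi z)).
    by apply/funext => z; rewrite mulrCA.
  rewrite E; transitivity (II (fun y => rUr y * d_ i (fun z => X i z * psi z) y + vel i y * (X i y * psi y))).
    apply: I_ext => y; rewrite (Ur_partial i y tx); congr (_ + _ * _).
    by move: i3; case: (ord3P i) => [->|[->|->]] //= _; rewrite !mulr1 !mulr0 ?addr0 ?add0r.
  have lu : Lloc (vel i) by have [] := wderiv_vel i i.
  have [lB lDB _] := wrUr i; have tdx := TF_partial i tx1.
  rewrite ID; [|exact: Lloc_TF|exact: Lloc_TF].
  rewrite (I_wderiv (wrUr i) tx1) -mulN1r -IZ; last exact: Lloc_TF.
  rewrite -[in RHS]mulN1r -IZ; last by apply: Lloc_TF => //; apply: LlocD; apply: LX; exact: La.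
  rewrite -ID; [|by apply: itgZ; exact: Lloc_TF|exact: Lloc_TF].
  apply: I_ext => y; rewrite /DrUr.
  by move: i3; case: (ord3P i) => [->|[->|->]] //= _; ring.
rewrite (K ix1 (TFoX ix1 tp))// (K ix2 (TFoX ix2 tp))// !opprK.
have l i : Lloc (fun y => X ix1 y * a ix1 i y + X ix2 y * a ix2 i y).
  by apply: LlocD; apply: LX; exact: La.
rewrite -ID; [|exact: Lloc_TF|exact: Lloc_TF].
by apply: I_ext => y; ring.
Qed.

End swirlfree.

Hypothesis hdiv : dist_eq (@off_axis R)
        (dist_add
          (dist_mul (fun y => (cyl_r y)^-1)
             (dist_dr (dist_of (fun y => cyl_r y * Ur y))))
          (dist_d3 (dist_of U3)))
        (@dist0 R).

Let div_arith (m s x1 x2 ux1 ux2 q1 q2 z1 z2 p p1 p2 : R) : ux1 = m * x1 -> ux2 = m * x2 ->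
  s = x1 * x1 + x2 * x2 ->
  q1 = x1 * p1 + p * 1 -> q2 = x2 * p2 + p * 1 ->
  z1 = s * p1 + p * (x1 * 1 + x1 * 1 + (x2 * 0 + x2 * 0)) ->
  z2 = s * p2 + p * (x1 * 0 + x1 * 0 + (x2 * 1 + x2 * 1)) ->
  (m * s) * q1 + (m * s) * q2 = ux1 * z1 + ux2 * z2.
Proof. by move=> -> -> -> -> -> -> ->; ring. Qed.

(** With the test function r^2 psi both weak forms of the divergence coincide
    pointwise before integration. *)
Lemma div0 : {ae mu3, forall y, a ix1 ix1 y + a ix2 ix2 y + a ix3 ix3 y = 0}.
Proof.
have lD : Lloc (fun y => a ix1 ix1 y + a ix2 ix2 y + a ix3 ix3 y).
  by apply: LlocD; [apply: LlocD|]; exact: La.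
suff H : {ae mu3, forall y, rad2 y * (a ix1 ix1 y + a ix2 ix2 y + a ix3 ix3 y) = 0}.
  apply: (ae2 H (rad2_ae R)) => y /eqP; rewrite mulf_eq0 => /orP[/eqP ->|/eqP//].
  by rewrite ltxx.
apply: flcv_off.
  apply: Lloc_Loff; apply: BlocMLloc => //; exact: elem_Bloc (@elem_rad2 R).
move=> psi tp; have tq := TFo_mul (@elem_rad2 R) tp; have [tq1 _] := tq.
have [[ap _] _] := tp.
have [t1 _] := TFoX ix1 tp; have [t2 _] := TFoX ix2 tp.
have := hdiv (TFo_test tq).
rewrite /dist_d3 /dist_dr /dist_add /dist_mul /dist_partial /dist_of /dist0.
have E (x : T -> R) : (fun y => x y / cyl_r y * ((cyl_r y)^-1 * (rad2 y * psi y))) = (fun y => x y * psi y).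
  apply/funext => y; have [r0|r0] := eqVneq (cyl_r y) 0.
    by rewrite (TFo_axis tp r0) !mulr0.
  by rewrite -cyl_r2; field.
have E1 := E (fun y => y.1.1); have E2 := E (fun y => y.1.2); cbv beta in E1, E2.
rewrite {}E1 {}E2 => H.
have rE y phi : TFo phi -> cyl_r y * Ur y * phi y = rUr y * phi y.
  move=> tphi; have [r0|r0] := eqVneq (cyl_r y) 0; first by rewrite (TFo_axis tphi r0) !mulr0.
  by rewrite (UrE r0) rUrE -cyl_r2; ring.
have td1 := TFo_partial ix1 (TFoX ix1 tp); have td2 := TFo_partial ix2 (TFoX ix2 tp).
have {}H : II (fun y => rUr y * d_ ix1 (fun z => X ix1 z * psi z) y) +
   II (fun y => rUr y * d_ ix2 (fun z => X ix2 z * psi z) y) +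
   II (fun y => vel ix3 y * d_ ix3 (fun z => rad2 z * psi z) y) = 0.
  apply: oppr_inj; rewrite oppr0 -H U3_vel !opprD; congr (_ + _ + _); congr (- _).
    by apply: I_ext => y; rewrite (rE y _ td1).
  by apply: I_ext => y; rewrite (rE y _ td2).
have [lB _ _] := wrUr ix1.
have lu i : Lloc (vel i) by have [] := wderiv_vel i i.
have tz i := TF_partial i tq1.
rewrite -ID in H; [|by case: td1 => ? _; exact: Lloc_TF|by case: td2 => ? _; exact: Lloc_TF].
have {}H : II (fun y => vel ix1 y * d_ ix1 (fun z => rad2 z * psi z) y) +
   II (fun y => vel ix2 y * d_ ix2 (fun z => rad2 z * psi z) y) +
   II (fun y => vel ix3 y * d_ ix3 (fun z => rad2 z * psi z) y) = 0.
  rewrite -{}H; congr (_ + _).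
  rewrite -ID; [|exact: Lloc_TF|exact: Lloc_TF].
  apply: I_ext => y; symmetry.
  have q1 := partial_Xmul ix1 ix1 y ap; have q2 := partial_Xmul ix2 ix2 y ap.
  have z i := congr1 (fun f => f y) (proj2 (derM (@der_rad2 R i) (der_partial i ap))).
  have z1 := z ix1; have z2 := z ix2; cbv beta in z1, z2.
  rewrite rUrE; exact: (div_arith (vel1 y) (vel2 y) (erefl (rad2 y)) q1 q2 z1 z2).
have W i := I_wderiv (wderiv_vel i i) tq1.
have {}H := etrans (esym (congr2 +%R (congr2 +%R (W ix1) (W ix2)) (W ix3))) H.
have Li i := Lloc_TF (La i i) tq1.
rewrite -!opprD -ID// -ID// in H; last by apply: itgD.
move/eqP: H; rewrite oppr_eq0 => /eqP H; rewrite -[RHS]H.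
by apply: I_ext => y; ring.
Qed.

End cylindrical.

Section momentum.
Variable R : realType.
Local Notation T := (vec3 R).
Local Notation mu3 := (leb3 R).
Local Notation mT := (measurableTypeR R * measurableTypeR R * measurableTypeR R)%type.
Local Notation M f := (@measurable_fun _ _ mT R setT f).
Implicit Types (i : 'I_3) (f phi : T -> R) (c t : R) (y v : T).
Local Notation X := (@coord3 R).
Local Notation d_ := (@partial R).
Local Notation "'II' f" := (\int[mu3]_(y in setT) f y) (at level 10, f at level 9).

Lemma off_M f phi : @measurable_fun _ _ mT R (@off_axis R) f -> TFo phi -> M (fun y => f y * phi y).
Proof.
move=> mf tp; have [t1 _] := tp.
rewrite (_ : (fun y => _) = (fun y => (f \_ (@off_axis R)) y * phi y)).
  apply: measurable_funM; last exact: TF_meas.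
  by have := (measurable_restrictT f (@measurable_off R)).1; apply; exact: mf.
apply/funext => y; rewrite patchE; case: ifPn => // /negP ny.
rewrite (TFo_axis tp) ?mulr0//; apply/eqP; rewrite eq_le cyl_r_ge0 andbT leNgt.
by apply/negP => H; apply: ny; rewrite inE.
Qed.

Let pressure_arith (x1 x2 p p1 p2 p3 p13 p31 p23 p32 ch e1 e2 q1 q2 c3 : R) :
  p31 = p13 -> p32 = p23 -> ch = -1 * p3 -> e1 = -1 * p13 + p3 * 0 -> e2 = -1 * p23 + p3 * 0 ->
  q1 = x1 * e1 + ch * 1 -> q2 = x2 * e2 + ch * 1 ->
  c3 = x1 * p31 + p1 * 0 + (x2 * p32 + p2 * 0) + (2 * p3 + p * 0) ->
  q1 + q2 + c3 = 0.
Proof. by move=> -> -> -> -> -> -> -> ->; ring. Qed.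

(** The tests form a divergence free field. *)
Lemma pressure_free phi y : elem phi ->
  d_ ix1 (fun z => X ix1 z * (-1 * d_ ix3 phi z)) y + d_ ix2 (fun z => X ix2 z * (-1 * d_ ix3 phi z)) y
  + d_ ix3 (chi3 phi) y = 0.
Proof.
move=> ap; have a3 := elem_partial ix3 ap.
have ac := elem_mul (@elem_cst R (-1)) a3.
have E i := congr1 (fun f => f y) (proj2 (derM (der_cst i (-1)) (der_partial i a3))).
exact: (pressure_arith (partialC_pt ix3 ix1 y ap) (partialC_pt ix3 ix2 y ap) (erefl _) (E ix1) (E ix2)
  (partial_Xmul ix1 ix1 y ac) (partial_Xmul ix2 ix2 y ac) (partial_chi3 ix3 y ap)).
Qed.

Lemma TFo_chi3 phi : TFo phi -> TFo (chi3 phi).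
Proof.
move=> tp; apply: TFo_add; last exact: TFo_mul (elem_cst _) tp.
by apply: TFo_add; (apply: TFo_mul; [exact: elem_crd|exact: TFo_partial]).
Qed.

(** The two momentum equations are tested with r times - d_3 phi and with [chi3
    phi]; the pressure integrals add up to the integral of [pressure_free]. *)
Lemma momentum_weak (Fr F3 P : T -> R) phi : Lloc P ->
  dist_eq (@off_axis R) (dist_add (dist_of Fr) (dist_dr (dist_of P))) (@dist0 R) ->
  dist_eq (@off_axis R) (dist_add (dist_of F3) (dist_d3 (dist_of P))) (@dist0 R) ->
  TFo phi ->
  II (fun y => Fr y * (cyl_r y * (-1 * d_ ix3 phi y))) + II (fun y => F3 y * chi3 phi y) = 0.
Proof.
move=> lP hr hz tp; have [[ap _] _] := tp.
have tc : TFo (fun y => -1 * d_ ix3 phi y) by apply: TFo_mul; [exact: elem_cst|exact: TFo_partial].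
have [tr _] := TFo_r tc; have t3 := TFo_chi3 tp.
have := hr _ (TFo_test tr); have := hz _ (TFo_test t3).
rewrite /dist_d3 /dist_dr /dist_add /dist_mul /dist_partial /dist_of /dist0.
have E1 := divr_cancel (X ix1) tc; have E2 := divr_cancel (X ix2) tc.
rewrite {}E1 {}E2.
have [tx1 _] := TFo_mul (@elem_crd R ix1) tc; have [tx2 _] := TFo_mul (@elem_crd R ix2) tc.
have i1 := Lloc_TF lP (TF_partial ix1 tx1); have i2 := Lloc_TF lP (TF_partial ix2 tx2).
have [t31 _] := t3; have i3 := Lloc_TF lP (TF_partial ix3 t31).
have : II (fun y => P y * d_ ix1 (fun z => X ix1 z * (-1 * d_ ix3 phi z)) y) +
  II (fun y => P y * d_ ix2 (fun z => X ix2 z * (-1 * d_ ix3 phi z)) y) +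
  II (fun y => P y * d_ ix3 (chi3 phi) y) = 0.
  rewrite -ID// -ID//; last exact: itgD.
  rewrite -[RHS](_ : II (fun=> 0) = 0); last by rewrite /Rintegral integral0.
  by apply: I_ext => y; rewrite -!mulrDr pressure_free// mulr0.
have ar (v1 v2 v3 v4 v5 : R) : v3 + v4 + v5 = 0 -> v2 + - v5 = 0 -> v1 + (- v3 + - v4) = 0 ->
  v1 + v2 = 0 by lra.
exact: ar.
Qed.

End momentum.

(** * Truncation and growth *)

Section truncation.
Variable R : realType.
Local Notation T := (vec3 R).
Local Notation mu3 := (leb3 R).
Local Notation mT := (measurableTypeR R * measurableTypeR R * measurableTypeR R)%type.
Local Notation M f := (@measurable_fun _ _ mT R setT f).
Implicit Types (i j : 'I_3) (f g : T -> R) (N C : R) (y : T).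
Local Notation X := (@coord3 R).

Lemma M_le f C : M f -> @measurable _ mT [set y | `|f y| <= C].
Proof.
move=> mf; have -> : [set y | `|f y| <= C] = (fun y => `|f y|) @^-1` `]-oo, C]%classic.
  by apply/seteqP; split => y /=; rewrite in_itv.
rewrite -[X in measurable X]setTI.
have H : M (fun y => `|f y|) by apply: measurableT_comp mf; exact: normr_measurable.
by apply: H => //; exact: measurable_itv.
Qed.

Lemma M_indic f (A : set T) : M f -> @measurable _ mT A -> M (fun y => \1_A y * f y).
Proof. by move=> mf mA; apply: measurable_funM => //; exact: measurable_indic. Qed.

(** The bounds of the hypotheses hold almost everywhere only. Truncated functions
    agree with the original ones almost everywhere and are bounded everywhere. *)
Definition trunc C f y : R := \1_[set z | `|f z| <= C] y * f y.

Lemma truncE C f y : `|f y| <= C -> trunc C f y = f y.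
Proof. by move=> H; rewrite /trunc indicE mem_set ?mul1r. Qed.

Lemma trunc_le C f y : 0 <= C -> `|trunc C f y| <= C.
Proof.
move=> C0; have [H|H] := leP `|f y| C; first by rewrite truncE.
by rewrite /trunc indicE memNset ?mul0r ?normr0//= => K; move: H; rewrite ltNge K.
Qed.

Lemma trunc_odd C f y z : f y = - f z -> trunc C f y = - trunc C f z.
Proof.
move=> E; rewrite /trunc !indicE E mulrN; congr (- (_%:R * _)); congr nat_of_bool.
by apply/idP/idP; rewrite !inE /= E normrN.
Qed.

Lemma Bloc_bounded f C : M f -> (forall y, `|f y| <= C) -> Bloc f.
Proof. by move=> mf fC; split => // N; exists C => y _. Qed.

Lemma Bloc_trunc f C : M f -> 0 <= C -> Bloc (trunc C f).
Proof.
move=> mf C0; apply: (@Bloc_bounded _ C); last by move=> y; exact: trunc_le.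
by apply: M_indic => //; exact: M_le.
Qed.

Lemma wderiv_trunc i f g C C' : 0 <= C -> 0 <= C' -> wderiv i f g ->
  {ae mu3, forall y, `|f y| <= C} -> {ae mu3, forall y, `|g y| <= C'} ->
  wderiv i (trunc C f) (trunc C' g).
Proof.
move=> C0 C0' w bf bg; have [[mf _] [mg _] _] := w.
apply: wderiv_ae w _ _ _ _.
- by apply: Bloc_Lloc; exact: Bloc_trunc.
- by apply: Bloc_Lloc; exact: Bloc_trunc.
- by apply: (ae1 bf) => y H; rewrite truncE.
- by apply: (ae1 bg) => y H; rewrite truncE.
Qed.

Lemma coord_le_enorm0 (U : T -> T) i y C : enorm0 U y <= C -> `|X i (U y)| <= C.
Proof.
apply: le_trans; rewrite /enorm0 -sqrtr_sqr ler_wsqrtr// (bigD1 i)//= lerDl.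
by apply: sumr_ge0 => j _; exact: sqr_ge0.
Qed.

Lemma entry_le_enorm1 (A : 'I_3 -> 'I_3 -> T -> R) i j y C : enorm1 A y <= C -> `|A i j y| <= C.
Proof.
apply: le_trans; rewrite /enorm1 -sqrtr_sqr ler_wsqrtr// (bigD1 i)//= (bigD1 j)//=.
rewrite -addrA lerDl addr_ge0//; first by apply: sumr_ge0 => l _; exact: sqr_ge0.
by apply: sumr_ge0 => l _; apply: sumr_ge0 => l' _; exact: sqr_ge0.
Qed.

Lemma enorm0E (U : T -> T) y : enorm0 U y ^+ 2 =
  X ix1 (U y) * X ix1 (U y) + X ix2 (U y) * X ix2 (U y) + X ix3 (U y) * X ix3 (U y).
Proof.
rewrite /enorm0 sqr_sqrtr; last by apply: sumr_ge0 => j _; exact: sqr_ge0.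
rewrite !big_ord_recl big_ord0 addr0 !expr2 addrA.
by have -> : lift ord0 (lift ord0 ord0) = ix3 by exact: val_inj; have -> : lift ord0 ord0 = ix2 by exact: val_inj.
Qed.

End truncation.

Section growth.
Variable R : realType.
Implicit Types (K eps r : R).

(** The choice of radius: (2 r)^(1 - m1) exceeds any constant since m1 < 1. *)
Lemma sublinear (m1 K eps r0 : R) : m1 < 1 -> 0 <= K -> 0 < eps ->
  exists r, [/\ r0 <= r, 1 < 2 * r & K * (2 * r) `^ m1 <= eps * r].
Proof.
move=> m11 K0 eps0.
have e0 : 0 < 1 - m1 by rewrite subr_gt0.
pose Q := (2 * K / eps) `^ (1 - m1)^-1.
pose r := Num.max r0 (Num.max 1 Q).
have r1 : 1 <= r by rewrite !le_max lexx orbT.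
have rQ : Q <= 2 * r.
  apply: (@le_trans _ _ r); first by rewrite !le_max lexx !orbT.
  by rewrite ler_peMl ?ler1n// (le_trans _ r1).
have r20 : 0 < 2 * r by rewrite mulr_gt0// (lt_le_trans _ r1).
exists r; split; first by rewrite le_max lexx.
  by lra.
have H : 2 * K / eps <= (2 * r) `^ (1 - m1).
  have -> : 2 * K / eps = Q `^ (1 - m1).
    rewrite /Q -powRrM mulVf ?gt_eqF// powRr1// divr_ge0 ?mulr_ge0//; exact: ltW.
  by apply: ge0_ler_powR => //; rewrite ?nnegrE ?powR_ge0// ltW.
have E : (2 * r) `^ m1 * (2 * r) `^ (1 - m1) = 2 * r.
  rewrite -powRD; first by rewrite addrC subrK powRr1// ltW.
  by rewrite addrC subrK oner_eq0.
have p0 : 0 < (2 * r) `^ m1 by exact: powR_gt0.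
have : (2 * r) `^ m1 * (2 * K / eps) <= 2 * r by rewrite -[X in _ <= X]E ler_pM2l.
have -> : (2 * r) `^ m1 * (2 * K / eps) = 2 * (K * (2 * r) `^ m1) / eps by ring.
by rewrite ler_pdivrMr//; move: (K * _) => Kp ?; lra.
Qed.

End growth.

(** * The Liouville theorem for self-similar profiles *)

Section rigidity.
Variable R : realType.
Local Notation T := (vec3 R).
Local Notation mu3 := (leb3 R).
Local Notation mT := (measurableTypeR R * measurableTypeR R * measurableTypeR R)%type.
Local Notation M f := (@measurable_fun _ _ mT R setT f).
Implicit Types (i j : 'I_3) (h phi : T -> R) (y : T).
Local Notation X := (@coord3 R).
Local Notation d_ := (@partial R).

Variables (u : 'I_3 -> T -> R) (a : 'I_3 -> 'I_3 -> T -> R)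
  (b : 'I_3 -> 'I_3 -> 'I_3 -> T -> R) (mu : T -> R) (bt k C : R).
Hypothesis wdu : forall i j, wderiv j (u i) (a i j).
Hypothesis wda : forall i j l, wderiv l (a i j) (b i j l).
Hypothesis uC : forall i y, `|u i y| <= C.
Hypothesis aC : forall i j y, `|a i j y| <= C.
Hypothesis mmu : M mu.
Hypothesis muC : forall y, `|mu y| <= C.
Hypothesis u1E : forall y, u ix1 y = mu y * X ix1 y.
Hypothesis u2E : forall y, u ix2 y = mu y * X ix2 y.
Hypothesis diva : {ae mu3, forall y, a ix1 ix1 y + a ix2 ix2 y + a ix3 ix3 y = 0}.
Hypothesis bt0 : 0 < bt.
Hypothesis k0 : 0 < k.
Hypothesis momentum : forall phi, TFo phi ->
  nullint (fun y => (X ix1 y * accel u a bt k ix1 y + X ix2 y * accel u a bt k ix2 y) * (- d_ ix3 phi y) +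
     accel u a bt k ix3 y * chi3 phi y).
Hypothesis growth : forall eps r0 : R, 0 < eps -> exists2 r, r0 <= r &
  \int[mu3]_(y in setT) (usq u y * \1_(cylinder (2 * r)) y) <= eps * r.

Let Bu i : Bloc (u i).
Proof. by have [[mu_ _] _ _] := wdu i i; exact: (Bloc_bounded mu_ (uC i)). Qed.

Let Ba i j : Bloc (a i j).
Proof. by have [_ [ma _] _] := wdu i j; exact: (Bloc_bounded ma (aC i j)). Qed.

Let C0 : 0 <= C. Proof. by apply: le_trans (muC (0, 0, 0)). Qed.

Let rvort_bound y : rvort a y * rvort a y <= 8 * C ^+ 2 * rad2 y.
Proof.
have d i j : `|a i j y - a j i y| <= 2 * C.
  by apply: le_trans (ler_normB _ _) _; have := aC i j y; have := aC j i y; lra.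
have sq i j : (a i j y - a j i y) ^+ 2 <= 4 * C ^+ 2.
  rewrite -(@real_normK _ (a i j y - a j i y)) ?num_real//.
  have -> : 4 * C ^+ 2 = (2 * C) ^+ 2 by ring.
  by rewrite ler_sqr ?nnegrE// mulr_ge0.
have := sq ix1 ix3; have := sq ix2 ix3; rewrite /rvort /rad2.
move: (a ix1 ix3 y - _) (a ix2 ix3 y - _) (X ix1 y) (X ix2 y) (C ^+ 2) => p q x z K H1 H2.
have H3 : (x * p + z * q) * (x * p + z * q) <= (p ^+ 2 + q ^+ 2) * (x * x + z * z).
  by have := sqr_ge0 (x * q - z * p); rewrite !expr2 => ?; nra.
apply: (le_trans H3); apply: ler_wpM2r; last by lra.
by rewrite addr_ge0// -expr2 sqr_ge0.
Qed.

(** By Young's inequality u.y is absorbed by half of bt |y|^2. *)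
Let outward y : 3 * C ^+ 2 / bt ^+ 2 <= nrm2 y ->
  0 <= V u bt ix1 y * X ix1 y + V u bt ix2 y * X ix2 y + V u bt ix3 y * X ix3 y.
Proof.
rewrite ler_pdivrMr ?exprn_gt0// => H.
have K i : - (C * C) <= 2 * bt * (u i y * X i y) + bt * bt * (X i y * X i y).
  have h := sqr_ge0 (u i y + bt * X i y).
  have hu : u i y * u i y <= C * C.
    by rewrite -!expr2 -(@real_normK _ (u i y)) ?num_real// ler_sqr ?nnegrE.
  by move: h hu; rewrite expr2; move: (u i y) (X i y) => p q h hu; nra.
rewrite -(@pmulr_rge0 _ (2 * bt)) ?mulr_gt0// /V.
have := K ix1; have := K ix2; have := K ix3; move: H; rewrite /nrm2 /rad2 !expr2.
by move: (u ix1 y) (u ix2 y) (u ix3 y) (X ix1 y) (X ix2 y) (X ix3 y) => *; lra.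
Qed.

(** First the vorticity vanishes, then the Pohozaev identity applies. *)
Lemma profile_eq0 : {ae mu3, forall y, usq u y = 0}.
Proof.
have transport_sq := nullint_vorticity_sq wdu wda Bu Ba (Bloc_bounded mmu muC) u1E u2E diva momentum.
have L0 : {ae mu3, forall y, rvort a y = 0}.
  apply: (@rvort_eq0 R (rvort a) (lam mu bt) (V u bt) (8 * C ^+ 2) (C + bt) (2 * k + 3 * bt)
    (3 * C ^+ 2 / bt ^+ 2)) => //.
  - by have [] := Bloc_rvort Ba.
  - move=> y; rewrite /lam (le_trans (ler_normD _ _))//.
    by rewrite lerD// gtr0_norm.
  - exact: V1E u1E.
  - exact: V2E u2E.
  - by rewrite addr_gt0// mulr_gt0.
exact: usq_eq0 wdu Bu u1E u2E diva L0 growth.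
Qed.

End rigidity.

Section profile.
Variable R : realType.
Local Notation T := (vec3 R).
Local Notation mu3 := (leb3 R).
Local Notation mT := (measurableTypeR R * measurableTypeR R * measurableTypeR R)%type.
Local Notation M f := (@measurable_fun _ _ mT R setT f).
Implicit Types (i j : 'I_3) (f h : T -> R) (t N : R) (y : T) (n : nat).
Local Notation X := (@coord3 R).

Variables (U : T -> T) (Ur U3 : T -> R) (a : 'I_3 -> 'I_3 -> T -> R) (C : R).
Hypothesis UE : forall y, U y = Ur y *: e_r y + U3 y *: e_3 R.
Hypothesis wgU : weak_gradient U a.
Hypothesis C0 : 0 <= C.
Hypothesis uB : forall i, {ae mu3, forall y, `|vel U i y| <= C}.
Hypothesis aB : forall i j, {ae mu3, forall y, `|a i j y| <= C}.

Lemma M_vel i : M (vel U i).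
Proof. by have [[mu_ _] _ _] := wderiv_vel wgU i i. Qed.

(** The quotient by r is a limit of products with smooth functions. *)
Lemma M_ang : M (ang Ur).
Proof.
pose q n y : R := theta n y * (isq (rreg n y) * isq (rreg n y)).
apply: (@measurable_fun_cvg _ mT R setT (fun n y => q n y * rUr U y) (ang Ur)) => [n|y _].
  apply: measurable_funM.
    have ai := elem_isq (elem_rreg R n) (@rreg_gt0 R n).
    by apply: elem_measurable; apply: elem_mul; [exact: elem_theta|exact: elem_mul].
  by have [[mr _] _ _] := wrUr wgU ix1.
have [r0|r0] := eqVneq (rad2 y) 0.
  have -> : ang Ur y = 0.
    by rewrite /ang cyl_rE r0 sqrtr0 invr0 mulr0.
  rewrite (rUrE UE) r0 mulr0; under eq_fun do rewrite mulr0; exact: cvg_cst.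
have y0 : 0 < rad2 y by rewrite lt_def r0 rad2_ge0.
have [N HN] := exists_nat_inv y0.
have := @cvg_near_cst nat R (ang Ur y) (fun n => q n y * rUr U y) _ eventually_filter.
apply; exists N => // n /= Nn.
have Hn : 2 * n.+1%:R^-1 <= rad2 y.
  apply: le_trans HN; rewrite ler_pM2l// lef_pV2 ?posrE//; by rewrite ler_nat.
rewrite /q theta1// mul1r rregE; last first.
  by apply: le_trans Hn; rewrite ler_peMl ?ler1n// invr_ge0.
have := isq_sqr y0; rewrite expr2 => ->.
by rewrite (rUrE UE) mulrC mulfK.
Qed.

(** Reflecting the i-th coordinate preserves r and y_3 and changes the sign of the
    position vector in that component. *)
Lemma axisym_odd i x t : axisymmetric Ur -> ix3 != i ->
  vel U i (x + t *: std_basis R i) = - vel U i (x + (- 2 * X i x - t) *: std_basis R i).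
Proof.
move=> aU i3.
set y := x + _; set z := x + _.
have uE w : vel U i w = ang Ur w * X i w.
  by move: i3; case: (ord3P i) => [->|[->|->]] // _; [exact: vel1 UE w|exact: vel2 UE w].
have Xi : X i y = - X i z by rewrite /y /z !crd_ray eqxx !mulr1; ring.
have rr : cyl_r y = cyl_r z.
  rewrite !cyl_rE; congr Num.sqrt; rewrite /rad2 /y /z !crd_ray.
  by move: i3; case: (ord3P i) => [->|[->|->]] // _; rewrite /coord3 /=; ring.
have y3 : y.2 = z.2.
  have : X ix3 y = X ix3 z by rewrite /y /z !crd_ray (negbTE i3) !mulr0.
  by [].
by rewrite !uE /ang rr (aU y z rr y3) Xi mulrN.
Qed.

(** The horizontal components are odd, so by [odd_bound] they are at most C times
    the coordinate, which is the same as a bound on Ur / r. *)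
Lemma ang_bound : axisymmetric Ur -> {ae mu3, forall y, `|ang Ur y| <= C}.
Proof.
move=> aU.
have H i : ix3 != i -> {ae mu3, forall y, `|vel U i y| <= C * `|X i y|}.
  move=> i3.
  have w := wderiv_trunc C0 C0 (wderiv_vel wgU i i) (uB i) (aB i i).
  have odd x t := trunc_odd C (@axisym_odd i x t aU i3).
  have H := odd_bound w (Bloc_trunc (M_vel i) C0) (fun y => trunc_le (a i i) y C0) C0 odd.
  by apply: (ae2 H (uB i)) => y h1 h2; rewrite truncE in h1.
apply: (ae3 (H ix1 isT) (H ix2 isT) (rad2_ae R)) => y h1 h2 y0.
rewrite (vel1 UE) normrM in h1; rewrite (vel2 UE) normrM in h2.
have [x0|x0] := eqVneq (X ix1 y) 0; last by rewrite ler_pM2r ?normr_gt0 in h1.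
have [z0|z0] := eqVneq (X ix2 y) 0; last by rewrite ler_pM2r ?normr_gt0 in h2.
by move: y0; rewrite /rad2 x0 z0 !mulr0 addr0 ltxx.
Qed.

Hypothesis angB : {ae mu3, forall y, `|ang Ur y| <= C}.

Definition goodset : set T := [set y | `|ang Ur y| <= C] `&`
  ([set y | `|vel U ix1 y| <= C] `&` [set y | `|vel U ix2 y| <= C]).
Definition tang y : R := \1_goodset y * ang Ur y.
(** The horizontal components are truncated through their common factor, which keeps
    the relation u_i = mu y_i valid everywhere. *)
Definition tvel i y : R := if i == ix3 then trunc C (vel U ix3) y else tang y * X i y.

Lemma M_goodset : @measurable _ mT goodset.
Proof.
apply: measurableI; first exact: M_le M_ang.
by apply: measurableI; apply: M_le; exact: M_vel.
Qed.

Lemma M_tang : M tang.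
Proof. exact: M_indic M_ang M_goodset. Qed.

Lemma tang_le y : `|tang y| <= C.
Proof.
rewrite /tang indicE; have [H|H] := pselect (goodset y); last by rewrite memNset// mul0r normr0.
by rewrite mem_set// mul1r; case: H.
Qed.

Lemma tvelE i y : goodset y -> `|vel U ix3 y| <= C -> tvel i y = vel U i y.
Proof.
move=> gy u3; rewrite /tvel /tang indicE mem_set// mul1r.
by case: (ord3P i) => [->|[->|->]] /=; [rewrite (vel1 UE)|rewrite (vel2 UE)|rewrite truncE].
Qed.

Lemma tvel_le i y : `|tvel i y| <= C.
Proof.
rewrite /tvel; case: ifPn => [_|i3]; first exact: trunc_le.
rewrite /tang indicE; have [H|H] := pselect (goodset y); last by rewrite memNset// !mul0r normr0.
have [_ [h1 h2]] := H; rewrite mem_set// mul1r.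
case: (ord3P i) => [E|[E|E]]; rewrite E in i3 *; last by [].
  by rewrite -(vel1 UE).
by rewrite -(vel2 UE).
Qed.

Lemma good_ae : {ae mu3, forall y, goodset y /\ forall i, tvel i y = vel U i y}.
Proof.
have H : {ae mu3, forall y, goodset y}.
  by apply: (ae3 angB (uB ix1) (uB ix2)) => y h1 h2 h3; split => //; split.
by apply: (ae2 H (uB ix3)) => y gy u3; split => // i; exact: tvelE.
Qed.

Lemma M_tvel i : M (tvel i).
Proof.
rewrite /tvel; case: (i == ix3); first by have [] := Bloc_trunc (M_vel ix3) C0.
by apply: measurable_funM; [exact: M_tang|exact: elem_measurable (@elem_crd R i)].
Qed.

Lemma trunc_ae f : {ae mu3, forall y, `|f y| <= C} -> {ae mu3, forall y, trunc C f y = f y}.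
Proof. by move=> H; apply: (ae1 H) => y h; rewrite truncE. Qed.

Lemma wderiv_tvel i j : wderiv j (tvel i) (trunc C (a i j)).
Proof.
have w := wderiv_vel wgU i j; have [_ [ma _] _] := w.
apply: wderiv_ae w _ _ _ _.
- by apply: Bloc_Lloc; apply: Bloc_bounded (M_tvel i) (tvel_le i).
- by apply: Bloc_Lloc; exact: Bloc_trunc ma C0.
- by apply: (ae1 good_ae) => y [_ ->].
- by apply: (ae1 (trunc_ae (aB i j))) => y ->.
Qed.

Lemma wderiv_tgrad (D2 : 'I_3 -> 'I_3 -> 'I_3 -> T -> R) i j l : weak_hessian a D2 ->
  wderiv l (trunc C (a i j)) (D2 i j l).
Proof.
move=> H; have w := weak_partial_wderiv (H i j l); have [[ma _] l2 _] := w.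
apply: wderiv_ae w _ l2 _ _; last by apply: aeW.
  by apply: Bloc_Lloc; exact: Bloc_trunc ma C0.
by apply: (ae1 (trunc_ae (aB i j))) => y ->.
Qed.

Lemma ae_trunc_grad : {ae mu3, forall y, forall i j, trunc C (a i j) y = a i j y}.
Proof.
have H i : {ae mu3, forall y, forall j, trunc C (a i j) y = a i j y}.
  apply: (ae3 (trunc_ae (aB i ix1)) (trunc_ae (aB i ix2)) (trunc_ae (aB i ix3))) => y h1 h2 h3 j.
  by case: (ord3P j) => [->|[->|->]].
apply: (ae3 (H ix1) (H ix2) (H ix3)) => y h1 h2 h3 i.
by case: (ord3P i) => [->|[->|->]].
Qed.

End profile.

Section euler.
Variable R : realType.
Local Notation T := (vec3 R).
Local Notation mu3 := (leb3 R).
Local Notation mT := (measurableTypeR R * measurableTypeR R * measurableTypeR R)%type.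
Local Notation Mo f := (@measurable_fun _ _ mT R (@off_axis R) f).
Implicit Types (i j : 'I_3) (f g phi : T -> R) (c s t : R) (y : T).
Local Notation X := (@coord3 R).
Local Notation d_ := (@partial R).

Variables (U : T -> T) (Ur U3 P : T -> R) (a : 'I_3 -> 'I_3 -> T -> R) (C : R).
Hypothesis UE : forall y, U y = Ur y *: e_r y + U3 y *: e_3 R.
Hypothesis wgU : weak_gradient U a.
Hypothesis C0 : 0 <= C.
Hypothesis uB : forall i, {ae mu3, forall y, `|vel U i y| <= C}.
Hypothesis aB : forall i j, {ae mu3, forall y, `|a i j y| <= C}.
Hypothesis angB : {ae mu3, forall y, `|ang Ur y| <= C}.
Hypothesis lP : Lloc P.

Variables (Ur_r Ur_3 U3_r U3_3 : T -> R) (al bt k : R).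
Hypothesis hUr_r : weak_dr Ur Ur_r.
Hypothesis hUr_3 : weak_d3 Ur Ur_3.
Hypothesis hU3_r : weak_dr U3 U3_r.
Hypothesis hU3_3 : weak_d3 U3 U3_3.
Hypothesis alE : al = k + bt.

Definition Fr y := al * Ur y + bt * (cyl_r y * Ur_r y + y.2 * Ur_3 y) + Ur y * Ur_r y + U3 y * Ur_3 y.
Definition F3 y := al * U3 y + bt * (cyl_r y * U3_r y + y.2 * U3_3 y) + Ur y * U3_r y + U3 y * U3_3 y.
Hypothesis hr : dist_eq (@off_axis R) (dist_add (dist_of Fr) (dist_dr (dist_of P))) (@dist0 R).
Hypothesis hz : dist_eq (@off_axis R) (dist_add (dist_of F3) (dist_d3 (dist_of P))) (@dist0 R).

Let w := tvel U Ur C.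
Let A i j := trunc C (a i j).
Let G i := accel w A bt k i.

Let Mo_sum f1 f2 g1 g2 : Mo f1 -> Mo f2 -> Mo g1 -> Mo g2 ->
  Mo (fun y => al * f1 y + bt * (cyl_r y * g1 y + y.2 * g2 y) + Ur y * g1 y + f2 y * g2 y).
Proof.
move=> mf1 mf2 mg1 mg2.
have [[mU _] _ _] := hUr_r.
have [mr' _] := cyl_r_Bloc R; have mr : Mo (@cyl_r R) by exact: measurable_funTS mr'.
have mz : Mo (fun y : T => y.2) by exact: measurable_funTS (elem_measurable (@elem_crd R ix3)).
have mc c : Mo (fun=> c) by exact: measurable_cst.
have mM f g (mf : Mo f) (mg : Mo g) : Mo (fun y => f y * g y) := measurable_funM mf mg.
have mD f g (mf : Mo f) (mg : Mo g) : Mo (fun y => f y + g y) := measurable_funD mf mg.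
exact: (mD _ _ (mD _ _ (mD _ _ (mM _ _ (mc al) mf1) (mM _ _ (mc bt) (mD _ _ (mM _ _ mr mg1) (mM _ _ mz mg2))))
  (mM _ _ mU mg1)) (mM _ _ mf2 mg2)).
Qed.

Let Mo_Fr : Mo Fr.
Proof.
have [[m1 _] [m2 _] _] := hUr_r; have [_ [m3 _] _] := hUr_3; have [[m4 _] _ _] := hU3_r.
exact: (Mo_sum m1 m4 m2 m3).
Qed.

Let Mo_F3 : Mo F3.
Proof.
have [[m1 _] [m2 _] _] := hU3_r; have [_ [m3 _] _] := hU3_3.
exact: (Mo_sum m1 m1 m2 m3).
Qed.

Let BG i : Bloc (G i).
Proof.
have Bw j : Bloc (w j) by apply: Bloc_bounded (M_tvel UE wgU C0 j) (tvel_le UE C0 j).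
have BA j l : Bloc (A j l).
  by have [_ [ma _] _] := wderiv_vel wgU j l; exact: Bloc_trunc ma C0.
apply: BlocD; first by apply: BlocM => //; exact: Bloc_cst.
by apply: BlocD; [apply: BlocD|]; apply: BlocM => //; apply: (Bloc_V _ Bw).
Qed.

Let radial_arith (r m x1 x2 x3 ur u1 u2 u3 dr d3 a11 a12 a13 a21 a22 a23 s p : R) :
  ur = m * r -> u1 = m * x1 -> u2 = m * x2 -> s = r * r -> s = x1 * x1 + x2 * x2 ->
  r * d3 = x1 * a13 + x2 * a23 ->
  s * dr = x1 * (x1 * a11 + x2 * a21) + x2 * (x1 * a12 + x2 * a22) ->
  (al * ur + bt * (r * dr + x3 * d3) + ur * dr + u3 * d3) * (r * (-1 * p)) =
  (x1 * ((k + bt) * u1 + ((u1 + bt * x1) * a11 + (u2 + bt * x2) * a12 + (u3 + bt * x3) * a13)) +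
   x2 * ((k + bt) * u2 + ((u1 + bt * x1) * a21 + (u2 + bt * x2) * a22 + (u3 + bt * x3) * a23))) * (- p).
Proof.
move=> -> -> -> sr sx E1 E2.
have -> : (al * (m * r) + bt * (r * dr + x3 * d3) + m * r * dr + u3 * d3) * (r * (-1 * p)) =
  (al * m * (r * r) + (m + bt) * ((r * r) * dr) + (u3 + bt * x3) * (r * d3)) * (- p) by ring.
by rewrite -sr E2 E1 sx alE; ring.
Qed.

Let axial_arith (r m x1 x2 x3 ur u1 u2 u3 dr d3 a31 a32 a33 q : R) :
  ur = m * r -> u1 = m * x1 -> u2 = m * x2 ->
  r * dr = x1 * a31 + x2 * a32 -> d3 = a33 ->
  (al * u3 + bt * (r * dr + x3 * d3) + ur * dr + u3 * d3) * q =
  ((k + bt) * u3 + ((u1 + bt * x1) * a31 + (u2 + bt * x2) * a32 + (u3 + bt * x3) * a33)) * q.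
Proof.
move=> -> -> -> E1 ->.
have -> : (al * u3 + bt * (r * dr + x3 * a33) + m * r * dr + u3 * a33) * q =
  (al * u3 + (m + bt) * (r * dr) + (u3 + bt * x3) * a33) * q by ring.
by rewrite E1 alE; ring.
Qed.

Let raw_ae : {ae mu3, forall y, forall p q,
  Fr y * (cyl_r y * (-1 * p)) = (X ix1 y * G ix1 y + X ix2 y * G ix2 y) * (- p) /\
  F3 y * q = G ix3 y * q}.
Proof.
have H1 := ae2 (rUr_3 UE wgU hUr_3) (rad2Ur_r UE wgU hUr_r) (fun y => @conj _ _).
have H2 := ae2 (rU3_r UE wgU hU3_r) (U3_3E UE wgU hU3_3) (fun y => @conj _ _).
have H3 := ae3 (good_ae UE uB angB) (ae_trunc_grad aB) (rad2_ae R) (fun y q1 q2 q3 => conj q1 (conj q2 q3)).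
apply: (ae3 H1 H2 H3) => y [e1 e2] [e3 e4] [[_ wE] [AE y0]] p q.
have r0 : cyl_r y != 0 by rewrite gt_eqF// cyl_r_gt0.
have ur := UrE Ur r0; have e5 := esym (cyl_r2 y).
rewrite /G /accel /V /w /A !wE !AE.
split.
  have := radial_arith (X ix3 y) (vel U ix3 y) p ur (vel1 UE y) (vel2 UE y) e5 (erefl (rad2 y)) e1 e2.
  by rewrite {1}(vel3 UE) /Fr => <-.
have := axial_arith (X ix3 y) (vel U ix3 y) q ur (vel1 UE y) (vel2 UE y) e3 e4.
by rewrite (vel3 UE) /F3 => <-.
Qed.

(** The weak momentum equation for the truncated profile, in the form required by
    the transport argument. The cylindrical derivatives are replaced by the
    Cartesian ones almost everywhere. *)
Lemma momentum_clean phi : TFo phi ->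
  nullint (fun y => (X ix1 y * G ix1 y + X ix2 y * G ix2 y) * (- d_ ix3 phi y) + G ix3 y * chi3 phi y).
Proof.
move=> tp; have [t1 _] := tp; have t3 := TFo_chi3 tp; have [t31 _] := t3.
have td := TFo_mul (@elem_cst R (-1)) (TFo_partial ix3 tp); have [td1 _] := td.
have [tr _] := TFo_r td.
have BX i : Bloc (X i) by exact: elem_Bloc (@elem_crd R i).
have i1 : itg mu3 (fun y => (X ix1 y * G ix1 y + X ix2 y * G ix2 y) * (- d_ ix3 phi y)).
  have B1 : Bloc (fun y => X ix1 y * G ix1 y + X ix2 y * G ix2 y).
    by apply: BlocD; apply: BlocM.
  by apply: itg_ext (Lloc_TF (Bloc_Lloc B1) td1) => y; rewrite mulN1r.
have i2 : itg mu3 (fun y => G ix3 y * chi3 phi y) by exact: Lloc_TF (Bloc_Lloc (BG ix3)) t31.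
split; first exact: itgD.
rewrite ID// -[RHS](momentum_weak lP hr hz tp); congr (_ + _).
  apply: I_ae; [exact: itg_meas i1|exact: off_M Mo_Fr tr|].
  by apply: (ae1 raw_ae) => y /(_ (d_ ix3 phi y) 0) [].
apply: I_ae; [exact: itg_meas i2|exact: off_M Mo_F3 t3|].
by apply: (ae1 raw_ae) => y /(_ 0 (chi3 phi y)) [].
Qed.

End euler.

Section energy.
Variable R : realType.
Local Notation T := (vec3 R).
Local Notation mu3 := (leb3 R).
Local Notation mT := (measurableTypeR R * measurableTypeR R * measurableTypeR R)%type.
Local Notation M f := (@measurable_fun _ _ mT R setT f).
Implicit Types (i j : 'I_3) (c s : R) (y : T).
Local Notation X := (@coord3 R).

(** The other two terms of the supremum are nonnegative. *)
Lemma energy_bound (U : T -> T) (F G : R -> \bar R) (m1 : R) :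
  (forall b : R, (0 <= F b)%E) -> (forall b : R, (0 <= G b)%E) ->
  (ereal_sup [set ((b `^ m1)^-1%:E * \int[mu3]_(y in cylinder b) (enorm0 U y ^+ 2)%:E + F b + G b)%E
     | b in [set b : R | (1 < b)%R]] < +oo)%E ->
  exists2 K : R, 0 <= K & forall b : R, 1 < b ->
    (\int[mu3]_(y in cylinder b) (enorm0 U y ^+ 2)%:E <= (K * b `^ m1)%:E)%E.
Proof.
move=> F0 G0; set S := ereal_sup _ => Sfin.
have I0 b : (0 <= \int[mu3]_(y in cylinder b) (enorm0 U y ^+ 2)%:E)%E.
  by apply: integral_ge0 => y _; rewrite lee_fin sqr_ge0.
have ub (b : R) : 1 < b ->
    ((b `^ m1)^-1%:E * \int[mu3]_(y in cylinder b) (enorm0 U y ^+ 2)%:E <= S)%E.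
  move=> b1; apply: (@le_trans _ _ ((b `^ m1)^-1%:E * \int[mu3]_(y in cylinder b) (enorm0 U y ^+ 2)%:E + F b + G b)%E).
    by rewrite -addeA leeDl// adde_ge0.
  by apply: ereal_sup_ubound; exists b.
have S0 : (0 <= S)%E.
  apply: le_trans (ub 2 _); last by rewrite ltr1n.
  by rewrite mule_ge0// lee_fin invr_ge0 powR_ge0.
have SE : S = (fine S)%:E by rewrite fineK// ge0_fin_numE.
exists (fine S); first by rewrite fine_ge0.
move=> b b1; have p0 : 0 < b `^ m1 by rewrite powR_gt0// (lt_trans _ b1).
have := ub b b1; rewrite SE muleC => H.
by rewrite EFinM -lee_pdivrMr.
Qed.

Lemma energy_Rintegral (U : T -> T) (u : 'I_3 -> T -> R) (b B : R) :
  (forall i, Bloc (u i)) -> (forall i, M (fun y => X i (U y))) ->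
  {ae mu3, forall y, forall i, u i y = X i (U y)} ->
  (\int[mu3]_(y in cylinder b) (enorm0 U y ^+ 2)%:E <= B%:E)%E ->
  \int[mu3]_(y in setT) (usq u y * \1_(cylinder b) y) <= B.
Proof.
move=> Bu mU uE H.
have mC := @cylinder_measurable R b.
rewrite -lee_fin I_EFin; last exact: usq_cyl_itg.
apply: le_trans H; rewrite le_eqVlt; apply/orP; left; apply/eqP.
have -> : (\int[mu3]_y (usq u y * \1_(cylinder b) y)%:E =
   \int[mu3]_(y in cylinder b) (usq u y)%:E)%E.
  rewrite [RHS]integral_mkcond; apply: eq_integral => y _; rewrite patchE indicE.
  by case: ifPn => _; rewrite ?mulr1 ?mulr0.
have [musq _] := Bloc_usq Bu.
apply: ae_eq_integral => //.
- by apply: measurable_funTS; exact/measurable_EFinP.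
- apply: measurable_funTS; apply/measurable_EFinP.
  rewrite (_ : (fun y => enorm0 U y ^+ 2) = (fun y => X ix1 (U y) * X ix1 (U y) +
    X ix2 (U y) * X ix2 (U y) + X ix3 (U y) * X ix3 (U y))).
    have mm i : M (fun y => X i (U y) * X i (U y)) by exact: measurable_funM.
    by apply: measurable_funD; [exact: measurable_funD|].
  by apply/funext => y; exact: enorm0E.
- by apply: (ae1 uE) => y yE _; rewrite enorm0E /usq !yE.
Qed.

End energy.
Theorem proposition3p1 (R : realType)
  (m m1 alpha s1 l1 gamma : R)
  (hm : 1 / 2 <= m) (hm' : m < 1)
  (hm1 : m1 = 2 * m - 1) (halpha : alpha = 2 - m)
  (hs1 : 1 < s1) (hl1 : 1 < l1)
  (hsl : 3 / s1 + 2 / l1 = 4)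
  (hs1_lo : 3 / (alpha + 1) < s1) (hs1_hi : s1 < 3 / 2)
  (hgamma : gamma = 1 - (3 / (2 * s1) - 1) * (1 - m))
  (U : vec3 R -> vec3 R) (Ur U3 P : vec3 R -> R)
  (DU : 'I_3 -> 'I_3 -> vec3 R -> R)
  (D2U : 'I_3 -> 'I_3 -> 'I_3 -> vec3 R -> R)
  (hU : axisymmetric_no_swirl U Ur U3)
  (hP : axisymmetric P)
  (hPloc : loc_integrable [set: vec3 R] P)
  (hDU : weak_gradient U DU)
  (hD2U : weak_hessian DU D2U)
  (hEuler : selfsimilar_euler alpha Ur U3 P)
  (hsup : (ereal_sup
     [set ((b `^ m1)^-1%:E
             * \int[leb3 R]_(y in cylinder b) (enorm0 U y ^+ 2)%:E
           + (b `^ m)^-1%:E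
             * \int[leb3 R]_(y in cylinder b) (enorm1 DU y ^+ 2)%:E
           + (b `^ (gamma * l1))^-1%:E
             * (\int[leb3 R]_(y in cylinder b) (enorm2 D2U y `^ s1)%:E)
                 `^ (l1 / s1))
     | b in [set b : R | (1 < b)%R]] < +oo)%E)
  (c2 c : R)
  (hU_bnd : {ae leb3 R, forall y, enorm0 U y <= c2})
  (hDU_bnd : {ae leb3 R, forall y, enorm1 DU y <= c}) :
  {ae leb3 R, forall y, U y = 0}.
Proof.
have [axUr _ UE] := hU.
have [Ur_r [Ur_3 [U3_r [U3_3 [[hUr_r hUr_3] [hU3_r hU3_3] hr hz hdiv]]]]] := hEuler.
pose bt := (alpha + 1)^-1; pose k := (alpha - 1) / (alpha + 1).
have al1 : 0 < alpha + 1 by rewrite halpha; lra.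
have bt0 : 0 < bt by rewrite invr_gt0.
have k0 : 0 < k by apply: divr_gt0 => //; rewrite halpha; lra.
have alE : alpha / (alpha + 1) = k + bt by rewrite /k /bt; field; rewrite gt_eqF.
pose C := Num.max 0 (Num.max c c2).
have C0 : 0 <= C by rewrite le_max lexx.
have cC : c <= C by rewrite !le_max lexx orbT.
have c2C : c2 <= C by rewrite !le_max lexx !orbT.
have uB i : {ae leb3 R, forall y, `|vel U i y| <= C}.
  by apply: (ae1 hU_bnd) => y H; exact: le_trans (coord_le_enorm0 i H) c2C.
have aB i j : {ae leb3 R, forall y, `|DU i j y| <= C}.
  by apply: (ae1 hDU_bnd) => y H; exact: le_trans (entry_le_enorm1 i j H) cC.
have angB := ang_bound UE hDU C0 uB aB axUr.
have gae := good_ae UE uB angB.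
have wdu := wderiv_tvel UE hDU C0 uB aB angB.
have Bu i : Bloc (tvel U Ur C i).
  exact: Bloc_bounded (M_tvel UE hDU C0 i) (tvel_le UE C0 i).
have div1 : {ae leb3 R, forall y, trunc C (DU ix1 ix1) y + trunc C (DU ix2 ix2) y + trunc C (DU ix3 ix3) y = 0}.
  by apply: (ae2 (div0 UE hDU hdiv) (ae_trunc_grad aB)) => y H E; rewrite !E.
have w0 (b p : R) : (0 <= (b `^ p)^-1%:E)%E by rewrite lee_fin invr_ge0 powR_ge0.
have g0 (b : R) : (0 <= (b `^ m)^-1%:E * \int[leb3 R]_(y in cylinder b) (enorm1 DU y ^+ 2)%:E)%E.
  by apply: mule_ge0 => //; apply: integral_ge0 => y _; rewrite lee_fin sqr_ge0.
have h0 (b : R) : (0 <= (b `^ (gamma * l1))^-1%:E *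
    (\int[leb3 R]_(y in cylinder b) (enorm2 D2U y `^ s1)%:E) `^ (l1 / s1))%E.
  by apply: mule_ge0 => //; exact: poweR_ge0.
have [K K0 HK] := energy_bound g0 h0 hsup.
have growth (eps r0 : R) : 0 < eps -> exists2 r, r0 <= r &
    \int[leb3 R]_(y in setT) (usq (tvel U Ur C) y * \1_(cylinder (2 * r)) y) <= eps * r.
  move=> eps0; have m11 : m1 < 1 by rewrite hm1; lra.
  have [r [r0r r1 Hr]] := sublinear r0 m11 K0 eps0.
  exists r => //; apply: le_trans Hr; apply: energy_Rintegral (HK _ r1) => //.
    exact: M_vel hDU.
  by apply: (ae1 gae) => y [].
have mom := momentum_clean UE hDU C0 uB aB angB (loc_Lloc hPloc) hUr_r hUr_3 hU3_r hU3_3 alE hr hz.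
have us0 := profile_eq0 wdu (fun i j l => wderiv_tgrad C0 aB i j l hD2U) (tvel_le UE C0)
  (fun i j y => trunc_le (DU i j) y C0) (M_tang C UE hDU) (tang_le U Ur C0)
  (fun y => erefl) (fun y => erefl) div1 bt0 k0 mom growth.
apply: (ae2 us0 gae) => y us [_ uE].
have z i : coord3 i (U y) = 0.
  have -> : coord3 i (U y) = tvel U Ur C i y by rewrite uE.
  move/eqP: us; rewrite /usq -!expr2 !paddr_eq0 ?addr_ge0 ?sqr_ge0// !sqrf_eq0.
  by move=> /andP[/andP[/eqP e1 /eqP e2] /eqP e3]; case: (ord3P i) => [->|[->|->]].
have := z ix1; have := z ix2; have := z ix3; case: (U y) => [[p q] r].
by rewrite /coord3 /= => -> -> ->.
Qed.
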